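(* Let $d\ge1$, let $\mu\in M_+(\overline{B}_d)$, and let $b:B_d\to\mathbb{D}$ be a $\mu$-admissible holomorphic function. Put $$g=\frac{d\mu|_{\partial B_d}}{d\sigma},$$ the Radon–Nikodym derivative with respect to $\sigma$ of the absolutely continuous part of the restriction $\mu|_{\partial B_d}$. Assume that $\mu$ is a reverse Carleson measure for the space $\mathcal{H}(b)$. Then there exists a constant $C>0$ such that $$1-|b(\zeta)|^2\ \le\ C\,(1-|b(\zeta)|^2)^2\,g(\zeta)$$ for $\sigma$-almost all points $\zeta\in\partial B_d$.
   Context: $B_d$ is the open unit ball of $\mathbb{C}^d$, $\overline{B}_d$ its closure, $\partial B_d$ the unit sphere, $\sigma=\sigma_d$ the normalized Lebesgue measure on $\partial B_d$, and $\mathbb{D}=B_1$ the open unit disk. $M_+(\overline{B}_d)$ is the set of all finite positive Borel measures on $\overline{B}_d$. $\langle\cdot,\cdot\rangle$ is the standard Hermitian inner product on $\mathbb{C}^d$, linear in the first variable. For a holomorphic function $b:B_d\to\mathbb{D}$, the de Branges–Rovnyak space $\mathcal{H}(b)$ is the reproducing kernel Hilbert space of holomorphic functions on $B_d$ (contained in the Hardy space $H^2(B_d)$) with reproducing kernel $$\mathcal{K}^b(z,w)=\frac{1-b(z)\overline{b(w)}}{(1-\langle z,w\rangle)^d},\quad z,w\in B_d.$$ For $\zeta\in\partial B_d$, $b(\zeta)=\lim_{r\to1-}b(r\zeta)$ denotes the radial limit, which exists $\sigma$-almost everywhere. A holomorphic function $f$ on $B_d$ is called $\mu$-admissible if $f$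 has radial limits $\mu$-almost everywhere on $\partial B_d$ (i.e. $\mu|_{\partial B_d}$-almost everywhere). $\mathcal{H}_\mu(b)$ denotes the set of all $\mu$-admissible functions in $\mathcal{H}(b)$. For $f\in\mathcal{H}_\mu(b)$, $f$ is defined $\mu|_{\partial B_d}$-almost everywhere on $\partial B_d$ by its radial limits, so that $\|f\|_{L^2(\overline{B}_d,\mu)}\in[0,+\infty]$ makes sense. The measure $\mu$ is called a reverse Carleson measure for $\mathcal{H}(b)$ if there is a constant $C>0$ with $\|f\|_{\mathcal{H}(b)}\le C\|f\|_{L^2(\overline{B}_d,\mu)}$ for all $f\in\mathcal{H}_\mu(b)$. *)

(* Defs.v *)
From HB Require Import structures.
From mathcomp Require Import all_boot all_order all_algebra.
From mathcomp Require Import complex.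
From mathcomp Require Import all_classical all_reals all_analysis.
From mathcomp Require Import measurable_realfun lra.
Set Implicit Arguments.
Unset Strict Implicit.
Unset Printing Implicit Defensive.
Import Order.TTheory GRing.Theory Num.Theory numFieldNormedType.Exports.
Import Normc.
Local Open Scope classical_set_scope.
Local Open Scope complex_scope.
Local Open Scope ring_scope.

(* [R[i]] only carries its algebraic and order structure; this gives it the
   topology of its modulus and makes it a normed space over itself, so that
   [differentiable] below means complex differentiable. *)
HB.instance Definition _ (R : rcfType) :=
  NormedModule.copy R[i] (R[i] : numFieldType)^o.

(* C^d with its Borel sigma-algebra.  The norm of 'rV[R[i]]_d is the sup norm;
   the Euclidean one, used for the ball and the sphere, is [enorm]. *)
Notation Cn R d := (g_sigma_algebraType (@open 'rV[R[i]]_d)).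

Section geometry.
Context (R : realType) (d : nat).
Implicit Types z w : 'rV[R[i]]_d.

Definition hdot z w : R[i] := \sum_(j < d) z 0 j * (w 0 j)^*%C.

Definition enorm z : R := Num.sqrt (\sum_(j < d) normc (z 0 j) ^+ 2).

Definition Bd : set 'rV[R[i]]_d := [set z | enorm z < 1].

Definition clBd : set 'rV[R[i]]_d := [set z | enorm z <= 1].

Definition Sd : set 'rV[R[i]]_d := [set z | enorm z = 1].

Definition holomorphic_Bd (f : 'rV[R[i]]_d -> R[i]) :=
  forall z, Bd z -> differentiable f z.

End geometry.
Arguments Bd {R d}.
Arguments clBd {R d}.
Arguments Sd {R d}.

(* The product of a measure mu on T with a measure nu on T^n, on T^(n+1);
   iterated below to get the n-fold product of mu. *)
Section cons_measure.
Context dp (T : measurableType dp) (R : realType) (n : nat).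
Variables (mu : {sigma_finite_measure set T -> \bar R})
          (nu : {sigma_finite_measure set (n.-tuple T) -> \bar R}).

Let consp (p : T * n.-tuple T) : n.+1.-tuple T := [tuple of p.1 :: p.2].

Let measurable_consp : measurable_fun [set: T * n.-tuple T] consp.
Proof. exact: measurable_cons. Qed.

Definition cons_measure := pushforward (mu \x nu)%E consp.

Let cons_measure0 : cons_measure set0 = 0%E.
Proof. by rewrite /cons_measure /pushforward preimage_set0 measure0. Qed.

Let cons_measure_ge0 A : (0 <= cons_measure A)%E.
Proof. exact: measure_ge0. Qed.

Let cons_measure_sigma_additive : semi_sigma_additive cons_measure.
Proof.
exact: (@measure_semi_sigma_additive _ _ _ (pushforward (mu \x nu)%E consp : 
  {measure set _ -> \bar R})).
Qed.

HB.instance Definition _ := isMeasure.Build _ _ _ cons_measure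
  cons_measure0 cons_measure_ge0 cons_measure_sigma_additive.

Let cons_measure_sigma_finite : sigma_finite [set: n.+1.-tuple T] cons_measure.
Proof.
have /sigma_finiteP[F [TF ndF Foo]] := sigma_finiteT mu.
have /sigma_finiteP[G [TG ndG Goo]] := sigma_finiteT nu.
pose u (t : n.+1.-tuple T) : T * n.-tuple T := (thead t, [tuple of behead t]).
have mu_ : measurable_fun [set: n.+1.-tuple T] u.
  apply/measurable_fun_pair; first exact: measurable_tnth.
  exact: measurable_behead.
exists (fun k => u @^-1` (F k `*` G k)).
  rewrite -preimage_bigcup; apply/seteqP; split=> // t _ /=.
  have [i _ Fi] : (\bigcup_k F k) (u t).1 by rewrite -TF.
  have [j _ Gj] : (\bigcup_k G k) (u t).2 by rewrite -TG.
  exists (maxn i j) => //; split.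
    by move: Fi; exact/subsetPset/ndF/leq_maxl.
  by move: Gj; exact/subsetPset/ndG/leq_maxr.
move=> k; have [mF Fk] := Foo k; have [mG Gk] := Goo k; split.
  by rewrite -[X in measurable X]setTI; apply: mu_ => //; exact: measurableX.
rewrite /cons_measure /pushforward -comp_preimage (_ : u \o consp = id).
  rewrite [ltLHS](_ : _ = (mu \x nu)%E (F k `*` G k)) // product_measure1E//.
  by rewrite lte_mul_pinfty// ge0_fin_numE.
by apply/funext => -[x t] /=; congr (_, _); apply/val_inj.
Qed.

HB.instance Definition _ := @Measure_isSigmaFinite.Build _ _ _ cons_measure
  cons_measure_sigma_finite.

End cons_measure.

Fixpoint tuple_measure dp (T : measurableType dp) (R : realType)
    (mu : {sigma_finite_measure set T -> \bar R}) (n : nat) :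
    {sigma_finite_measure set (n.-tuple T) -> \bar R} :=
  match n return {sigma_finite_measure set (n.-tuple T) -> \bar R} with
  | 0 => \d_([tuple] : 0.-tuple T)
  | n'.+1 => cons_measure mu (tuple_measure mu n')
  end.

Lemma tuple_measure_box dp (T : measurableType dp) (R : realType)
    (mu : {sigma_finite_measure set T -> \bar R}) (n : nat) (A : set T) :
  measurable A ->
  tuple_measure mu n [set t | forall i, A (tnth t i)] = (mu A ^+ n)%E.
Proof.
move=> mA; elim: n => [|n IHn] /=.
  by rewrite diracE mem_set// => -[].
rewrite /cons_measure /pushforward (_ : _ @^-1` _ =
    A `*` [set t : n.-tuple T | forall i, A (tnth t i)]); last first.
  apply/seteqP; split => [[x t] /= xt|[x t] /= [Ax At] i].
    by split=> [|i]; [have := xt ord0|have := xt (lift ord0 i); rewrite tnthS].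
  by case: (unliftP ord0 i) => [j|] ->; rewrite ?tnthS.
rewrite product_measure1E//; first by rewrite IHn; case: (n) => //; rewrite mule1.
rewrite (_ : mkset _ = \bigcap_(i in [set: 'I_n]) ((@tnth _ T ^~ i) @^-1` A)).
  apply: fin_bigcap_measurable => // i _.
  by rewrite -[X in measurable X]setTI; exact: measurable_tnth.
by apply/seteqP; split => [t At i _|t At i]; exact: At.
Qed.

Section Cn_measurable.
Context (R : realType) (d : nat).

Let normc_le (x : R[i]) : normc x <= `|complex.Re x| + `|complex.Im x|.
Proof.
case: x => a b /=.
rewrite -[leRHS]ger0_norm ?addr_ge0// -sqrtr_sqr ler_sqrt ?sqr_ge0//.
by rewrite sqrrD !real_normK ?num_real// lerD2r lerDl mulrn_wge0// mulr_ge0.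
Qed.

Let norm_Re_le (x : R[i]) : `|complex.Re x| <= normc x.
Proof. by have := normc_ge_Re x; rewrite normc_def lecR; case: x. Qed.

Let norm_Im_le (x : R[i]) : `|complex.Im x| <= normc x.
Proof.
case: x => a b /=; rewrite -sqrtr_sqr ler_sqrt ?lerDr ?sqr_ge0//.
by rewrite addr_ge0 ?sqr_ge0.
Qed.

Let ltC_norm (x : R[i]) (e : R) : (`|x| < e%:C) = (normc x < e).
Proof. by rewrite normc_def ltcR; case: x. Qed.

Let open_normP (U : set 'rV[R[i]]_d) z : open U -> U z -> exists2 e : R,
  0 < e & forall w : 'rV[R[i]]_d, (forall j, normc (z 0 j - w 0 j) < e) -> U w.
Proof.
move=> oU Uz; have [[a b]] : nbhs_ball z U by apply/nbhs_ballP; exact: open_nbhs_nbhs.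
rewrite /= ltcE/= => /andP[/eqP b0 a0] sU; rewrite {}b0 in sU.
exists a => // w zw; apply: sU; split=> [|i j].
  by rewrite ltcR.
by rewrite ord1 /ball /= ltC_norm.
Qed.

Let norm_open (U : set 'rV[R[i]]_d) : (forall z, U z -> exists2 e : R,
  0 < e & forall w : 'rV[R[i]]_d, (forall j, normc (z 0 j - w 0 j) < e) -> U w) -> open U.
Proof.
move=> UP; rewrite openE => z /UP [e e0 eU]; apply/nbhs_ballP.
exists e%:C; first by rewrite /= ltcR.
move=> w zw; apply: eU => j; rewrite -ltC_norm; exact: zw.2.
Qed.

Lemma measurable_Re_coord (j : 'I_d) :
  measurable_fun [set: Cn R d] (fun z : Cn R d => complex.Re ((z : 'rV[R[i]]_d) 0 j)).
Proof.
apply: (measurability _ (RGenOInfty.measurableE R)) => _ [_ [x ->] <-].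
rewrite setTI; apply: sub_sigma_algebra; apply: norm_open => z /=.
rewrite in_itv/= andbT => xz; exists (complex.Re (z 0 j) - x).
  by rewrite subr_gt0.
move=> w /(_ j) zw; rewrite in_itv/= andbT.
have := le_lt_trans (norm_Re_le _) zw; rewrite raddfB/= ltr_norml => /andP[_].
by rewrite ltrD2l ltrN2.
Qed.

Lemma measurable_Im_coord (j : 'I_d) :
  measurable_fun [set: Cn R d] (fun z : Cn R d => complex.Im ((z : 'rV[R[i]]_d) 0 j)).
Proof.
apply: (measurability _ (RGenOInfty.measurableE R)) => _ [_ [x ->] <-].
rewrite setTI; apply: sub_sigma_algebra; apply: norm_open => z /=.
rewrite in_itv/= andbT => xz; exists (complex.Im (z 0 j) - x).
  by rewrite subr_gt0.
move=> w /(_ j) zw; rewrite in_itv/= andbT.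
have := le_lt_trans (norm_Im_le _) zw; rewrite raddfB/= ltr_norml => /andP[_].
by rewrite ltrD2l ltrN2.
Qed.

Lemma measurable_fun_Cn dp (X : measurableType dp) (f : X -> 'rV[R[i]]_d) :
  (forall j, measurable_fun [set: X] (fun x => complex.Re (f x 0 j))) ->
  (forall j, measurable_fun [set: X] (fun x => complex.Im (f x 0 j))) ->
  measurable_fun [set: X] (f : X -> Cn R d).
Proof.
move=> mRe mIm; apply: (@measurability _ _ X (Cn R d) setT f (@open 'rV[R[i]]_d)) => //.
move=> _ [U oU <-]; rewrite setTI.
pose box (k : 'rV[rat * rat]_d * nat) : set 'rV[R[i]]_d := [set z | forall j,
  `|complex.Re (z 0 j) - ratr (k.1 0 j).1| < k.2.+1%:R^-1 /\
  `|complex.Im (z 0 j) - ratr (k.1 0 j).2| < k.2.+1%:R^-1].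
have -> : U = \bigcup_(k in [set k | box k `<=` U]) box k.
  apply/seteqP; split => [z Uz|z [k /= + kz]]; last exact.
  have [e e0 eU] := open_normP oU Uz.
  have [n ne] : exists n : nat, n.+1%:R^-1 < e / 4.
    by have := @near_infty_natSinv_lt R (PosNum (divr_gt0 e0 (ltr0Sn R 3))) => -[n _ /(_ n (leqnn n))]; exists n.
  have n0 : 0 < n.+1%:R^-1 :> R by rewrite invr_gt0.
  have rat_near (x : R) : exists q : rat, `|x - ratr q| < n.+1%:R^-1.
    have [q] := @rat_in_itvoo R (x - n.+1%:R^-1) (x + n.+1%:R^-1) ltac:(by rewrite ltrD2l; apply: lt_trans n0; rewrite oppr_lt0).
    by rewrite in_itv/= => xq; exists q; rewrite distrC ltr_distl.
  pose q j := (sval (cid (rat_near (complex.Re (z 0 j)))),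
               sval (cid (rat_near (complex.Im (z 0 j))))).
  have qz : box (\row_j q j, n) z.
    by move=> j; rewrite /= mxE /q/=; case: cid => ? ?; case: cid.
  exists (\row_j q j, n) => // w qw; apply: eU => j.
  apply: le_lt_trans (normc_le _) _; rewrite !raddfB/=.
  have [a1 a2] := qz j; have [b1 b2] := qw j.
  rewrite /= in a1 a2 b1 b2; move: a1 a2 b1 b2 ne; set m := _^-1.
  rewrite !ltr_norml => /andP[a1 a2] /andP[a3 a4] /andP[b1 b2] /andP[b3 b4] ne.
  rewrite -[X in X < _]ger0_norm ?addr_ge0//.
  have : `|complex.Re (z 0 j) - complex.Re (w 0 j)| < 2 * m by rewrite ltr_norml; apply/andP; split; lra.
  have : `|complex.Im (z 0 j) - complex.Im (w 0 j)| < 2 * m by rewrite ltr_norml; apply/andP; split; lra.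
  rewrite ger0_norm ?addr_ge0//; lra.
rewrite preimage_bigcup bigcup_mkcond.
apply: countable_bigcupT_measurable => [|k]; first exact: countableP.
case: ifP => // _.
have -> : f @^-1` box k = \bigcap_(j in [set: 'I_d])
    (((fun x => complex.Re (f x 0 j)) @^-1` [set y | `|y - ratr (k.1 0 j).1| < k.2.+1%:R^-1]) `&`
     ((fun x => complex.Im (f x 0 j)) @^-1` [set y | `|y - ratr (k.1 0 j).2| < k.2.+1%:R^-1])).
  by apply/seteqP; split => [x kx j _|x kx j]; [exact: kx|exact: (kx j I)].
have mball (q r : R) : measurable [set y | `|y - q| < r].
  rewrite [X in measurable X](_ : _ = `]q - r, q + r[%classic)//.
  by apply/seteqP; split => y; rewrite /= in_itv/= ltr_distl.
apply: fin_bigcap_measurable => // j _; apply: measurableI.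
  by rewrite -[X in measurable X]setTI; exact: mRe.
by rewrite -[X in measurable X]setTI; exact: mIm.
Qed.

End Cn_measurable.

Section sphere_measure.
Context (R : realType) (d : nat).

Definition Cn_of_R2n (t : (d + d).-tuple R) : 'rV[R[i]]_d :=
  \row_j (tnth t (lshift d j) +i* tnth t (rshift d j)).

Lemma measurable_Cn_of_R2n :
  measurable_fun [set: (d + d).-tuple R] (Cn_of_R2n : _ -> Cn R d).
Proof.
apply: measurable_fun_Cn => j.
  rewrite (_ : (fun _ => _) = @tnth _ R ^~ (lshift d j)).
    exact: measurable_tnth.
  by apply/funext => t; rewrite mxE.
rewrite (_ : (fun _ => _) = @tnth _ R ^~ (rshift d j)).
  exact: measurable_tnth.
by apply/funext => t; rewrite mxE.
Qed.

(* Lebesgue measure of R^(2d), transported to C^d. *)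
Definition lebesgue_Cn : set (Cn R d) -> \bar R :=
  pushforward (tuple_measure (@lebesgue_measure R) (d + d))
    (Cn_of_R2n : _ -> Cn R d).

HB.instance Definition _ := Measure.copy lebesgue_Cn
  (measure_function_pushforward__canonical__measure_function_Measure
     (tuple_measure (@lebesgue_measure R) (d + d)) measurable_Cn_of_R2n).

Lemma measurable_enorm :
  measurable_fun [set: Cn R d] (@enorm R d : Cn R d -> R).
Proof.
have normcE (x : R[i]) : normc x ^+ 2 = complex.Re x ^+ 2 + complex.Im x ^+ 2.
  by case: x => a b; rewrite /= sqr_sqrtr// addr_ge0 ?sqr_ge0.
have msqrt : measurable_fun [set: R] (@Num.sqrt R).
  by apply: continuous_measurable_fun; exact: sqrt_continuous.
apply: (measurableT_comp msqrt).
apply: measurable_sum => j; rewrite (_ : (fun _ => _) =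
  (fun z : Cn R d => complex.Re ((z : 'rV[R[i]]_d) 0 j) ^+ 2
                   + complex.Im ((z : 'rV[R[i]]_d) 0 j) ^+ 2)).
  apply: measurable_funD; apply: measurable_funX.
    exact: measurable_Re_coord.
  exact: measurable_Im_coord.
by apply/funext => z; rewrite normcE.
Qed.

Lemma measurable_Bd : measurable (Bd : set (Cn R d)).
Proof.
rewrite (_ : Bd = setT `&` (@enorm R d : Cn R d -> R) @^-1` `]-oo, 1[%classic).
  exact: measurable_enorm.
by apply/seteqP; split => z /=; rewrite in_itv/=; [split|case].
Qed.

Definition radial_proj (z : 'rV[R[i]]_d) : 'rV[R[i]]_d :=
  (enorm z)^-1%:C *: z.

Lemma measurable_radial_proj :
  measurable_fun [set: Cn R d] (radial_proj : Cn R d -> Cn R d).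
Proof.
have minv : measurable_fun [set: Cn R d]
    (fun z : Cn R d => (enorm (z : 'rV[R[i]]_d))^-1).
  apply: (measurableT_comp _ measurable_enorm).
  rewrite (_ : [set: R] = [set x | x != 0] `|` [set 0]).
    have oU : open [set x : R | x != 0].
      rewrite (_ : mkset _ = ~` [set 0]); last by apply/seteqP; split => x /= /eqP.
      exact/closed_openC/closed_eq.
    apply/measurable_funU; [exact: open_measurable|exact: measurable_set1|split].
      apply: open_continuous_measurable_fun => // x; rewrite inE/= => x0.
      exact: inv_continuous.
    exact: measurable_fun_set1.
  apply/seteqP; split => // x _ /=.
  by have [->|x0] := eqVneq x 0; [right|left].
apply: measurable_fun_Cn => j.
  rewrite (_ : (fun _ => _) = (fun z : Cn R d =>
    (enorm (z : 'rV[R[i]]_d))^-1 * complex.Re ((z : 'rV[R[i]]_d) 0 j))).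
    apply: measurable_funM => //; exact: measurable_Re_coord.
  by apply/funext => z; rewrite mxE; case: (_ z _ _) => a b /=; rewrite mul0r subr0.
rewrite (_ : (fun _ => _) = (fun z : Cn R d =>
  (enorm (z : 'rV[R[i]]_d))^-1 * complex.Im ((z : 'rV[R[i]]_d) 0 j))).
  apply: measurable_funM => //; exact: measurable_Im_coord.
by apply/funext => z; rewrite mxE; case: (_ z _ _) => a b /=; rewrite mul0r addr0.
Qed.

Let enormE (t : (d + d).-tuple R) :
  enorm (Cn_of_R2n t) = Num.sqrt (\sum_i tnth t i ^+ 2).
Proof.
congr Num.sqrt; rewrite big_split_ord [RHS]/= -big_split /=; apply: eq_bigr => j _.
by rewrite mxE /= sqr_sqrtr// addr_ge0 ?sqr_ge0.
Qed.

Lemma lebesgue_Bd_fin : (0 < lebesgue_Cn (Bd : set (Cn R d)) < +oo)%E.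
Proof.
have mB := measurable_Bd.
have mpre : measurable ((Cn_of_R2n : _ -> Cn R d) @^-1` Bd).
  by rewrite -[X in measurable X]setTI; exact: measurable_Cn_of_R2n.
have mbox (c : R) : measurable [set t : (d + d).-tuple R |
    forall i, `[- c, c]%classic (tnth t i)].
  rewrite (_ : mkset _ = \bigcap_(i in [set: 'I_(d + d)])
    ((@tnth _ R ^~ i) @^-1` `[- c, c])).
    apply: fin_bigcap_measurable => // i _.
    by rewrite -[X in measurable X]setTI; exact: measurable_tnth.
  by apply/seteqP; split => [t At i _|t At i]; exact: At.
have box (c : R) : 0 < c -> tuple_measure (@lebesgue_measure R) (d + d)
    [set t | forall i, `[- c, c]%classic (tnth t i)] = ((c + c) ^+ (d + d))%:E.
  move=> c0; apply: etrans (@tuple_measure_box _ _ R (@lebesgue_measure R) _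
    `[- c, c]%classic _) _ => //.
  rewrite [X in (X ^+ _)%E](lebesgue_measure_itv `[- c, c])/= lte_fin.
  by rewrite ifT; [rewrite -EFinB opprK EFin_expe|rewrite gtrN].
apply/andP; split.
  pose c : R := (d + d).+2%:R^-1.
  have c0 : 0 < c by rewrite invr_gt0.
  apply: (@lt_le_trans _ _ ((c + c) ^+ (d + d))%:E).
    by rewrite lte_fin exprn_gt0// addr_gt0.
  rewrite -box//; apply: le_measure; rewrite ?inE.
  - exact: mbox.
  - exact: mpre.
  move=> t ct.
  rewrite /= /Bd /= enormE -[ltRHS]sqrtr1 ltr_sqrt//.
  have cc : forall i, tnth t i ^+ 2 <= c.
    move=> i; have := ct i; rewrite /= in_itv/= -ler_norml => tc.
    rewrite -real_normK ?num_real// expr2 -[leRHS]mulr1 ler_pM//.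
    by rewrite (le_trans tc)// invf_le1// ler1n.
  apply: (@le_lt_trans _ _ (\sum_(i < d + d) c)); first exact: ler_sum.
  by rewrite sumr_const card_ord -mulr_natl ltr_pdivrMr// mul1r ltr_nat.
apply: (@le_lt_trans _ _ ((1 + 1) ^+ (d + d))%:E); last exact: ltry.
rewrite -box// /lebesgue_Cn /pushforward; apply: le_measure; rewrite ?inE.
- exact: mpre.
- exact: mbox.
move=> t.
rewrite /= /Bd /= enormE => t1 i; rewrite /= in_itv/= -ler_norml.
rewrite -sqrtr_sqr; apply: le_trans (ltW t1); rewrite ler_wsqrtr//.
by rewrite (bigD1 i)//= lerDl sumr_ge0// => j _; exact: sqr_ge0.
Qed.

(* A |-> Lebesgue measure of the part in the unit ball of the cone over A *)
Definition cone_measure : set (Cn R d) -> \bar R :=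
  pushforward (mrestr lebesgue_Cn measurable_Bd)
    (radial_proj : Cn R d -> Cn R d).

HB.instance Definition _ := Measure.copy cone_measure
  (measure_function_pushforward__canonical__measure_function_Measure
     (mrestr lebesgue_Cn measurable_Bd) measurable_radial_proj).

(* The normalized Lebesgue measure on the unit sphere, as a Borel probability
   measure on C^d carried by the sphere: the measure of A is the proportion of
   the volume of the ball lying in the cone over A (see [sphere_measureE]).
   [mnormalize] asks for a fallback probability for measures that cannot be
   normalized; by [lebesgue_Bd_fin] it is never used. *)
Definition sphere_measure : probability (Cn R d) R :=
  mnormalize cone_measure \d_(0 : Cn R d).

Lemma sphere_measureE (A : set (Cn R d)) : sphere_measure A =
  (lebesgue_Cn ([set z | A (radial_proj z)] `&` Bd) *
   (fine (lebesgue_Cn Bd))^-1%:E)%E.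
Proof.
have /andP[B0 Boo] := lebesgue_Bd_fin.
have coneT : cone_measure setT = lebesgue_Cn Bd.
  by rewrite /cone_measure /pushforward /mrestr preimage_setT setTI.
rewrite [LHS](_ : _ = mnormalize cone_measure \d_(0 : Cn R d) A)//.
rewrite /mnormalize -coneT in B0 Boo *.
by rewrite gt_eqF// lt_eqF.
Qed.

End sphere_measure.

Section radial_limits.
Context (R : realType) (d : nat).
Implicit Types (f : 'rV[R[i]]_d -> R[i]) (z : 'rV[R[i]]_d).

Definition radial_cvg f z := cvg (f (r%:C *: z) @[r --> (1 : R)^'-]).

Definition radial_lim f z : R[i] := lim (f (r%:C *: z) @[r --> (1 : R)^'-]).

(* f inside the ball and its radial limits elsewhere.  Only the values on the
   closed ball matter.  Where the radial limit does not exist, [lim] is an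
   arbitrary default value. *)
Definition bd_extension f z : R[i] :=
  if enorm z < 1 then f z else radial_lim f z.

(* Since {ae mu, _} is relative to mu on the whole of C^d, the implication
   expresses almost everywhere with respect to the restriction of mu to the
   sphere. *)
Definition admissible (mu : {measure set (Cn R d) -> \bar R}) f :=
  holomorphic_Bd f /\ {ae mu, forall z, Sd z -> radial_cvg f z}.

End radial_limits.

(* A Hilbert space of complex functions on D with reproducing kernel K.
   Functions on D are represented by functions on T that vanish off D, so that
   equality on D is equality.  The inner product is linear on the left and
   only meaningful on the carrier.  K determines the carrier and the inner
   product uniquely. *)
Record rkhs (R : realType) (T : Type) (D : set T) (K : T -> T -> R[i]) := RKHS {
  rkhs_carrier : set (T -> R[i]);
  rkhs_dot : (T -> R[i]) -> (T -> R[i]) -> R[i];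
  rkhs_vanish : forall f, rkhs_carrier f -> forall z, ~ D z -> f z = 0;
  rkhs0 : rkhs_carrier (fun=> 0);
  rkhs_lin : forall (a : R[i]) f g, rkhs_carrier f -> rkhs_carrier g ->
    rkhs_carrier (fun z => a * f z + g z);
  rkhs_dotl : forall (a : R[i]) f g h,
    rkhs_carrier f -> rkhs_carrier g -> rkhs_carrier h ->
    rkhs_dot (fun z => a * f z + g z) h = a * rkhs_dot f h + rkhs_dot g h;
  rkhs_dotC : forall f g, rkhs_carrier f -> rkhs_carrier g ->
    rkhs_dot g f = (rkhs_dot f g)^*%C;
  rkhs_dot_gt0 : forall f, rkhs_carrier f -> f <> (fun=> 0) ->
    0 < rkhs_dot f f;
  rkhs_norm := fun f => Num.sqrt (complex.Re (rkhs_dot f f));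
  rkhs_complete : forall u : (T -> R[i])^nat, (forall n, rkhs_carrier (u n)) ->
    (forall e : R, 0 < e -> exists N, forall m n, (N <= m)%N -> (N <= n)%N ->
      rkhs_norm (fun z => u m z - u n z) < e) ->
    exists2 f, rkhs_carrier f &
      rkhs_norm (fun z => u n z - f z) @[n --> \oo] --> (0 : R);
  rkhs_kernel : forall w, D w ->
    rkhs_carrier (fun z => if z \in D then K z w else 0);
  rkhs_reproducing : forall f w, rkhs_carrier f -> D w ->
    f w = rkhs_dot f (fun z => if z \in D then K z w else 0)
}.

Section deBranges_Rovnyak.
Context (R : realType) (d : nat).

(* The de Branges-Rovnyak space H(b) is the space with kernel [dbr_kernel b] on
   the ball, that is, an element of [rkhs Bd (dbr_kernel b)].  Its elements are
   automatically holomorphic when b is. *)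
Definition dbr_kernel (b : 'rV[R[i]]_d -> R[i]) (z w : 'rV[R[i]]_d) : R[i] :=
  (1 - b z * (b w)^*%C) / (1 - hdot z w) ^+ d.

(* For mu carried by the closed ball, the norm on the right is the one of
   L^2(clBd, mu); it may be +oo. *)
Definition reverse_carleson (b : 'rV[R[i]]_d -> R[i])
    (H : rkhs Bd (dbr_kernel b)) (mu : {measure set (Cn R d) -> \bar R}) :=
  exists2 C : R, 0 < C & forall f, rkhs_carrier H f -> admissible mu f ->
    ((rkhs_norm H f)%:E <=
     C%:E * 'N[mu]_2%:E[(fun z : Cn R d => (normc (bd_extension f z))%:E)])%E.

End deBranges_Rovnyak.

Section lebesgue_decomposition.
Context dp (T : measurableType dp) (R : realType).
Implicit Types nu sigma : set T -> \bar R.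

Definition mutually_singular nu sigma := exists N : set T,
  [/\ measurable N, nu (~` N) = 0%E & sigma N = 0%E].

(* nua is the absolutely continuous part of nu, nus its singular part *)
Definition lebesgue_decomposition nu sigma nua nus :=
  [/\ forall A, measurable A -> nu A = (nua A + nus A)%E,
      nua `<< sigma & mutually_singular nus sigma].

End lebesgue_decomposition.

(* Main.v *)
Require Import Defs.
From HB Require Import structures.
From mathcomp Require Import all_boot all_order all_algebra.
From mathcomp Require Import complex.
From mathcomp Require Import all_classical all_reals all_analysis.
From mathcomp Require Import measurable_realfun ring lra.
Import Order.TTheory GRing.Theory Num.Theory numFieldNormedType.Exports.
Import Normc.
Local Open Scope classical_set_scope.
Local Open Scope complex_scope.
Local Open Scope charge_scope.
Local Open Scope ring_scope.
Set Implicit Arguments.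
Unset Strict Implicit.
Unset Printing Implicit Defensive.

(** Why the inequality holds. Test the reverse Carleson inequality on the reproducing kernel
    at w = (1 - ep) z, with z on the sphere. Its squared norm is
    (1 - |b(w)|^2) / (1 - |w|^2)^d, so that
      1 - |b(w)|^2 <= C * integral of |1 - b(x) b(w)^*|^2 P_ep(x, w) against mu(dx),
    where P_ep(x, w) = (ep / |1 - <x, w>|^2)^d is essentially the Poisson kernel
    ([kernel_norm_le], [poisson_test]). When ep tends to 0 the kernel concentrates at z, and
    the right side formally becomes (1 - |b(z)|^2)^2 g(z).

    Instead of differentiating measures, integrate over z in a set A against sigma and
    exchange the integrals. The integrals of P_ep over the sphere are bounded
    ([poisson_integral_le], from the measure O(t^d) of a cap of size t, [cap_measure]). If A
    is closed and the radial limits of b on A are uniform, then the inner integral is in the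
    limit at most a constant times (1 - |b(x)|^2)^2 for x in A, and 0 for x outside A
    ([poisson_fun_near]). By dominated convergence, the integral over A of 1 - |b|^2 against
    sigma is at most a constant times that of (1 - |b|^2)^2 against mu ([averaged_bound]).
    For A disjoint from a sigma-null set that carries the singular part, mu can be replaced
    by g sigma. By Egorov's theorem and inner regularity every set of positive measure
    contains such an A of positive measure, which turns the integrated inequality into one
    almost everywhere ([le_off_null_of_closed]).

    The radial limits of b exist sigma-almost everywhere by Fatou's theorem
    ([sphere_fatou]). The measure sigma is invariant under the rotations of C^d by unimodular
    scalars, so that it suffices to treat the restriction of b to a complex line, and by a
    Cayley transform a bounded holomorphic function f on a half plane ([halfplane_fatou]).
    A primitive of f is Lipschitz, so its boundary values are differentiable almost
    everywhere ([lipschitz_ae_derivable]). Where they are, the maximum principle with a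
    barrier function shows that the primitive is differentiable at the boundary point within
    cones, and an estimate of Schwarz type transfers this to the convergence of f
    ([boundary_derivative]). The maximum principle itself comes from Goursat's theorem for
    rectangles. *)

(** * Goursat's theorem for rectangles *)

Section bisection.
Context (R : realType).
Implicit Types x y w h : R.

(** Every integral along a path parallel to an axis is represented below by an
    increment of a primitive; this is the estimate that replaces the comparison of integrals. *)
Lemma mvt_le (Phi phi : R -> R) (a b k M : R) : a <= b ->
  (forall x, a <= x <= b -> is_derive x 1 Phi (phi x)) ->
  (forall x, a <= x <= b -> `|phi x - k| <= M) ->
  `|Phi b - Phi a - k * (b - a)| <= M * (b - a).
Proof.
move=> ab dPhi phiM.
have [c] := @MVT_segment R Phi phi a b ab
  (fun x xab => dPhi x (let xab' := subset_itv_oo_cc xab in ltac:(by move: xab'; rewrite in_itv)))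
  ltac:(by apply: derivable_within_continuous => x; rewrite in_itv/= => /dPhi []).
rewrite in_itv/= => cab ->.
by rewrite -mulrBl normrM (ger0_norm (x := b - a)) ?subr_ge0// ler_wpM2r ?subr_ge0 ?phiM.
Qed.

(** Of the four quarters of a rectangle, one carries at least a quarter of |L|. Repeated
    choices shrink to a point (p, q), around which |L| is at most e times the squared side:
    the factor 4^n lost by the choices is regained by the size of the n-th rectangle. *)
Lemma bisection_zero (L : R -> R -> R -> R -> R) (x0 y0 w0 h0 : R) :
  0 <= w0 -> 0 <= h0 ->
  (forall x y w h, x0 <= x -> y0 <= y -> 0 <= w -> 0 <= h ->
     x + (w + w) <= x0 + w0 -> y + (h + h) <= y0 + h0 ->
     L x y (w + w) (h + h) = L x y w h + L (x + w) y w h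
       + L x (y + h) w h + L (x + w) (y + h) w h) ->
  (forall p q, x0 <= p <= x0 + w0 -> y0 <= q <= y0 + h0 ->
     forall e, 0 < e -> exists2 de, 0 < de & forall x y w h,
       x0 <= x -> y0 <= y -> x + w <= x0 + w0 -> y + h <= y0 + h0 ->
       x <= p <= x + w -> y <= q <= y + h -> w < de -> h < de ->
       `|L x y w h| <= e * (w + h) ^+ 2) ->
  L x0 y0 w0 h0 = 0.
Proof.
move=> w00 h00 split_ loc.
pose W n : R := w0 / 2 ^+ n; pose H n : R := h0 / 2 ^+ n.
have WS n : W n = W n.+1 + W n.+1.
  by rewrite /W exprS; field; rewrite expf_neq0// pnatr_eq0.
have HS n : H n = H n.+1 + H n.+1.
  by rewrite /H exprS; field; rewrite expf_neq0// pnatr_eq0.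
have W0 n : 0 <= W n by rewrite divr_ge0// exprn_ge0.
have H0 n : 0 <= H n by rewrite divr_ge0// exprn_ge0.
pose T n (r : R * R) := `|L r.1 r.2 (W n) (H n)|.
pose stp n (r : R * R) : R * R :=
  let r1 := r in let r2 := (r.1 + W n.+1, r.2) in
  let r3 := (r.1, r.2 + H n.+1) in let r4 := (r.1 + W n.+1, r.2 + H n.+1) in
  if T n r <= 4 * T n.+1 r1 then r1 else
  if T n r <= 4 * T n.+1 r2 then r2 else
  if T n r <= 4 * T n.+1 r3 then r3 else r4.
pose r := fix r n := if n is n'.+1 then stp n' (r n') else (x0, y0).
have rS n : r n.+1 = stp n (r n) by [].
have inv n : [/\ x0 <= (r n).1, y0 <= (r n).2, (r n).1 + W n <= x0 + w0 &
                 (r n).2 + H n <= y0 + h0].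
  elim: n => [|n [a1 a2 a3 a4]]; first by rewrite /W /H !expr0 !divr1.
  have := W0 n.+1; have := H0 n.+1; move: a3 a4; rewrite WS HS => a3 a4 c1 c2.
  by rewrite rS /stp; case: ifP => _; [|case: ifP => _; [|case: ifP => _]];
    rewrite /=; split; lra.
have stpb n : [/\ (r n).1 <= (r n.+1).1 , (r n).2 <= (r n.+1).2,
    (r n.+1).1 + W n.+1 <= (r n).1 + W n & (r n.+1).2 + H n.+1 <= (r n).2 + H n].
  have := W0 n.+1; have := H0 n.+1; rewrite (WS n) (HS n) => c1 c2.
  by rewrite rS /stp; case: ifP => _; [|case: ifP => _; [|case: ifP => _]];
    rewrite /=; split; lra.
have Tstp n : T n (r n) <= 4 * T n.+1 (r n.+1).
  have [a1 a2 a3 a4] := inv n.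
  have : T n (r n) <= T n.+1 (r n) + T n.+1 ((r n).1 + W n.+1, (r n).2)
    + T n.+1 ((r n).1, (r n).2 + H n.+1)
    + T n.+1 ((r n).1 + W n.+1, (r n).2 + H n.+1).
    rewrite {1}/T WS HS split_ -?WS -?HS//.
    by rewrite (le_trans (ler_normD _ _))// lerD2r (le_trans (ler_normD _ _))//
      lerD2r (le_trans (ler_normD _ _)).
  rewrite rS /stp; case: ifPn => //; rewrite -ltNge => b1.
  case: ifPn => //; rewrite -ltNge => b2.
  case: ifPn => //; rewrite -ltNge => b3; move: b1 b2 b3; rewrite /=; lra.
have Tn n : T 0%N (r 0%N) <= 4 ^+ n * T n (r n).
  elim: n => [|n IH]; first by rewrite expr0 mul1r.
  by rewrite (le_trans IH)// exprSr -mulrA ler_wpM2l// exprn_ge0.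
have ndx : nondecreasing_seq (fun n => (r n).1).
  by apply/nondecreasing_seqP => n; have [] := stpb n.
have ndy : nondecreasing_seq (fun n => (r n).2).
  by apply/nondecreasing_seqP => n; have [] := stpb n.
have upx n m : (n <= m)%N -> (r m).1 + W m <= (r n).1 + W n.
  move=> /subnK <-; elim: (m - n)%N => // k; rewrite addSn; apply: le_trans.
  by have [] := stpb (k + n)%N.
have upy n m : (n <= m)%N -> (r m).2 + H m <= (r n).2 + H n.
  move=> /subnK <-; elim: (m - n)%N => // k; rewrite addSn; apply: le_trans.
  by have [] := stpb (k + n)%N.
have upx' n m : (r m).1 <= (r n).1 + W n.
  have [nm|/ltnW mn] := leqP n m.
    by apply: le_trans (upx _ _ nm); rewrite lerDl.
  by apply: le_trans (ndx _ _ mn) _; rewrite lerDl.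
have upy' n m : (r m).2 <= (r n).2 + H n.
  have [nm|/ltnW mn] := leqP n m.
    by apply: le_trans (upy _ _ nm); rewrite lerDl.
  by apply: le_trans (ndy _ _ mn) _; rewrite lerDl.
have supx (n : nat) : has_sup (range (fun n => (r n).1)).
  by split; [exists (r 0%N).1; exists 0%N|exists ((r n).1 + W n) => _ [m _ <-]; exact: upx'].
have supy (n : nat) : has_sup (range (fun n => (r n).2)).
  by split; [exists (r 0%N).2; exists 0%N|exists ((r n).2 + H n) => _ [m _ <-]; exact: upy'].
pose p := sup (range (fun n => (r n).1)); pose q := sup (range (fun n => (r n).2)).
have pb n : (r n).1 <= p <= (r n).1 + W n.
  apply/andP; split.
    by apply: sup_upper_bound (supx n) _ _; exists n.
  by apply: ge_sup; [exact: (supx n).1|move=> _ [m _ <-]; exact: upx'].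
have qb n : (r n).2 <= q <= (r n).2 + H n.
  apply/andP; split.
    by apply: sup_upper_bound (supy n) _ _; exists n.
  by apply: ge_sup; [exact: (supy n).1|move=> _ [m _ <-]; exact: upy'].
have p0 : x0 <= p <= x0 + w0 by have := pb 0%N; rewrite /W expr0 divr1.
have q0 : y0 <= q <= y0 + h0 by have := qb 0%N; rewrite /H expr0 divr1.
apply/eqP; rewrite -normr_le0; apply/ler_addgt0Pl => e e0; rewrite addr0.
have s0 : 0 < (w0 + h0) ^+ 2 + 1 by rewrite ltr_wpDl// sqr_ge0.
have [de de0 locp] := loc p q p0 q0 _ (divr_gt0 e0 s0).
have small c : 0 <= c -> exists N, forall n, (N <= n)%N -> c / 2 ^+ n < de.
  move=> c0; have cv : (fun n => c * (2^-1) ^+ n) @ \oo --> (0 : R).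
    rewrite -(mulr0 c); apply: cvgMr; apply: cvg_expr.
    by rewrite ger0_norm ?invr_ge0// invf_lt1// ltr1n.
  have [N _ NP] := cvgr_lt (0 : R) cv de de0.
  by exists N => n /NP; rewrite exprVn.
have [N1 N1P] := small w0 w00; have [N2 N2P] := small h0 h00.
pose n := maxn N1 N2.
have [a1 a2 a3 a4] := inv n.
have := locp (r n).1 (r n).2 (W n) (H n) a1 a2 a3 a4 (pb n) (qb n)
  (N1P n (leq_maxl _ _)) (N2P n (leq_maxr _ _)).
rewrite -[`|L _ _ _ _|]/(T n (r n)) => Tle.
have := Tn n; rewrite /T /= /W /H !expr0 !divr1 => /le_trans; apply.
rewrite -/(T n (r n)).
have -> : e = 4 ^+ n * (e / ((w0 + h0) ^+ 2 + 1) * (((w0 + h0) ^+ 2 + 1) / 4 ^+ n)).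
  have t0 : 4 ^+ n != 0 :> R by rewrite expf_neq0// pnatr_eq0.
  move: (gt_eqF s0) t0; move: (_ + 1) (4 ^+ n) => s t /negbT s1 t1.
  by field; rewrite ?s1 ?t1.
rewrite ler_wpM2l ?exprn_ge0//; apply: (le_trans Tle).
rewrite ler_wpM2l ?divr_ge0 ?(ltW e0) ?(ltW s0)//.
rewrite /W /H -mulrDl expr_div_n -exprM mulnC exprM (_ : 2 ^+ 2 = 4 :> R); last by rewrite -natrX.
by rewrite ler_pM2r ?invr_gt0 ?exprn_gt0// lerDl.
Qed.

End bisection.

Section circulation.
Context (R : realType).
Implicit Types (P Q X Y : R -> R -> R).

(** The integral of P dx + Q dy along the boundary of a rectangle, when X and Y are
    primitives of P in x and of Q in y. Written with primitives, its additivity under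
    subdivision is a ring identity. *)
Definition circ X Y (x1 x2 y1 y2 : R) : R :=
  (X x2 y1 - X x1 y1) + (Y x2 y2 - Y x2 y1)
  - (X x2 y2 - X x1 y2) - (Y x1 y2 - Y x1 y1).

Definition primitives P Q X Y (x1 x2 y1 y2 : R) := forall x y,
  x1 <= x <= x2 -> y1 <= y <= y2 ->
  is_derive x 1 (X ^~ y) (P x y) /\ is_derive y 1 (Y x) (Q x y).

(** P and Q are differentiable at (p, q) with equal cross derivatives m, that is, the
    form P dx + Q dy is closed there. *)
Definition closed_at P Q (p q : R) := exists p1 m q2 : R, forall e : R, 0 < e ->
  exists2 de : R, 0 < de & forall x y, `|x - p| < de -> `|y - q| < de ->
    `|P x y - (P p q + p1 * (x - p) + m * (y - q))| <= e * (`|x - p| + `|y - q|) /\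
    `|Q x y - (Q p q + m * (x - p) + q2 * (y - q))| <= e * (`|x - p| + `|y - q|).

(** The increment of a primitive of an affine function is exact, so that the affine parts
    of P and Q cancel around a rectangle. *)
Lemma edge_estimate (Phi phi : R -> R) (a b k c p M : R) : a <= b ->
  (forall x, a <= x <= b -> is_derive x 1 Phi (phi x)) ->
  (forall x, a <= x <= b -> `|phi x - (k + c * (x - p))| <= M) ->
  `|Phi b - Phi a - (k * (b - a) + c / 2 * ((b - p) ^+ 2 - (a - p) ^+ 2))|
    <= M * (b - a).
Proof.
move=> ab dPhi phiM.
pose Psi x := Phi x - c / 2 * (x - p) ^+ 2.
have dPsi x : a <= x <= b -> is_derive x 1 Psi (phi x - c * (x - p)).
  move=> xab; have := dPhi _ xab => d1.
  rewrite /Psi; apply: is_derive_eq; rewrite /GRing.scale/=. lra.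
have := @mvt_le R Psi _ a b k M ab dPsi.
rewrite /Psi => H; rewrite (_ : Phi b - _ - _ = Phi b - c / 2 * (b - p) ^+ 2 -
  (Phi a - c / 2 * (a - p) ^+ 2) - k * (b - a)); last by ring.
apply: H => x xab; rewrite (_ : _ - _ - _ = phi x - (k + c * (x - p))); last by ring.
exact: phiM.
Qed.

Lemma circ_le P Q X Y (x1 x2 y1 y2 K : R) : x1 <= x2 -> y1 <= y2 ->
  primitives P Q X Y x1 x2 y1 y2 ->
  (forall x y, x1 <= x <= x2 -> y1 <= y <= y2 -> `|P x y| <= K /\ `|Q x y| <= K) ->
  `|circ X Y x1 x2 y1 y2| <= 2 * K * ((x2 - x1) + (y2 - y1)).
Proof.
move=> x12 y12 prim K_.
have y1in : y1 <= y1 <= y2 by rewrite lexx.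
have y2in : y1 <= y2 <= y2 by rewrite lexx andbT.
have x1in : x1 <= x1 <= x2 by rewrite lexx.
have x2in : x1 <= x2 <= x2 by rewrite lexx andbT.
have HX y : y1 <= y <= y2 -> `|X x2 y - X x1 y| <= K * (x2 - x1).
  move=> yin; have := @mvt_le R (X ^~ y) (P ^~ y) x1 x2 0 K x12.
  rewrite mul0r subr0; apply => x xin; first exact: (prim _ _ xin yin).1.
  by rewrite subr0; exact: (K_ _ _ xin yin).1.
have HY x : x1 <= x <= x2 -> `|Y x y2 - Y x y1| <= K * (y2 - y1).
  move=> xin; have := @mvt_le R (Y x) (Q x) y1 y2 0 K y12.
  rewrite mul0r subr0; apply => y yin; first exact: (prim _ _ xin yin).2.
  by rewrite subr0; exact: (K_ _ _ xin yin).2.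
have := HX _ y1in; have := HX _ y2in; have := HY _ x1in; have := HY _ x2in.
rewrite /circ !ler_norml => /andP[a1 a2] /andP[b1 b2] /andP[c1 c2] /andP[d1 d2].
by apply/andP; split; lra.
Qed.

(** The affine part of a closed form has no circulation, and the error is small compared
    to the squared side of a small rectangle: bisection applies. *)
Lemma goursat P Q X Y (x1 x2 y1 y2 : R) : x1 <= x2 -> y1 <= y2 ->
  primitives P Q X Y x1 x2 y1 y2 ->
  (forall p q, x1 <= p <= x2 -> y1 <= q <= y2 -> closed_at P Q p q) ->
  circ X Y x1 x2 y1 y2 = 0.
Proof.
move=> x12 y12 prim cl.
have := @bisection_zero R (fun x y w h => circ X Y x (x + w) y (y + h)) x1 y1
  (x2 - x1) (y2 - y1).
rewrite !subrKC; apply; rewrite ?subr_ge0//.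
  by move=> x y w h _ _ _ _ _ _; rewrite /circ !addrA; ring.
move=> p q pin qin e e0.
have e2 : 0 < e / 2 by rewrite divr_gt0.
have [p1 [m [q2 /(_ (e / 2) e2)[de de0 cde]]]] := cl p q pin qin.
exists de => // x y w h xx1 yy1 xx2 yy2 xp yq wd hd.
have w0 : 0 <= w by case/andP: xp => a b; have := le_trans a b; rewrite lerDl.
have h0 : 0 <= h by case/andP: yq => a b; have := le_trans a b; rewrite lerDl.
have near x' y' : x <= x' <= x + w -> y <= y' <= y + h ->
    [/\ x1 <= x' <= x2, y1 <= y' <= y2,
     `|P x' y' - (P p q + p1 * (x' - p) + m * (y' - q))| <= e / 2 * (w + h) &
     `|Q x' y' - (Q p q + m * (x' - p) + q2 * (y' - q))| <= e / 2 * (w + h)].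
  move=> /andP[x'1 x'2] /andP[y'1 y'2].
  move: xp yq => /andP[xp1 xp2] /andP[yq1 yq2].
  have a : `|x' - p| <= w by rewrite ler_norml; apply/andP; split; lra.
  have b : `|y' - q| <= h by rewrite ler_norml; apply/andP; split; lra.
  have [c1 c2] := cde x' y' (le_lt_trans a wd) (le_lt_trans b hd).
  have ee : e / 2 * (`|x' - p| + `|y' - q|) <= e / 2 * (w + h).
    by rewrite ler_wpM2l ?lerD// divr_ge0// ltW.
  split; [apply/andP; split; move: x'1 x'2 xx1 xx2; clear; lra|
    apply/andP; split; move: y'1 y'2 yy1 yy2; clear; lra| |].
    exact: le_trans c1 ee.
  exact: le_trans c2 ee.
have HX y' : y <= y' <= y + h -> `|X (x + w) y' - X x y' -
   ((P p q + m * (y' - q)) * w + p1 / 2 * ((x + w - p) ^+ 2 - (x - p) ^+ 2))|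
   <= e / 2 * (w + h) * w.
  move=> yin.
  have := @edge_estimate (X ^~ y') (P ^~ y') x (x + w) (P p q + m * (y' - q)) p1 p
    (e / 2 * (w + h)).
  rewrite (_ : x + w - x = w); last by ring.
  apply; first by rewrite lerDl.
    by move=> x' xin; have [u1 u2 _ _] := near _ _ xin yin; exact: (prim _ _ u1 u2).1.
  by move=> x' xin; have [_ _ u _] := near _ _ xin yin; rewrite addrAC.
have HY x' : x <= x' <= x + w -> `|Y x' (y + h) - Y x' y -
   ((Q p q + m * (x' - p)) * h + q2 / 2 * ((y + h - q) ^+ 2 - (y - q) ^+ 2))|
   <= e / 2 * (w + h) * h.
  move=> xin.
  have := @edge_estimate (Y x') (Q x') y (y + h) (Q p q + m * (x' - p)) q2 q
    (e / 2 * (w + h)).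
  rewrite (_ : y + h - y = h); last by ring.
  apply; first by rewrite lerDl.
    by move=> y' yin; have [u1 u2 _ _] := near _ _ xin yin; exact: (prim _ _ u1 u2).2.
  by move=> y' yin; have [_ _ _ u] := near _ _ xin yin.
have := HX y ltac:(by rewrite lexx lerDl); have := HX (y + h) ltac:(by rewrite lexx lerDl h0).
have := HY x ltac:(by rewrite lexx lerDl); have := HY (x + w) ltac:(by rewrite lexx lerDl w0).
rewrite /circ !ler_norml.
set A := p1 / 2 * _; set B := q2 / 2 * _.
move=> /andP[a1 a2] /andP[b1 b2] /andP[c1 c2] /andP[d1 d2].
rewrite (_ : e * (w + h) ^+ 2 = 2 * (e / 2 * (w + h) * w) + 2 * (e / 2 * (w + h) * h)); last by field.
apply/andP; split; lra.
Qed.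

(** Cut the rectangle into nine: the eight pieces away from (p, q) have no circulation,
    and the piece around it is bounded by its perimeter, which is arbitrarily small. *)
Lemma goursat_punctured P Q X Y (x1 x2 y1 y2 p q K r : R) :
  x1 < p < x2 -> y1 < q < y2 -> 0 < r ->
  primitives P Q X Y x1 x2 y1 y2 ->
  (forall x y, x1 <= x <= x2 -> y1 <= y <= y2 -> x != p \/ y != q -> closed_at P Q x y) ->
  (forall x y, `|x - p| < r -> `|y - q| < r -> `|P x y| <= K /\ `|Q x y| <= K) ->
  circ X Y x1 x2 y1 y2 = 0.
Proof.
move=> /andP[xp1 xp2] /andP[yq1 yq2] r0 prim cl K_.
have K0 : 0 <= K.
  have [] := K_ p q; rewrite ?subrr ?normr0//.
  by move=> /(le_trans (normr_ge0 _)).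
have sub a1 a2 c1 c2 : x1 <= a1 -> a2 <= x2 -> y1 <= c1 -> c2 <= y2 ->
    primitives P Q X Y a1 a2 c1 c2.
  move=> h1 h2 h3 h4 x y /andP[xa xb] /andP[ya yb].
  by apply: prim; apply/andP; split; lra.
pose t0 := Num.min (Num.min (p - x1) (x2 - p)) (Num.min (q - y1) (y2 - q)).
have t00 : 0 < t0 by rewrite !lt_min !subr_gt0 xp1 xp2 yq1.
have main t : 0 < t -> t < t0 -> circ X Y x1 x2 y1 y2 = circ X Y (p - t) (p + t) (q - t) (q + t).
  rewrite !lt_min => tt0 /andP[/andP[t1 t2] /andP[t3 t4]].
  have Z a1 a2 c1 c2 : x1 <= a1 -> a1 <= a2 -> a2 <= x2 -> y1 <= c1 -> c1 <= c2 -> c2 <= y2 ->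
      (a2 <= p - t \/ p + t <= a1) \/ (c2 <= q - t \/ q + t <= c1) ->
      circ X Y a1 a2 c1 c2 = 0.
    move=> h1 h2 h3 h4 h5 h6 hh; apply: goursat h2 h5 (sub _ _ _ _ _ _ _ _) _ => //.
    move=> x y /andP[xa xb] /andP[ya yb]; apply: cl.
    - by apply/andP; split; lra.
    - by apply/andP; split; lra.
    - case: hh => hh; [left|right]; apply/eqP; case: hh => ? ?; lra.
  have : circ X Y x1 x2 y1 y2 =
      circ X Y x1 (p - t) y1 (q - t) + circ X Y (p - t) (p + t) y1 (q - t)
      + circ X Y (p + t) x2 y1 (q - t)
      + circ X Y x1 (p - t) (q - t) (q + t)
      + circ X Y (p - t) (p + t) (q - t) (q + t)
      + circ X Y (p + t) x2 (q - t) (q + t)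
      + circ X Y x1 (p - t) (q + t) y2 + circ X Y (p - t) (p + t) (q + t) y2
      + circ X Y (p + t) x2 (q + t) y2.
    by rewrite /circ; ring.
  move=> ->.
  by rewrite !(Z x1 (p - t)) ?(Z (p - t) _ y1) ?(Z (p - t) _ (q + t)) ?(Z (p + t) x2);
    rewrite ?add0r ?addr0//;
    try by move: tt0 t1 t2 t3 t4 xp1 xp2 yq1 yq2; clear; lra.
apply/eqP; rewrite -normr_le0; apply/ler_addgt0Pl => e e0; rewrite addr0.
pose t := Num.min (Num.min (t0 / 2) (r / 2)) (e / (8 * K + 8)).
have K8 : 0 < 8 * K + 8 by rewrite ltr_wpDl// mulr_ge0.
have tt0 : 0 < t by rewrite !lt_min !divr_gt0.
have tlt : t < t0 by rewrite !gt_min; apply/orP; left; apply/orP; left; lra.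
have tr : t < r by rewrite !gt_min; apply/orP; left; apply/orP; right; lra.
rewrite (main t)//.
move: (tlt); rewrite !lt_min => /andP[/andP[t1 t2] /andP[t3 t4]].
have KL : `|circ X Y (p - t) (p + t) (q - t) (q + t)|
    <= 2 * K * (p + t - (p - t) + (q + t - (q - t))).
  apply: (@circ_le P Q) => //; [lra|lra|by apply: sub; lra|].
  by move=> x y /andP[? ?] /andP[? ?]; apply: K_; rewrite ltr_norml; apply/andP; split; lra.
apply: le_trans KL _.
have : t * (8 * K + 8) <= e by rewrite -ler_pdivlMr// ge_min lexx orbT.
lra.
Qed.

End circulation.

(** * Complex derivatives and primitives *)

Section complex_derivative.
Context (R : realType).
Implicit Types (f g : R[i] -> R[i]) (z w : R[i]).

Lemma normc_ge0 z : 0 <= normc z.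
Proof. by case: z => a b; exact: sqrtr_ge0. Qed.

Lemma normCE z : `|z| = (normc z)%:C.
Proof. by rewrite normc_def; case: z. Qed.

Lemma normc_eq0 z : (normc z == 0) = (z == 0).
Proof.
apply/eqP/eqP => [/eq0_normc//|->]; exact: normc0.
Qed.

Lemma normc_gt0 z : (0 < normc z) = (z != 0).
Proof. by rewrite lt0r normc_eq0 normc_ge0 andbT. Qed.

Lemma normc_real (r : R) : normc r%:C = `|r|.
Proof. by rewrite /normc /= expr0n /= addr0 sqrtr_sqr. Qed.

Lemma distcC z w : normc (z - w) = normc (w - z).
Proof. by rewrite -normcN opprB. Qed.

Lemma normcX z n : normc (z ^+ n) = normc z ^+ n.
Proof. by elim: n => [|n IH]; rewrite ?expr0 ?normc1// !exprS normcM IH. Qed.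

Lemma normc_conj z : normc (z^*%C) = normc z.
Proof. by case: z => a b; rewrite /normc /= sqrrN. Qed.

Lemma normc_Re z : `|complex.Re z| <= normc z.
Proof. by have := normc_ge_Re z; rewrite normCE lecR. Qed.

Lemma normc_Im z : `|complex.Im z| <= normc z.
Proof.
case: z => a b /=; rewrite -sqrtr_sqr ler_sqrt ?lerDr ?sqr_ge0//.
by rewrite addr_ge0 ?sqr_ge0.
Qed.

Lemma sqr_normcE z : normc z ^+ 2 = complex.Re z ^+ 2 + complex.Im z ^+ 2.
Proof. by case: z => a b; rewrite /normc sqr_sqrtr// addr_ge0 ?sqr_ge0. Qed.

Lemma normc_le_ReIm z : normc z <= `|complex.Re z| + `|complex.Im z|.
Proof.
rewrite -(ler_pXn2r (n := 2)) ?nnegrE ?normc_ge0 ?addr_ge0//.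
rewrite sqr_normcE -[in X in X <= _](real_normK (num_real (complex.Re z))).
rewrite -[in X in X <= _](real_normK (num_real (complex.Im z))) sqrrD.
by rewrite lerD2r lerDl mulrn_wge0// mulr_ge0.
Qed.

Lemma normcB_le z w : normc (z - w) <= normc z + normc w.
Proof. by rewrite -[normc w]normcN; exact: le_normcD. Qed.

Lemma normc_triangle u z w : normc (z - w) <= normc (z - u) + normc (u - w).
Proof. by rewrite -[z - w](subrKA u); exact: le_normcD. Qed.

Lemma nbhsCP z (P : set R[i]) :
  nbhs z P <-> exists2 de : R, 0 < de & forall w, normc (w - z) < de -> P w.
Proof.
split=> [/nbhs_ballP[[e e']]|[de de0 H]].
  rewrite /= ltcE/= => /andP[/eqP -> e0] H; exists e => // w we; apply: H.
  by rewrite /ball /= distrC normCE ltcR.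
apply/nbhs_ballP; exists de%:C; first by rewrite /= ltcR.
by move=> w; rewrite /ball/= distrC normCE ltcR => /H.
Qed.

Definition cderiv f z (a : R[i]) := forall e : R, 0 < e -> exists2 de : R, 0 < de &
  forall w, normc (w - z) < de -> normc (f w - f z - a * (w - z)) <= e * normc (w - z).

Lemma cderivP f z a : cderiv f z a <-> is_derive z (1 : R[i]) f a.
Proof.
have quot h w : h != 0 -> normc (a - h^-1 * w) * normc h = normc (w - a * h).
  by move=> h0; rewrite -normcM -normcN; congr normc; field.
split => [dfa|dfa].
  have cv : h^-1 *: ((f \o shift z) (h *: (1 : R[i])) - f z) @[h --> (0 : R[i])^'] --> a.
    apply/cvgrPdist_le => /= e e0.
    have eR : e = (complex.Re e)%:C.
      by case: e e0 => u v; rewrite ltcE /= => /andP[/eqP -> _].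
    have e0' : 0 < complex.Re e by move: e0; rewrite ltcE => /andP[].
    have [de de0 H] := dfa _ e0'.
    near=> h.
    have h0 : h != 0 by near: h; exact: nbhs_dnbhs_neq.
    have hde : normc h < de.
      by rewrite -ltcR -normCE; near: h; apply: dnbhs0_lt; rewrite ltcR.
    rewrite eR normCE lecR.
    have := H (h + z); rewrite addrK => /(_ hde) {}H.
    have n0 : 0 < normc h by rewrite normc_gt0.
    by rewrite -(ler_pM2r n0) /GRing.scale/= quot// mulr1.
  by apply: DeriveDef; [exact: cvgP cv|exact: cvg_lim cv].
move=> e e0; have [] := dfa => /cvg_ex[/= l cvl] dE.
have al : l = a by rewrite -dE; apply/esym; exact: cvg_lim cvl.
rewrite {}al in cvl.
have /cvgrPdist_le/(_ e%:C) := cvl.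
rewrite ltcR => /(_ e0); rewrite /= near_withinE => /nbhsCP[de de0 H].
exists de => // w wde.
have [->|wz] := eqVneq w z; first by rewrite !subrr mulr0 subrr normc0 mulr0.
have := H (w - z); rewrite subr0 subr_eq0 => /(_ wde wz).
rewrite normCE lecR /GRing.scale/= mulr1 subrK => {}H.
have n0 : 0 < normc (w - z) by rewrite normc_gt0 subr_eq0.
by move: H; rewrite -(ler_pM2r n0) quot// subr_eq0.
Unshelve. all: by end_near. Qed.

Lemma derivable_cderiv f z : derivable f z (1 : R[i]) <-> exists a, cderiv f z a.
Proof.
split=> [df|[a /cderivP[]]//].
by exists ('D_1 f z); apply/cderivP; exact: derivableP.
Qed.

Definition ccts f z := forall e : R, 0 < e -> exists2 de : R, 0 < de &
  forall w, normc (w - z) < de -> normc (f w - f z) < e.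

Lemma cderiv_cts f z a : cderiv f z a -> ccts f z.
Proof.
move=> dfa e e0; have [de de0 H] := dfa 1 ltr01.
have a0 := normc_ge0 a.
have k0 : 0 < normc a + 1 by rewrite ltr_wpDl.
exists (Num.min de (e / (normc a + 1))); first by rewrite lt_min de0 divr_gt0.
move=> w; rewrite lt_min => /andP[/H wde]; rewrite ltr_pdivlMr// => we.
apply: le_lt_trans we.
have -> : f w - f z = (f w - f z - a * (w - z)) + a * (w - z) by rewrite subrK.
rewrite (le_trans (le_normcD _ _))// normcM.
rewrite (le_trans (lerD wde (lexx _)))// mul1r; lra.
Qed.

(** The Cauchy-Riemann equations. The circulation of the field (Re f, - Im f) is the real
    part of the contour integral of f. *)
Lemma cderiv_closed f (x y : R) a : cderiv f (x +i* y) a ->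
  closed_at (fun x y => complex.Re (f (x +i* y))) (fun x y => - complex.Im (f (x +i* y))) x y.
Proof.
case: a => al be df; exists al, (- be), (- al) => e e0.
have [de de0 H] := df e e0.
exists (de / 2) => [|x' y' xx yy]; first by rewrite divr_gt0.
have wz : (x' +i* y') - (x +i* y) = (x' - x) +i* (y' - y) by simpc.
have le1 : normc ((x' +i* y') - (x +i* y)) <= `|x' - x| + `|y' - y|.
  by rewrite wz; exact: normc_le_ReIm.
have /H : normc ((x' +i* y') - (x +i* y)) < de by apply: le_lt_trans le1 _; lra.
rewrite wz; case: (f (x' +i* y')) => u v; case: (f (x +i* y)) => u0 v0.
rewrite (_ : _ - _ - _ = (u - u0 - (al * (x' - x) - be * (y' - y))) +i*
    (v - v0 - (al * (y' - y) + be * (x' - x)))); last by simpc.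
move=> HE; have H1 : normc ((x' - x) +i* (y' - y)) <= `|x' - x| + `|y' - y| by exact: normc_le_ReIm.
have {H1}HE := le_trans HE (ler_wpM2l (ltW e0) H1).
split.
  apply: le_trans HE; apply: le_trans (normc_Re _); rewrite /=.
  by rewrite le_eqVlt; apply/orP; left; apply/eqP; congr (`|_|); ring.
apply: le_trans HE; apply: le_trans (normc_Im _); rewrite /= -normrN.
by rewrite le_eqVlt; apply/orP; left; apply/eqP; congr (`|_|); ring.
Qed.

Lemma ccts_horizontal f (x y : R) : ccts f (x +i* y) ->
  {for x, continuous (fun t : R => complex.Re (f (t +i* y)))}.
Proof.
move=> cf; apply/cvgrPdist_lt => e /cf[de de0 H]; near=> t.
rewrite distrC -raddfB; apply: le_lt_trans (normc_Re _) _; apply: H.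
have -> : (t +i* y) - (x +i* y) = (t - x)%:C by rewrite [LHS]/GRing.add/= subrr.
rewrite normc_real distrC; near: t.
by apply: cvgr_dist_lt de0.
Unshelve. all: by end_near. Qed.

Lemma ccts_vertical f (x y : R) : ccts f (x +i* y) ->
  {for y, continuous (fun t : R => - complex.Im (f (x +i* t)))}.
Proof.
move=> cf; apply/cvgrPdist_lt => e /cf[de de0 H]; near=> t.
rewrite opprK addrC -raddfB; apply: le_lt_trans (normc_Im _) _.
apply: H.
have -> : (x +i* t) - (x +i* y) = 0 +i* (t - y) by rewrite [LHS]/GRing.add/= subrr.
apply: le_lt_trans (normc_le_ReIm _) _; rewrite /= normr0 add0r distrC; near: t.
by apply: cvgr_dist_lt de0.
Unshelve. all: by end_near. Qed.

Lemma primitive_exists (phi : R -> R) (l a u : R) : l < a ->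
  (forall x, l < x < u -> {for x, continuous phi}) ->
  exists Phi : R -> R, forall x, a < x < u -> is_derive x 1 Phi (phi x).
Proof.
move=> la cphi; pose b := (l + a) / 2.
exists (fun x => \int[lebesgue_measure]_(t in `[b, x]) phi t)%R => x /andP[ax xu].
pose v := (x + u) / 2.
have int : lebesgue_measure.-integrable `[b, v] (EFin \o phi).
  apply: continuous_compact_integrable; first exact: segment_compact.
  apply: continuous_in_subspaceT => y; rewrite inE/= in_itv/= => /andP[yb yv].
  by apply: cphi; rewrite /b /v in yb yv; apply/andP; split; lra.
have [] := @continuous_FTC1_closed R phi b x v ltac:(rewrite /v; lra) int ltac:(rewrite /b; lra)
  (cphi x ltac:(apply/andP; split; lra)).
by rewrite derive1E => d1 <-; exact: derivableP.
Qed.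

Lemma field_primitives f (l a u c b v : R) : l < a -> c < b ->
  (forall x y, l < x < u -> c < y < v -> ccts f (x +i* y)) ->
  exists X Y : R -> R -> R, forall x y, a < x < u -> b < y < v ->
    is_derive x 1 (X ^~ y) (complex.Re (f (x +i* y))) /\
    is_derive y 1 (Y x) (- complex.Im (f (x +i* y))).
Proof.
move=> la cb cf.
have HX y : exists X : R -> R, forall x, a < x < u -> b < y < v ->
    is_derive x 1 X (complex.Re (f (x +i* y))).
  have [yin|?] := boolP (b < y < v); last by exists 0.
  have [|X HX] := @primitive_exists (fun x => complex.Re (f (x +i* y))) l a u la.
    move=> x xin; apply/ccts_horizontal/cf => //; move/andP: yin => [? ?]; apply/andP; split; lra.
  by exists X => x /HX.
have HY x : exists Y : R -> R, forall y, a < x < u -> b < y < v ->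
    is_derive y 1 Y (- complex.Im (f (x +i* y))).
  have [xin|?] := boolP (a < x < u); last by exists 0.
  have [|Y HY] := @primitive_exists (fun y => - complex.Im (f (x +i* y))) c b v cb.
    move=> y yin; apply/ccts_vertical/cf => //; move/andP: xin => [? ?]; apply/andP; split; lra.
  by exists Y => y _ /HY.
have [X XP] := choice HX; have [Y YP] := choice HY.
by exists (fun x y => X y x), Y => x y xin yin; split; [exact: XP|exact: YP].
Qed.

Lemma cderiv_local f g z a (r : R) : 0 < r ->
  (forall w, normc (w - z) < r -> f w = g w) -> cderiv f z a -> cderiv g z a.
Proof.
move=> r0 fg df e e0; have [de de0 H] := df e e0.
exists (Num.min de r); first by rewrite lt_min de0.
move=> w; rewrite lt_min => /andP[w1 w2].
by rewrite -!fg//; [exact: H|rewrite subrr normc0].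
Qed.

Lemma ex_cderivM f g z : (exists a, cderiv f z a) -> (exists a, cderiv g z a) ->
  exists a, cderiv (fun w => f w * g w) z a.
Proof.
move=> /derivable_cderiv df /derivable_cderiv dg; apply/derivable_cderiv.
exact: (derivableM df dg).
Qed.

Lemma ex_cderivD f g z : (exists a, cderiv f z a) -> (exists a, cderiv g z a) ->
  exists a, cderiv (fun w => f w + g w) z a.
Proof.
move=> /derivable_cderiv df /derivable_cderiv dg; apply/derivable_cderiv.
exact: (derivableD df dg).
Qed.

Lemma ex_cderivX f (z : R[i]) n : (exists a, cderiv f z a) ->
  exists a, cderiv (fun w => f w ^+ n) z a.
Proof.
move=> df; elim: n => [|n IH].
  exists 0 => e e0; exists 1 => // w _; rewrite !expr0 subrr mul0r subrr normc0.
  by rewrite mulr_ge0 ?normc_ge0// ltW.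
have -> : (fun w => f w ^+ n.+1) = (fun w => f w * f w ^+ n).
  by apply/funext => w; rewrite exprS.
exact: (ex_cderivM df IH).
Qed.

Lemma ex_cderiv_cst (c z : R[i]) : exists a, cderiv (fun=> c) z a.
Proof.
exists 0 => e e0; exists 1 => // w _; rewrite subrr mul0r subrr normc0.
by rewrite mulr_ge0 ?normc_ge0// ltW.
Qed.

Lemma cderiv_shift (w0 z : R[i]) : cderiv (fun x => x - w0) z 1.
Proof.
move=> e e0; exists 1 => // w _.
rewrite (_ : _ - _ - _ = 0); last by rewrite mul1r opprB addrA subrK subrr.
by rewrite normc0 mulr_ge0 ?normc_ge0// ltW.
Qed.

End complex_derivative.

(** * The maximum principle *)

Section maximum_principle.
Context (R : realType).
Implicit Types (f : R[i] -> R[i]).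

Lemma mvt_ub (Phi phi : R -> R) (a b M : R) : a <= b ->
  (forall x, a <= x <= b -> is_derive x 1 Phi (phi x)) ->
  (forall x, a <= x <= b -> phi x <= M) ->
  Phi b - Phi a <= M * (b - a).
Proof.
move=> ab dPhi phiM.
have [c] := @MVT_segment R Phi phi a b ab
  (fun x xab => dPhi x (let xab' := subset_itv_oo_cc xab in ltac:(by move: xab'; rewrite in_itv)))
  ltac:(by apply: derivable_within_continuous => x; rewrite in_itv/= => /dPhi []).
by rewrite in_itv/= => cab ->; rewrite ler_wpM2r ?subr_ge0 ?phiM.
Qed.

Lemma mvt_lb (Phi phi : R -> R) (a b M : R) : a <= b ->
  (forall x, a <= x <= b -> is_derive x 1 Phi (phi x)) ->
  (forall x, a <= x <= b -> - phi x <= M) ->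
  - (Phi b - Phi a) <= M * (b - a).
Proof.
move=> ab dPhi phiM.
have dN x : a <= x <= b -> is_derive x 1 (- Phi) (- phi x).
  by move=> /dPhi ?; exact: is_deriveN.
by rewrite opprB addrC; have := @mvt_ub (- Phi) (fun x => - phi x) a b M ab dN phiM;
  rewrite !fctE opprK.
Qed.

Lemma Re_iV (z : R[i]) : complex.Re ('i * z^-1) = complex.Im z / normc z ^+ 2.
Proof.
by rewrite sqr_normcE; case: z => a b; rewrite /= mul0r sub0r mul1r opprK.
Qed.

Lemma Im_iV (z : R[i]) : complex.Im ('i * z^-1) = complex.Re z / normc z ^+ 2.
Proof.
by rewrite sqr_normcE; case: z => a b; rewrite /= mul0r add0r mul1r.
Qed.

(** Cauchy's integral formula, reduced to the bound that it implies. The quotient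
    (f - f(w0)) / (z - w0), extended by f'(w0), has no circulation. A unimodular factor turns
    the contribution of f(w0) into |f(w0)| times that of 1 / (z - w0), which has a definite
    sign on each side of the rectangle; hence |f(w0)| is controlled by f on the sides. The
    constant depends only on the rectangle, which makes the bound applicable to powers of f. *)
Lemma cauchy_bound (l u c v x1 x2 y1 y2 p q : R) :
  l < x1 -> x1 < p -> p < x2 -> x2 < u ->
  c < y1 -> y1 < q -> q < y2 -> y2 < v ->
  exists C : R, forall f m,
    (forall x y, l < x < u -> c < y < v -> exists a, cderiv f (x +i* y) a) ->
    (forall x y, x1 <= x <= x2 -> y1 <= y <= y2 ->
       x = x1 \/ x = x2 \/ y = y1 \/ y = y2 -> normc (f (x +i* y)) <= m) ->
    normc (f (p +i* q)) <= C * m.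
Proof.
move=> lx1 x1p px2 x2u cy1 y1q qy2 y2v.
pose h := Num.min (Num.min (p - x1) (x2 - p)) (Num.min (q - y1) (y2 - q)).
have h0 : 0 < h by rewrite !lt_min !subr_gt0 x1p px2 y1q.
pose D2 := (x2 - x1) ^+ 2 + (y2 - y1) ^+ 2.
have D20 : 0 < D2 by rewrite addr_gt0// exprn_gt0// subr_gt0; lra.
exists (D2 / h ^+ 2) => f m df fm.
have D2h : 0 <= D2 / h ^+ 2 by rewrite divr_ge0// ?exprn_ge0// ltW.
have m0 : 0 <= m.
  by apply: le_trans (fm x1 y1 _ _ _); [exact: normc_ge0|lra|lra|left].
have [v0|v0] := eqVneq (f (p +i* q)) 0; first by rewrite v0 normc0 mulr_ge0.
pose w0 : R[i] := p +i* q.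
pose V := normc (f w0).
have V0 : 0 < V by rewrite normc_gt0.
pose un : R[i] := V%:C / f w0.
have un1 : normc un = 1.
  by rewrite normcM normcV normc_real ger0_norm ?divff ?gt_eqF// ltW.
have unV : un * f w0 = V%:C by rewrite divfK.
have [a dfa] : exists a, cderiv f w0 a by apply: df; apply/andP; split; lra.
pose k (z : R[i]) := if z == w0 then - 'i * un * a else - 'i * un * ((f z - f w0) / (z - w0)).
have normk (t z : R[i]) : normc (- 'i * un * t - - 'i * un * z) = normc (t - z).
  by rewrite -mulrBr normcM (normcM (- _)) un1 normcN (_ : normc 'i = 1) ?mul1r//
    /normc /= expr0n /= add0r expr1n sqrtr1.
have kcts : forall e : R, 0 < e -> exists2 de : R, 0 < de &
    forall z, normc (z - w0) < de -> normc (k z - k w0) <= e.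
  move=> e e0; have [de de0 H] := dfa e e0; exists de => // z zde.
  rewrite /k eqxx; case: eqVneq => [_|zw]; first by rewrite subrr normc0 ltW.
  have n0 : 0 < normc (z - w0) by rewrite normc_gt0 subr_eq0.
  rewrite normk -(ler_pM2r n0) -normcM mulrBl divfK ?subr_eq0//; exact: H.
have dk x y : l < x < u -> c < y < v -> x != p \/ y != q ->
    exists b, cderiv k (x +i* y) b.
  move=> xin yin xy; set z := x +i* y.
  have zw : z != w0.
    by rewrite eq_complex /= negb_and; case: xy => ->; rewrite ?orbT.
  have [a1 d1] := df x y xin yin.
  have : derivable (fun z : R[i] => - 'i * un * ((f z - f w0) / (z - w0))) z (1 : R[i]).
    apply: derivableM; first exact: derivable_cst.
    apply: derivableM.
      by apply: derivableB; [apply/derivable_cderiv; exists a1|exact: derivable_cst].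
    apply: derivableV; first by rewrite subr_eq0.
    by apply/derivable_cderiv; exists 1; exact: cderiv_shift.
  move=> /derivable_cderiv[b db]; exists b.
  have n0 : 0 < normc (z - w0) by rewrite normc_gt0 subr_eq0.
  apply: cderiv_local n0 _ db => t tz; rewrite /k; case: eqVneq => // tw.
  by move: tz; rewrite tw distcC ltxx.
have ck x y : l < x < u -> c < y < v -> ccts k (x +i* y).
  move=> xin yin; have [/andP[/eqP -> /eqP ->]|] := boolP ((x == p) && (y == q)).
    move=> e e0; have [de de0 H] := kcts (e / 2) ltac:(by rewrite divr_gt0).
    by exists de => // w /H /le_lt_trans; apply; lra.
  rewrite negb_and => /orP xy; have [b db] := dk x y xin yin xy.
  exact: cderiv_cts db.
have [X [Y XY]] := @field_primitives R k l ((l + x1) / 2) u c ((c + y1) / 2) v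
  ltac:(lra) ltac:(lra) ck.
have prim : primitives (fun x y => complex.Re (k (x +i* y)))
    (fun x y => - complex.Im (k (x +i* y))) X Y x1 x2 y1 y2.
  by move=> x y /andP[? ?] /andP[? ?]; apply: XY; apply/andP; split; lra.
have [de de0 kde] := kcts 1 ltr01.
have circ0 : circ X Y x1 x2 y1 y2 = 0.
  apply: (@goursat_punctured R _ _ X Y x1 x2 y1 y2 p q (normc (k w0) + 1) (de / 2)) prim _ _.
  - by rewrite x1p.
  - by rewrite y1q.
  - by rewrite divr_gt0.
  - move=> x y xin yin xy; have [b db] : exists b, cderiv k (x +i* y) b.
      by apply: dk => //; lra.
    exact: cderiv_closed db.
  - move=> x y xde yde.
    have : normc ((x +i* y) - w0) < de.
      rewrite (_ : _ - w0 = (x - p) +i* (y - q)); last by [].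
      by apply: le_lt_trans (normc_le_ReIm _) _; rewrite /= (splitr de) ltrD.
    move=> /kde kk; have kb : normc (k (x +i* y)) <= normc (k w0) + 1.
      rewrite -[k (x +i* y)](subrK (k w0)) (le_trans (le_normcD _ _))// addrC.
      by rewrite lerD2l.
    by rewrite normrN; split; apply: le_trans kb; [exact: normc_Re|exact: normc_Im].
(* on each side, B bounds the component of the field in the direction of integration *)
pose B := m / h - V * h / D2.
have bdry x y : x1 <= x <= x2 -> y1 <= y <= y2 ->
    x = x1 \/ x = x2 \/ y = y1 \/ y = y2 ->
    let z := (x +i* y) - w0 in
    [/\ h <= normc z, normc z ^+ 2 <= D2, k (x +i* y) = - 'i * un * (f (x +i* y) / z) + V%:C * ('i * z^-1)
      & normc (- 'i * un * (f (x +i* y) / z)) <= m / h].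
  move=> xin yin xy z.
  have zE : z = (x - p) +i* (y - q) by [].
  have hz : h <= normc z.
    have [t1 [t2 [t3 t4]]] : h <= p - x1 /\ h <= x2 - p /\ h <= q - y1 /\ h <= y2 - q.
      by rewrite /h !ge_min !lexx !orbT.
    case: xy => [e|[e|[e|e]]]; subst.
    - by apply: le_trans (normc_Re _); rewrite zE /= distrC ger0_norm; lra.
    - by apply: le_trans (normc_Re _); rewrite zE /= ger0_norm; lra.
    - by apply: le_trans (normc_Im _); rewrite zE /= distrC ger0_norm; lra.
    - by apply: le_trans (normc_Im _); rewrite zE /= ger0_norm; lra.
  have zn0 : 0 < normc z by exact: lt_le_trans hz.
  have z0 : z != 0 by rewrite -normc_gt0.
  split=> //.
  - rewrite sqr_normcE zE /= /D2 lerD// -[leLHS]real_normK ?num_real// -[leRHS]real_normK ?num_real//.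
      by rewrite ler_pXn2r ?nnegrE// [leRHS]ger0_norm ?ler_norml; lra.
    by rewrite ler_pXn2r ?nnegrE// [leRHS]ger0_norm ?ler_norml; lra.
  - rewrite /k ifF; last by apply/negbTE; rewrite -subr_eq0.
    by rewrite -/z -unV; field.
  - rewrite -[X in normc X]subr0 -{1}(mulr0 (- 'i * un)) normk subr0 normcM normcV.
    rewrite ler_pM ?invr_ge0 ?normc_ge0 ?fm// lef_pV2//.
have Bge (s n2 t : R) : s <= - h -> n2 <= D2 -> 0 < n2 -> t <= m / h -> t + V * (s / n2) <= B.
  move=> sh nD n0 tm; rewrite /B lerD// -mulrA -mulrN ler_pM2l//.
  rewrite ler_pdivrMr//; apply: (le_trans sh); rewrite mulNr lerN2.
  by rewrite -mulrA ger_pMr// mulrC ler_pdivrMr// mul1r.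
have [hx1 [hx2 [hy1 hy2]]] : h <= p - x1 /\ h <= x2 - p /\ h <= q - y1 /\ h <= y2 - q.
  by rewrite /h !ge_min !lexx !orbT.
have Rek x y : x1 <= x <= x2 -> y1 <= y <= y2 ->
    x = x1 \/ x = x2 \/ y = y1 \/ y = y2 ->
    [/\ y = y1 -> complex.Re (k (x +i* y)) <= B,
       y = y2 -> - complex.Re (k (x +i* y)) <= B,
       x = x2 -> - complex.Im (k (x +i* y)) <= B &
       x = x1 -> - - complex.Im (k (x +i* y)) <= B].
  move=> xin yin xy; have [z1 z2 -> z4] := bdry x y xin yin xy.
  set z := _ - w0 in z1 z2 z4 *.
  have zn0 : 0 < normc z ^+ 2 by rewrite exprn_gt0//; exact: lt_le_trans z1.
  set t := - 'i * un * _ in z4 *.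
  have := le_trans (normc_Re t) z4; have := le_trans (normc_Im t) z4.
  rewrite !ler_norml => /andP[t1 t2] /andP[t3 t4].
  have ReV (r : R[i]) : complex.Re (V%:C * r) = V * complex.Re r.
    by case: r => r1 r2; rewrite /= mul0r subr0.
  have ImV (r : R[i]) : complex.Im (V%:C * r) = V * complex.Im r.
    by case: r => r1 r2; rewrite /= mul0r addr0.
  have ReD (r s : R[i]) : complex.Re (r + s) = complex.Re r + complex.Re s by case: r s => [? ?] [].
  have ImD (r s : R[i]) : complex.Im (r + s) = complex.Im r + complex.Im s by case: r s => [? ?] [].
  rewrite ReD ImD ReV ImV Re_iV Im_iV.
  split=> e.
  - by apply: Bge => //; rewrite /z e /= -opprB lerN2.
  - by rewrite opprD -mulrN -mulNr; apply: Bge => //; [rewrite /z e /= lerN2|rewrite lerNl].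
  - by rewrite opprD -mulrN -mulNr; apply: Bge => //; [rewrite /z e /= lerN2|rewrite lerNl].
  - by rewrite opprK; apply: Bge => //; rewrite /z e /= -opprB lerN2.
have xle : x1 <= x2 by lra.
have yle : y1 <= y2 by lra.
have x1in : x1 <= x1 <= x2 by rewrite lexx.
have x2in : x1 <= x2 <= x2 by rewrite lexx andbT.
have y1in : y1 <= y1 <= y2 by rewrite lexx.
have y2in : y1 <= y2 <= y2 by rewrite lexx andbT.
have e1 : X x2 y1 - X x1 y1 <= B * (x2 - x1).
  apply: mvt_ub xle (fun x xin => (prim x y1 xin y1in).1) _ => x xin.
  by have [->] := Rek x y1 xin y1in ltac:(right; right; left; reflexivity).
have e2 : - (X x2 y2 - X x1 y2) <= B * (x2 - x1).
  apply: mvt_lb xle (fun x xin => (prim x y2 xin y2in).1) _ => x xin.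
  by have [_ ->] := Rek x y2 xin y2in ltac:(right; right; right; reflexivity).
have e3 : Y x2 y2 - Y x2 y1 <= B * (y2 - y1).
  apply: mvt_ub yle (fun y yin => (prim x2 y x2in yin).2) _ => y yin.
  by have [_ _ ->] := Rek x2 y x2in yin ltac:(right; left; reflexivity).
have e4 : - (Y x1 y2 - Y x1 y1) <= B * (y2 - y1).
  apply: mvt_lb yle (fun y yin => (prim x1 y x1in yin).2) _ => y yin.
  by have [_ _ _ ->] := Rek x1 y x1in yin ltac:(left; reflexivity).
have B0 : 0 <= B.
  have s0 : 0 < 2 * ((x2 - x1) + (y2 - y1)) by rewrite mulr_gt0// addr_gt0 ?subr_gt0//; apply: lt_trans; eassumption.
  rewrite -(pmulr_lge0 _ s0); move: e1 e2 e3 e4 circ0; rewrite /circ; clear; lra.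
have : V * h / D2 <= m / h by rewrite -subr_ge0.
rewrite ler_pdivrMr// mulrAC ler_pdivlMr// => VV.
by rewrite -/V mulrAC ler_pdivlMr ?exprn_gt0// (mulrC D2); apply: le_trans VV; rewrite expr2 mulrA.
Qed.

Lemma le_of_powers (s t C : R) : 0 <= s -> 0 <= t ->
  (forall n, s ^+ n <= C * t ^+ n) -> s <= t.
Proof.
move=> s0 t0 H; rewrite leNgt; apply/negP => ts.
have sp : 0 < s by exact: le_lt_trans ts.
have C0 : 0 < C by have := H 0%N; rewrite !expr0 mulr1; apply: lt_le_trans.
have cv : (fun n => C * (t / s) ^+ n) @ \oo --> (0 : R).
  rewrite -(mulr0 C); apply: cvgMr; apply: cvg_expr.
  by rewrite ger0_norm ?divr_ge0// ltr_pdivrMr// mul1r.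
have [N _ /(_ N (leqnn N))] := cvgr_lt (0 : R) cv 1 ltr01.
rewrite /= expr_div_n mulrA ltr_pdivrMr ?exprn_gt0// mul1r ltNge.
by rewrite H.
Qed.

(** The bound for f^n has the same constant C for all n; taking n-th roots removes it. *)
Lemma maximum_rect (l u c v x1 x2 y1 y2 p q m : R) f :
  l < x1 -> x1 < p -> p < x2 -> x2 < u ->
  c < y1 -> y1 < q -> q < y2 -> y2 < v ->
  (forall x y, l < x < u -> c < y < v -> exists a, cderiv f (x +i* y) a) ->
  (forall x y, x1 <= x <= x2 -> y1 <= y <= y2 ->
     x = x1 \/ x = x2 \/ y = y1 \/ y = y2 -> normc (f (x +i* y)) <= m) ->
  normc (f (p +i* q)) <= m.
Proof.
move=> a1 a2 a3 a4 b1 b2 b3 b4 df fm.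
have [C HC] := cauchy_bound a1 a2 a3 a4 b1 b2 b3 b4.
have m0 : 0 <= m.
  by apply: le_trans (fm x1 y1 _ _ _); [exact: normc_ge0|lra|lra|left].
apply: (@le_of_powers _ _ C) => // [|n]; first exact: normc_ge0.
rewrite -normcX; apply: (HC (fun z => f z ^+ n)) => x y xin yin.
  have := df x y xin yin.
  exact: ex_cderivX.
by move=> xy; rewrite normcX lerXn2r ?nnegrE ?normc_ge0// fm.
Qed.

End maximum_principle.

(** * Holomorphic functions near a boundary point *)

Section boundary_estimate.
Context (R : realType).
Implicit Types (f : R[i] -> R[i]).

Lemma lt_in3 (l x u a b : R) : l < a -> b < u -> a <= x <= b -> l < x < u.
Proof. by move=> la bu /andP[ax xb]; rewrite (lt_le_trans la)//= (le_lt_trans xb). Qed.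

(** The quotient h = (f - f(z)) / (w - z) is at most 2 m / r on the boundary of the square
    of half side r, hence inside. As only the continuity of h is known at the centre z, the
    maximum principle is applied to h^N (w - z), which is differentiable at z, and N tends to
    infinity. *)
Lemma schwarz_deriv (l u c v p q r m : R) f a :
  0 < r -> l < p - r -> p + r < u -> c < q - r -> q + r < v ->
  (forall x y, l < x < u -> c < y < v -> exists a, cderiv f (x +i* y) a) ->
  (forall x y, p - r <= x <= p + r -> q - r <= y <= q + r -> normc (f (x +i* y)) <= m) ->
  cderiv f (p +i* q) a -> normc a <= 2 * m / r.
Proof.
move=> r0 lp pu cq qv df fm dfa.
have pin : p - r < p < p + r by apply/andP; split; lra.
have qin : q - r < q < q + r by apply/andP; split; lra.
have m0 : 0 <= m.
  by apply: le_trans (fm p q _ _); [exact: normc_ge0|lra|lra].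
pose z : R[i] := p +i* q.
pose h w := if w == z then a else (f w - f z) / (w - z).
have hz w : (w - z) * h w = f w - f z.
  rewrite /h; case: eqVneq => [->|wz]; first by rewrite !subrr mul0r.
  by rewrite mulrC divfK ?subr_eq0.
have hcts : forall e : R, 0 < e -> exists2 de : R, 0 < de &
    forall w, normc (w - z) < de -> normc (h w - h z) < e.
  move=> e e0; have [|de de0 H] := dfa (e / 2); first by rewrite divr_gt0.
  exists de => // w wde; rewrite /h eqxx; case: eqVneq => [_|wz]; first by rewrite subrr normc0.
  have n0 : 0 < normc (w - z) by rewrite normc_gt0 subr_eq0.
  rewrite -(ltr_pM2r n0) -normcM mulrBl divfK ?subr_eq0//.
  apply: le_lt_trans (H w wde) _; rewrite ltr_pM2r//; lra.
have dh x y : l < x < u -> c < y < v -> x +i* y != z -> exists b, cderiv h (x +i* y) b.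
  move=> xin yin; set w := x +i* y => wz.
  have [b db] : exists b, cderiv (fun w => (f w - f z) * (w - z)^-1) w b.
    apply: ex_cderivM.
      by apply: (ex_cderivD (df x y xin yin)); exact: ex_cderiv_cst.
    apply/derivable_cderiv/derivableV; first by rewrite subr_eq0.
    by apply/derivable_cderiv; exists 1; exact: cderiv_shift.
  exists b; have n0 : 0 < normc (w - z) by rewrite normc_gt0 subr_eq0.
  apply: cderiv_local n0 _ db => t tw; rewrite /h; case: eqVneq => // tz.
  by move: tw; rewrite tz distcC ltxx.
(* h ^ N times (w - z) is differentiable at z too, with derivative h(z) ^ N *)
have dF N x y : l < x < u -> c < y < v ->
    exists b, cderiv (fun w => h w ^+ N * (w - z)) (x +i* y) b.
  move=> xin yin; have [->|wz] := eqVneq (x +i* y) z; last first.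
    apply: ex_cderivM; first exact/ex_cderivX/dh.
    by exists 1; exact: cderiv_shift.
  have ctsN : forall e : R, 0 < e -> exists2 de : R, 0 < de &
      forall w, normc (w - z) < de -> normc (h w ^+ N - h z ^+ N) < e.
    have : {for z, continuous (fun w => h w ^+ N)}.
      have ch : {for z, continuous h}.
        apply/(@cvgrPdist_lt _ _ _ (nbhs z)) => e; rewrite ltcE => /andP[/eqP /= ei /= e0].
        have [de de0 H] := hcts _ e0; apply/nbhsCP; exists de => // w /H.
        by rewrite distrC normCE ltcE /= ei eqxx.
      elim: (N) => [|n IH].
        have -> : (fun w => h w ^+ 0) = cst (1 : R[i]) by apply/funext => w; rewrite expr0.
        exact: cst_continuous.
      have -> : (fun w => h w ^+ n.+1) = (fun w => h w * h w ^+ n).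
        by apply/funext => w; rewrite exprS.
      exact: (@cvgM R[i] R[i] (nbhs z) _ h (fun w => h w ^+ n) _ _ ch IH).
    move=> /cvgrPdist_lt cN e e0; have := cN e%:C; rewrite ltcR => /(_ e0) /nbhsCP[de de0 H].
    by exists de => // w /H; rewrite normCE ltcR distcC.
  exists (h z ^+ N) => e e0; have [de de0 H] := ctsN e e0; exists de => // w /H /ltW wde.
  by rewrite subrr mulr0 subr0 -mulrBl normcM ler_wpM2r ?normc_ge0.
have fz : normc (f z) <= m by apply: fm; lra.
have hb w : (exists x y, [/\ w = x +i* y, p - r < x < p + r & q - r < y < q + r]) ->
    w != z -> normc (h w) <= 2 * m / r.
  move=> [x [y [-> /andP[x1 x2] /andP[y1 y2]]]]; set w' := x +i* y => wz.
  have n0 : 0 < normc (w' - z) by rewrite normc_gt0 subr_eq0.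
  have B0 : 0 <= 2 * m / r by rewrite divr_ge0 ?mulr_ge0// ltW.
  apply: (@le_of_powers _ _ _ (2 * r / normc (w' - z))) => // [|N]; first exact: normc_ge0.
  rewrite mulrAC ler_pdivlMr// -normcX -normcM.
  apply: (@maximum_rect R l u c v (p - r) (p + r) (q - r) (q + r) x y _
    (fun w => h w ^+ N * (w - z))) => //; first by move=> ? ? ? ?; exact: dF.
  move=> x' y' x'in y'in bd; set zt := x' +i* y'.
  have wz1 : r <= normc (zt - z).
    have E1 (o : R) : o - r - o = - r by ring.
    have E2 (o : R) : o + r - o = r by ring.
    case: bd => [e|[e|[e|e]]].
    - by apply: le_trans (normc_Re _); rewrite /zt /z e /= E1 normrN ger0_norm// ltW.
    - by apply: le_trans (normc_Re _); rewrite /zt /z e /= E2 ger0_norm// ltW.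
    - by apply: le_trans (normc_Im _); rewrite /zt /z e /= E1 normrN ger0_norm// ltW.
    - by apply: le_trans (normc_Im _); rewrite /zt /z e /= E2 ger0_norm// ltW.
  have wz2 : normc (zt - z) <= 2 * r.
    apply: le_trans (normc_le_ReIm _) _; rewrite mulr_natl mulr2n lerD// /= ler_distl//.
  have n1 : 0 < normc (zt - z) by exact: lt_le_trans wz1.
  rewrite normcM normcX mulrC ler_pM ?normc_ge0 ?exprn_ge0// ?normc_ge0//.
  rewrite lerXn2r ?nnegrE ?normc_ge0//.
  have -> : h zt = (f zt - f z) / (zt - z) by rewrite -hz mulrAC divff ?mul1r// -normc_gt0.
  rewrite normcM normcV ler_pM ?invr_ge0 ?normc_ge0 ?lef_pV2//.
  rewrite (le_trans (normcB_le _ _))// mulr_natl mulr2n lerD//.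
  exact: fm.
have -> : a = h z by rewrite /h eqxx.
apply/ler_addgt0Pl => e e0; have [de de0 H] := hcts e e0.
pose t := Num.min (de / 2) (r / 2).
have t0 : 0 < t by rewrite lt_min !divr_gt0.
have td : t < de by rewrite gt_min; apply/orP; left; lra.
have tr : t < r by rewrite gt_min; apply/orP; right; lra.
pose w : R[i] := (p + t) +i* q.
have wz : w - z = t%:C by rewrite /w /z [LHS]/GRing.add/= subrr addrAC subrr add0r.
have /H hw : normc (w - z) < de by rewrite wz normc_real gtr0_norm.
have {}hb : normc (h w) <= 2 * m / r.
  apply: hb; last by rewrite -subr_eq0 wz eq_complex /= eqxx andbT gt_eqF.
  by exists (p + t), q; split => //; apply/andP; split; lra.
rewrite -[h z](subrK (h w)) (le_trans (le_normcD _ _))// lerD//.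
by rewrite distcC ltW.
Qed.

(** On the rectangle |Im u| <= 1, -1 <= Re u <= 0, this multiplier has modulus at most 1,
    and at most 19/20 on the three sides off the imaginary axis, but it is 1 at 0. A high
    power of it therefore makes those three sides negligible in the maximum principle,
    and costs little near 0. *)
Definition barrier (u : R[i]) : R[i] := 1 + u * (8^-1%:C) + u ^+ 2 * (16^-1%:C).

Lemma sqr_norm_barrier (k t : R) : 0 <= k <= 1 -> `|t| <= 1 ->
  normc (barrier (- k +i* t)) ^+ 2 <= 1 - 27 / 256 * (2 * k - k ^+ 2 + t ^+ 2).
Proof.
move=> /andP[k0 k1] t1; rewrite sqr_normcE.
have -> : barrier (- k +i* t) =
   (1 - k / 8 + (k ^+ 2 - t ^+ 2) / 16) +i* (t / 8 - 2 * k * t / 16).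
  rewrite /barrier expr2 /=; apply/eqP; rewrite eq_complex /=.
  by apply/andP; split; apply/eqP; field.
rewrite /=; set m := 2 * k - k ^+ 2; set T := t ^+ 2.
have T0 : 0 <= T by exact: sqr_ge0.
have T1 : T <= 1 by rewrite /T -real_normK ?num_real// expr_le1.
have m0 : 0 <= m by rewrite /m; nra.
have m1 : m <= 1 by rewrite /m; have := sqr_ge0 (k - 1); nra.
have -> : (1 - k / 8 + (k ^+ 2 - T) / 16) ^+ 2 + (t / 8 - 2 * k * t / 16) ^+ 2 =
  1 - (m + T) / 8 + ((m - T) ^+ 2 + 4 * T) / 256 by rewrite /m /T; field.
have : (m - T) ^+ 2 <= m + T by nra.
lra.
Qed.

Lemma barrier_le1 (k t : R) : 0 <= k <= 1 -> `|t| <= 1 ->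
  normc (barrier (- k +i* t)) <= 1.
Proof.
move=> k1 t1; rewrite -(ler_pXn2r (n := 2)) ?nnegrE ?normc_ge0// expr1n.
apply: le_trans (sqr_norm_barrier k1 t1) _; move/andP: k1 => [k0 k1].
have := sqr_ge0 t; nra.
Qed.

Lemma barrier_side (k t : R) : 0 <= k <= 1 -> `|t| <= 1 -> k = 1 \/ `|t| = 1 ->
  normc (barrier (- k +i* t)) <= 19 / 20.
Proof.
move=> k1 t1 side; rewrite -(ler_pXn2r (n := 2)) ?nnegrE ?normc_ge0// ?divr_ge0//.
apply: le_trans (sqr_norm_barrier k1 t1) _.
have : 1 <= 2 * k - k ^+ 2 + t ^+ 2.
  case: side => [->|t1']; first by have := sqr_ge0 t; lra.
  move/andP: k1 => [k0 k1]; rewrite -[t ^+ 2]real_normK ?num_real// t1'; nra.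
lra.
Qed.

Lemma barrier_ge (u : R[i]) : normc u <= 1 -> 1 - normc u <= normc (barrier u).
Proof.
move=> u1.
have b3 : normc (u * (8^-1%:C) + u ^+ 2 * (16^-1%:C)) <= normc u.
  rewrite (le_trans (le_normcD _ _))// !normcM !normc_real !ger0_norm ?invr_ge0//.
  have := normc_ge0 u; nra.
have : normc (1 : R[i]) <= normc (barrier u) + normc (u * (8^-1%:C) + u ^+ 2 * (16^-1%:C)).
  rewrite {1}(_ : 1 = barrier u - (u * (8^-1%:C) + u ^+ 2 * (16^-1%:C))); first exact: normcB_le.
  by rewrite /barrier; ring.
rewrite normc1; lra.
Qed.

Lemma ex_cderiv_barrier (s : R) (z : R[i]) :
  exists a, cderiv (fun w => barrier (w * s%:C)) z a.
Proof.
have d1 : exists a, cderiv (fun w => w * s%:C) z a.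
  apply: ex_cderivM; last exact: ex_cderiv_cst.
  have := cderiv_shift 0 z; rewrite (_ : (fun x => x - 0) = id); last first.
    by apply/funext => x; rewrite subr0.
  by move=> d; exists 1.
apply: ex_cderivD.
  apply: ex_cderivD; first exact: ex_cderiv_cst.
  by apply: ex_cderivM; [|exact: ex_cderiv_cst].
by apply: ex_cderivM; [exact: (@ex_cderivX R _ z 2 d1)|exact: ex_cderiv_cst].
Qed.

Lemma power_decay (e : R) : 0 < e -> exists2 N, (0 < N)%N & N%:R * (19 / 20) ^+ N <= e :> R.
Proof.
move=> e0; pose p : R := 39 / 40.
have cv : (fun n => 39 * p ^+ n) @ \oo --> (0 : R).
  rewrite -(mulr0 39); apply: cvgMr; apply: cvg_expr.
  rewrite ger0_norm ?divr_ge0// /p; lra.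
have [N _ NP] := cvgr_le (0 : R) cv e e0.
exists N.+1 => //; apply: le_trans (NP N.+1 (leqnSn _)).
have : (19 / 20) ^+ N.+1 <= p ^+ N.+1 * p ^+ N.+1.
  by rewrite -exprMn lerXn2r ?nnegrE ?divr_ge0// ?mulr_ge0 ?divr_ge0// /p; lra.
move=> /(ler_wpM2l (ler0n R N.+1)) /le_trans; apply.
rewrite mulrA ler_wpM2r ?exprn_ge0 ?divr_ge0//.
have -> : p = (1 + 39^-1)^-1 by rewrite /p; field.
rewrite exprVn ler_pdivrMr ?exprn_gt0//.
have : 1 + N.+1%:R * 39^-1 <= (1 + 39^-1) ^+ N.+1 :> R.
  elim: (N.+1) => [|n IH]; first by rewrite mul0r addr0.
  rewrite exprS -natr1; have : 0 <= n%:R :> R by [].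
  nra.
lra.
Qed.

Lemma bernoulli_le (q : R) N : 0 <= q <= 1 -> 1 - N%:R * q <= (1 - q) ^+ N.
Proof.
move=> /andP[q0 q1]; elim: N => [|n IH]; first by rewrite mul0r subr0 expr0.
rewrite exprS -natr1; have : 0 <= n%:R :> R by [].
move=> n0; have := ler_wpM2l (ltac:(lra) : 0 <= 1 - q) IH; nra.
Qed.

(** An argument in the style of Phragmen and Lindelof. With s = - x, consider the rectangle
    of size A s resting on the imaginary axis. On the side along the axis f is at most e s / 2
    up to an arbitrarily small error, by the third bound; on the other sides it is at most a
    multiple of A s, which the N-th power of the barrier brings below e s / 2. In the cone the
    same power is at least 1/2, since A is chosen proportional to N. *)
Lemma boundary_small f (rho K c e : R) : 0 < rho -> 0 <= K -> 0 <= c -> 0 < e ->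
  (forall x y, - rho < x < 0 -> - rho < y < rho -> exists a, cderiv f (x +i* y) a) ->
  (forall x y, - rho < x < 0 -> - rho < y < rho -> normc (f (x +i* y)) <= K * (- x + `|y|)) ->
  (forall eta : R, 0 < eta -> exists2 de : R, 0 < de & forall x y, - rho < x < 0 -> - rho < y < rho ->
     `|y| < de -> normc (f (x +i* y)) <= eta * `|y| + K * - x) ->
  exists2 s0 : R, 0 < s0 & forall x y, - s0 < x < 0 -> `|y| <= c * - x ->
    normc (f (x +i* y)) <= e * - x.
Proof.
move=> rho0 K0 c0 e0 df H1 H2.
pose c' := 1 + c; have c'1 : 1 <= c' by rewrite /c'; lra.
have k8 : 0 < 8 * K * c' + 8 by rewrite ltr_wpDl// !mulr_ge0//; lra.
have [N N0 Np] := @power_decay (e / (8 * K * c' + 8)) (divr_gt0 e0 k8).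
have N1 : 1 <= N%:R :> R by rewrite ler1n.
pose A := 2 * N%:R * c'; have A2 : 2 <= A by rewrite /A; nra.
have A0 : 0 < A by lra.
have [de de0 Hde] := H2 (e / (2 * A)) ltac:(by rewrite divr_gt0// mulr_gt0).
exists (Num.min de rho / (2 * A)); first by rewrite divr_gt0 ?lt_min ?de0// mulr_gt0.
move=> x y /andP[xs x0] yc.
pose s := - x; have s0 : 0 < s by rewrite oppr_gt0.
have sA : A * s < Num.min de rho.
  have : s * (2 * A) < Num.min de rho by rewrite -ltr_pdivlMr ?mulr_gt0// /s; lra.
  by move: s0; clear -A0; nra.
have /andP[As1 As2] : (A * s < de) && (A * s < rho) by move: sA; rewrite lt_min.
have As0 : 0 < A * s by rewrite mulr_gt0.
have c'A : c' <= A by rewrite /A; clear -N1 c'1; nra.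
have ys : `|y| < A * s.
  apply: le_lt_trans yc _; rewrite -/s ltr_pM2r//; apply: lt_le_trans c'A; rewrite /c'; lra.
have As_s : s < A * s by rewrite ltr_pMl//; lra.
pose Psi (z : R[i]) := barrier (z * ((A * s)^-1)%:C).
have scale (x' y' : R) : (x' +i* y') * ((A * s)^-1)%:C = (- (- x' / (A * s))) +i* (y' / (A * s)).
  by rewrite [LHS]/GRing.mul/= !mulr0 subr0 add0r mulNr opprK.
have uz : normc ((x +i* y) * ((A * s)^-1)%:C) <= c' / A.
  rewrite normcM normc_real ger0_norm; last by rewrite invr_ge0 ltW.
  rewrite ler_pdivrMr// mulrA divfK ?gt_eqF//.
  apply: le_trans (normc_le_ReIm _) _; rewrite /= ltr0_norm// -/s.
  by apply: le_trans (lerD (lexx s) yc) _; rewrite -/s /c' mulrDl mul1r.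
have cA1 : 0 <= c' / A <= 1.
  apply/andP; split; last by rewrite ler_pdivrMr// mul1r.
  by rewrite divr_ge0//; lra.
have Psi_ge : 2^-1 <= normc (Psi (x +i* y)) ^+ N.
  have b1 : 1 - c' / A <= normc (Psi (x +i* y)).
    apply: le_trans (barrier_ge _); first by rewrite lerD2l lerN2.
    by apply: le_trans uz _; case/andP: cA1.
  apply: le_trans (_ : (1 - c' / A) ^+ N <= _); last first.
    by rewrite lerXn2r ?nnegrE ?normc_ge0// subr_ge0; case/andP: cA1.
  apply: le_trans (bernoulli_le N cA1).
  have -> : N%:R * (c' / A) = 2^-1; last by lra.
  have Nn : N%:R != 0 :> R by rewrite gt_eqF//; lra.
  have cn : c' != 0 by rewrite gt_eqF//; lra.
  by rewrite /A; field; rewrite cn Nn.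
apply/ler_addgt0Pl => t t0.
pose ep := Num.min (s / 2) (t / (2 * K + 2)).
have K2 : 0 < 2 * K + 2 by lra.
have ep0 : 0 < ep by rewrite lt_min !divr_gt0.
have eps : ep < s by rewrite gt_min; apply/orP; left; rewrite ltr_pdivrMr//; lra.
have ept : 2 * K * ep <= t.
  have : ep * (2 * K + 2) <= t by rewrite -ler_pdivlMr// ge_min lexx orbT.
  by clear -ep0; nra.
pose m := e * s / 2 + K * ep.
have FM : normc (f (x +i* y) * Psi (x +i* y) ^+ N) <= m.
  move: (ys); rewrite ltr_norml => /andP[ys1 ys2].
  apply: (@maximum_rect R (- rho) 0 (- rho) rho (- (A * s)) (- ep) (- (A * s)) (A * s) x y m
    (fun z => f z * Psi z ^+ N)) => //.
  - by rewrite ltrN2.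
  - by rewrite ltrNl.
  - by rewrite ltrNr.
  - by rewrite oppr_lt0.
  - by rewrite ltrN2.
  - by move=> x' y' x'in y'in; apply: ex_cderivM; [exact: df|exact/ex_cderivX/ex_cderiv_barrier].
  move=> x' y' /andP[x'1 x'2] y'in bd.
  have y'A : `|y'| <= A * s by rewrite ler_norml.
  have x'0 : - rho < x' < 0.
    apply/andP; split; first by apply: lt_le_trans x'1; rewrite ltrN2.
    by apply: le_lt_trans x'2 _; rewrite oppr_lt0.
  have y'r : - rho < y' < rho by rewrite -ltr_norml; exact: le_lt_trans As2.
  rewrite /Psi scale normcM normcX.
  set k := - x' / (A * s); set u := y' / (A * s).
  have kin : 0 <= k <= 1.
    apply/andP; split; last by rewrite /k ler_pdivrMr// mul1r lerNl.
    apply: divr_ge0; last exact: ltW.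
    by rewrite oppr_ge0; case/andP: x'0 => _ /ltW.
  have uin : `|u| <= 1.
    by rewrite /u normrM normfV (ger0_norm (ltW As0)) ler_pdivrMr// mul1r.
  have side : k = 1 \/ `|u| = 1 -> normc (f (x' +i* y')) * normc (barrier (- k +i* u)) ^+ N <= m.
    move=> sd; have := barrier_side kin uin sd => b1.
    have f1 : normc (f (x' +i* y')) <= K * (2 * (A * s)).
      apply: le_trans (H1 _ _ x'0 y'r) _; rewrite ler_wpM2l// mulr_natl mulr2n lerD//.
      by rewrite lerNl.
    apply: (@le_trans _ _ (K * (2 * (A * s)) * (19 / 20) ^+ N)).
      by rewrite ler_pM ?normc_ge0 ?exprn_ge0 ?normc_ge0// lerXn2r ?nnegrE ?normc_ge0// divr_ge0.
    have -> : K * (2 * (A * s)) * (19 / 20) ^+ N = (4 * K * c' * s) * (N%:R * (19 / 20) ^+ N).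
      by rewrite /A; ring.
    apply: le_trans (ler_wpM2l _ Np) _; first by rewrite !mulr_ge0//; [lra|exact: ltW].
    apply: (@le_trans _ _ (e * s / 2)); last by rewrite lerDl mulr_ge0// ltW.
    rewrite mulrA ler_pdivrMr//.
    rewrite (_ : 4 * K * c' * s * e = (e * s / 2) * (8 * K * c')); last by field.
    by rewrite ler_wpM2l ?lerDl// divr_ge0 ?mulr_ge0 ?ltW.
  case: bd => [xe|[xe|[ye|ye]]].
  - by apply: side; left; rewrite /k xe opprK divff// gt_eqF.
  - have b1 := barrier_le1 kin uin.
    apply: (@le_trans _ _ (normc (f (x' +i* y')))).
      by rewrite ler_piMr ?normc_ge0// exprn_ile1 ?normc_ge0.
    apply: le_trans (Hde _ _ x'0 y'r (le_lt_trans y'A As1)) _.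
    rewrite xe opprK /m lerD2r.
    apply: (@le_trans _ _ (e / (2 * A) * (A * s))); first by rewrite ler_wpM2l//; apply: divr_ge0; [exact: ltW|rewrite mulr_ge0// ltW].
    by rewrite le_eqVlt; apply/orP; left; apply/eqP; field; rewrite gt_eqF.
  - by apply: side; right; rewrite /u ye mulNr divff ?normrN1// gt_eqF.
  - by apply: side; right; rewrite /u ye divff ?normr1// gt_eqF.
rewrite normcM normcX in FM.
have : normc (f (x +i* y)) * 2^-1 <= m.
  by apply: le_trans FM; rewrite ler_wpM2l ?normc_ge0.
rewrite ler_pdivrMr// => /le_trans; apply.
by rewrite /m -/s; move: ept; clear; lra.
Qed.

(** A cone contains squares centred at its points with sides proportional to the distance
    to the axis: the bound of f in a wider cone gives one for its derivative. *)
Lemma boundary_derivative f (rho K c e : R) : 0 < rho -> 0 <= K -> 0 <= c -> 0 < e ->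
  (forall x y, - rho < x < 0 -> - rho < y < rho -> exists a, cderiv f (x +i* y) a) ->
  (forall x y, - rho < x < 0 -> - rho < y < rho -> normc (f (x +i* y)) <= K * (- x + `|y|)) ->
  (forall eta : R, 0 < eta -> exists2 de : R, 0 < de & forall x y, - rho < x < 0 -> - rho < y < rho ->
     `|y| < de -> normc (f (x +i* y)) <= eta * `|y| + K * - x) ->
  exists2 s0 : R, 0 < s0 & forall x y a, - s0 < x < 0 -> `|y| <= c * - x ->
    cderiv f (x +i* y) a -> normc a <= e.
Proof.
move=> rho0 K0 c0 e0 df H1 H2.
have [s1 s10 H] := boundary_small rho0 K0 (ltac:(lra) : 0 <= 2 * c + 1)
  (ltac:(by rewrite divr_gt0) : 0 < e / 6) df H1 H2.
have c1 : 0 < 2 * (c + 1) by lra.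
exists (Num.min (s1 / 2) (rho / (2 * (c + 1)))); first by rewrite lt_min !divr_gt0.
move=> x y a /andP[xs x0] yc da; pose s := - x.
have s0 : 0 < s by rewrite oppr_gt0.
have : s < Num.min (s1 / 2) (rho / (2 * (c + 1))) by rewrite ltrNl.
rewrite lt_min !ltr_pdivlMr// => /andP[ss1 sr].
move: yc; rewrite -/s ler_norml => /andP[y1 y2].
have sc : 0 <= s * c by rewrite mulr_ge0// ltW.
have xE : x = - s by rewrite opprK.
have sr1 : s * c + s < rho / 2 by move: sr; clear; lra.
have y1' : - (s * c) <= y by rewrite mulrC.
have y2' : y <= s * c by rewrite mulrC.
have -> : e = 2 * (e / 6 * (3 / 2 * s)) / (s / 2) by field; rewrite gt_eqF.
apply: (@schwarz_deriv (- rho) 0 (- rho) rho x y (s / 2) _ f a) => //; rewrite ?xE.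
- by rewrite divr_gt0.
- by move: rho0 sr1 sc s0; clear; lra.
- by move: s0; clear; lra.
- by move: rho0 y1' sr1 s0; clear; lra.
- by move: rho0 y2' sr1 s0; clear; lra.
- move=> x' y' /andP[a1 a2] /andP[b1 b2].
  have x'0 : - s1 < x' < 0 by apply/andP; split; move: a1 a2 ss1 s0; clear; lra.
  apply: le_trans (H x' y' x'0 _) _.
    have : 0 <= c * (- x' - s / 2) by rewrite mulr_ge0//; move: a2; clear; lra.
    by rewrite ler_norml => h; apply/andP; split; move: h a2 b1 b2 y1' y2' s0; clear; lra.
  by rewrite ler_pM2l ?divr_gt0//; move: a1; clear; lra.
Qed.

End boundary_estimate.

(** * Lipschitz functions are differentiable almost everywhere *)

Section lipschitz_differentiable.
Context (R : realType).
Local Notation leb := (@lebesgue_measure R).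

(** Write g = 2 h - x and x = h + k with h and k nondecreasing. The Stieltjes measures of h
    and k add up to Lebesgue measure, so that the one of h has a density; h is an
    indefinite integral of it, hence differentiable almost everywhere. *)
Lemma lipschitz_ae_derivable (g : R -> R) :
  (forall x y, `|g x - g y| <= `|x - y|) ->
  {ae leb, forall x, 0 < x < 1 -> derivable g x 1}.
Proof.
move=> lip.
have cg : continuous g.
  move=> x; apply/cvgrPdist_lt => e e0; near=> y.
  by apply: le_lt_trans (lip x y) _; near: y; exact: cvgr_dist_lt.
have lip' x y : x <= y -> `|g y - g x| <= y - x.
  by move=> xy; rewrite (le_trans (lip _ _))// ger0_norm// subr_ge0.
pose h x : R := (x + g x) / 2; pose k x : R := (x - g x) / 2.
have ndh : {homo h : x y / x <= y}.
  by move=> x y xy; have := lip' x y xy; rewrite ler_norml => /andP[a b]; rewrite /h; lra.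
have ndk : {homo k : x y / x <= y}.
  by move=> x y xy; have := lip' x y xy; rewrite ler_norml => /andP[a b]; rewrite /k; lra.
have rch : right_continuous h.
  apply/right_continuousW => x; apply: cvgMl; apply: cvgD; [exact: cvg_id|exact: cg].
have rck : right_continuous k.
  apply/right_continuousW => x; apply: cvgMl; apply: cvgB; [exact: cvg_id|exact: cg].
pose H : cumulative R R := HB.pack h (isCumulative.Build R _ R h ndh rch).
pose K : cumulative R R := HB.pack k (isCumulative.Build R _ R k ndk rck).
pose nuH := lebesgue_stieltjes_measure H; pose nuK := lebesgue_stieltjes_measure K.
have oc (F : cumulative R R) (a b : R) : a <= b ->
    lebesgue_stieltjes_measure F `]a, b]%classic = (F b - F a)%:E.
  move=> ab; rewrite /lebesgue_stieltjes_measure /measure_extension.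
  by rewrite measurable_mu_extE/=; [rewrite wlength_itv_bnd|exact: is_ocitv].
have sum A : measurable A -> leb A = measure_add nuH nuK A.
  apply: lebesgue_measure_unique => X /ocitvP[->|[[a b] /= ab ->]].
    by rewrite !measure0.
  transitivity (nuH `]a, b]%classic + nuK `]a, b]%classic)%E; last exact/esym/measure_addE.
  rewrite /nuH /nuK !oc ?ltW// lebesgue_measure_itv/= lte_fin ab.
  by rewrite -!EFinD; congr (_%:E); rewrite /H /K /= /h /k; lra.
have dom A : measurable A -> (nuH A <= leb A)%E.
  by move=> mA; rewrite sum// [leRHS]measure_addE leeDl.
pose D : set (measurableTypeR R) := `]0, 1]%classic.
have mD : measurable D by exact: measurable_itv.
have Doo : (nuH D < +oo)%E by rewrite /nuH oc// ltry.
pose nu : {finite_measure set (measurableTypeR R) -> \bar R} := mfrestr mD Doo.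
have nu_dom : charge_of_finite_measure nu `<< leb.
  apply/null_content_dominatesP => A mA A0; apply/eqP; rewrite eq_le.
  apply/andP; split; last exact: measure_ge0.
  apply: (@le_trans _ _ (nuH A)); first by apply: le_measure; rewrite ?inE//; exact: measurableI.
  by rewrite -A0; exact: dom.
pose fE := Radon_Nikodym (charge_of_finite_measure nu) leb.
pose f := fine \o fE.
have fEE : fE = EFin \o f.
  by apply/funext => x; rewrite /= fineK//; exact: Radon_Nikodym_fin_num.
have intf : leb.-integrable setT (EFin \o f).
  by rewrite -fEE; exact: Radon_Nikodym_integrable.
have locf : locally_integrable setT f.
  by apply: open_integrable_locally => //; exact: openT.
have inty (y : R) : leb.-integrable [set` Interval (BRight 0) (BRight y)] (EFin \o f).
  by apply: integrableS intf => //; exact: measurable_itv.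
have := @FTC1 R f (BRight 0) inty locf.
apply: filterS; first exact: (ae_filter_ringOfSetsType leb).
move=> x Fx /andP[x0 x1].
have {Fx} [|dF _] := Fx.
  by rewrite /Order.lt/=.
have FE y : 0 < y < 1 -> (\int[leb]_(t in [set` Interval (BRight 0) (BRight y)]) f t)%R = h y - h 0.
  move=> /andP[y0 y1].
  rewrite /Rintegral (_ : (\int[leb]_(t in _) _)%E = (\int[leb]_(t in `]0%R, y]) fE t)%E); last first.
    by rewrite fEE.
  have mI : measurable (`]0, y]%classic : set (measurableTypeR R)) by exact: measurable_itv.
  rewrite -(Radon_Nikodym_integral nu_dom mI).
  rewrite /charge_of_finite_measure /nu /= /mfrestr /mrestr (_ : _ `&` D = `]0, y]%classic).
    by rewrite /nuH oc ?ltW.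
  apply/seteqP; split => t; rewrite /D /= !in_itv/=; first by case.
  by move=> /andP[-> ty]; split => //=; rewrite (le_trans ty)// ltW.
have -> : g = (fun y => 2 * h y - y) by apply/funext => y; rewrite /h; lra.
apply: derivableB; last exact: derivable_id.
apply: derivableM; first exact: derivable_cst.
pose F y := (\int[leb]_(t in [set` Interval (BRight 0) (BRight y)]) f t)%R + h 0.
have dF' : derivable F x 1 by apply: derivableD; [exact: dF|exact: derivable_cst].
have nF : {near x, F =1 h}.
  near=> y; rewrite /F FE ?subrK//; apply/andP; split; near: y.
    exact: lt_nbhsr.
  exact: lt_nbhsl.
exact: near_eq_derivable nF dF'.
Unshelve. all: by end_near. Qed.

End lipschitz_differentiable.

(** * Fatou's theorem in the half plane *)

Section half_plane_fatou.
Context (R : realType).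
Implicit Types (f : R[i] -> R[i]).
Local Notation leb := (@lebesgue_measure R).

Lemma mvt_abs (Phi phi : R -> R) (a b k M : R) :
  (forall x, Num.min a b <= x <= Num.max a b -> is_derive x 1 Phi (phi x)) ->
  (forall x, Num.min a b <= x <= Num.max a b -> `|phi x - k| <= M) ->
  `|Phi b - Phi a - k * (b - a)| <= M * `|b - a|.
Proof.
move=> d m; have [ab|/ltW ba] := leP a b.
  rewrite [in leRHS]ger0_norm ?subr_ge0//.
  by apply: (@mvt_le R Phi phi) => // x xab; [apply: d|apply: m]; rewrite min_l// max_r.
rewrite [in leRHS]distrC [in leRHS]ger0_norm ?subr_ge0//.
rewrite -normrN opprB (_ : _ - _ = Phi a - Phi b - k * (a - b)); last by ring.
by apply: (@mvt_le R Phi phi) => // x xab; [apply: d|apply: m]; rewrite min_r// max_l.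
Qed.

(** As circulations vanish, integrating first along the line x = o and then horizontally, or
    in the other order, gives the same function up to a constant: the first path shows its
    derivative in x, the second one in y. *)
Lemma potential f (l a u c b v : R) : l < a -> a < u -> c < b -> b < v ->
  (forall x y, l < x < u -> c < y < v -> exists a, cderiv f (x +i* y) a) ->
  exists g : R -> R -> R, forall x y, a < x < u -> b < y < v ->
    is_derive x 1 (g ^~ y) (complex.Re (f (x +i* y))) /\
    is_derive y 1 (g x) (- complex.Im (f (x +i* y))).
Proof.
move=> la au cb bv df.
have [X [Y XY]] := @field_primitives R f l a u c b v la cb
  (fun x y xin yin => let: ex_intro d dd := df x y xin yin in cderiv_cts dd).
pose o := (a + u) / 2.
have oin : a < o < u by rewrite /o; apply/andP; split; lra.
have circ0 x1 x2 y1 y2 : a < x1 -> x1 <= x2 -> x2 < u -> b < y1 -> y1 <= y2 -> y2 < v ->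
    circ X Y x1 x2 y1 y2 = 0.
  move=> h1 h2 h3 h4 h5 h6.
  have sub x y : x1 <= x <= x2 -> y1 <= y <= y2 -> a < x < u /\ b < y < v.
    by move=> xin yin; split; [exact: lt_in3 h1 h3 xin|exact: lt_in3 h4 h6 yin].
  apply: (@goursat R (fun x y => complex.Re (f (x +i* y))) (fun x y => - complex.Im (f (x +i* y)))) => //.
    by move=> x y xin yin; have [? ?] := sub _ _ xin yin; exact: XY.
  move=> x y xin yin; have [/andP[x1' x2'] /andP[y1' y2']] := sub _ _ xin yin.
  have [|d dd] := df x y _ ltac:(by rewrite (lt_trans cb)); first by rewrite (lt_trans la).
  exact: cderiv_closed dd.
have ind x y y' : a < x < u -> b < y < v -> b < y' < v ->
    X x y' - X o y' + Y o y' - (X x y - X o y + Y o y) = Y x y' - Y x y.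
  wlog yy : y y' / y <= y'.
    move=> H xin yin y'in; have [yy|/ltW yy] := leP y y'; first exact: (H y y').
    have E := H y' y yy xin y'in yin.
    by rewrite -[LHS]opprB E opprB.
  move=> /andP[x1 x2] /andP[y1 _] /andP[_ y2]; case/andP: oin => o1 o2.
  have [xo|/ltW ox] := leP x o.
    by have := circ0 x o y y' x1 xo o2 y1 yy y2; rewrite /circ; lra.
  by have := circ0 o x y y' o1 ox x2 y1 yy y2; rewrite /circ; lra.
exists (fun x y => X x y - X o y + Y o y) => x y xin yin; split.
  have [d1 _] := XY x y xin yin.
  by apply: is_derive_eq; rewrite subr0 addr0.
have [_ d2] := XY x y xin yin.
apply: (@near_eq_is_derive _ _ _ (fun y' => Y x y' - Y x y + (X x y - X o y + Y o y))).
  case/andP: (yin) => y1 y2; near=> y'; rewrite -(ind x y y') ?subrK//.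
  apply/andP; split; near: y'.
    exact: lt_nbhsr.
  exact: lt_nbhsl.
by apply: is_derive_eq; rewrite subr0 addr0.
Unshelve. all: by end_near. Qed.

(** The potentials of f and - i f are the real and imaginary parts of a primitive of f. They
    are Lipschitz because f is bounded. *)
Lemma holomorphic_primitive f (l a u c b v : R) : l < a -> a < u -> c < b -> b < v ->
  (forall x y, l < x < u -> c < y < v -> exists a, cderiv f (x +i* y) a) ->
  (forall x y, l < x < u -> c < y < v -> normc (f (x +i* y)) <= 1) ->
  exists g1 g2 : R -> R -> R,
   [/\ forall x y, a < x < u -> b < y < v ->
         cderiv (fun z => g1 (complex.Re z) (complex.Im z) +i* g2 (complex.Re z) (complex.Im z))
           (x +i* y) (f (x +i* y)),
       forall x y x' y', a < x < u -> b < y < v -> a < x' < u -> b < y' < v ->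
         `|g1 x' y' - g1 x y| <= `|x' - x| + `|y' - y| &
       forall x y x' y', a < x < u -> b < y < v -> a < x' < u -> b < y' < v ->
         `|g2 x' y' - g2 x y| <= `|x' - x| + `|y' - y|].
Proof.
move=> la au cb bv df f1.
have [g1 G1] := potential la au cb bv df.
have dif x y : l < x < u -> c < y < v -> exists d, cderiv (fun z => - 'i * f z) (x +i* y) d.
  by move=> xin yin; apply: ex_cderivM; [exact: ex_cderiv_cst|exact: df].
have [g2 G2'] := potential la au cb bv dif.
have G2 x y : a < x < u -> b < y < v -> is_derive x 1 (g2 ^~ y) (complex.Im (f (x +i* y))) /\
    is_derive y 1 (g2 x) (complex.Re (f (x +i* y))).
  move=> xin yin; have [] := G2' x y xin yin; case: (f _) => p q /=.
  by rewrite !oppr0 !mul0r !mulN1r !sub0r !opprK.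
have sub (m n o p q : R) : m < o < n -> m < p < n -> Num.min o p <= q <= Num.max o p -> m < q < n.
  move=> /andP[h1 h2] /andP[p1 p2] /andP[q1 q2]; apply/andP; split.
    by apply: lt_le_trans q1; rewrite lt_min h1.
  by apply: le_lt_trans q2 _; rewrite gt_max h2.
have inD x y : a < x < u -> b < y < v -> l < x < u /\ c < y < v.
  by move=> /andP[x1 ->] /andP[y1 ->]; rewrite (lt_trans la x1) (lt_trans cb y1).
have Lip (g : R -> R -> R) (P Q : R -> R -> R) :
    (forall x y, a < x < u -> b < y < v -> is_derive x 1 (g ^~ y) (P x y) /\ is_derive y 1 (g x) (Q x y)) ->
    (forall x y, a < x < u -> b < y < v -> `|P x y| <= 1 /\ `|Q x y| <= 1) ->
    forall x y x' y', a < x < u -> b < y < v -> a < x' < u -> b < y' < v ->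
         `|g x' y' - g x y| <= `|x' - x| + `|y' - y|.
  move=> dg PQ x y x' y' xin yin x'in y'in.
  have h1 : `|g x' y' - g x y'| <= `|x' - x|.
    have := @mvt_abs (g ^~ y') (P ^~ y') x x' 0 1.
    rewrite mul0r subr0 mul1r; apply=> t tin; first exact: (dg _ _ (sub _ _ _ _ _ xin x'in tin) y'in).1.
    by rewrite subr0; exact: (PQ _ _ (sub _ _ _ _ _ xin x'in tin) y'in).1.
  have h2 : `|g x y' - g x y| <= `|y' - y|.
    have := @mvt_abs (g x) (Q x) y y' 0 1.
    rewrite mul0r subr0 mul1r; apply=> t tin; first exact: (dg _ _ xin (sub _ _ _ _ _ yin y'in tin)).2.
    by rewrite subr0; exact: (PQ _ _ xin (sub _ _ _ _ _ yin y'in tin)).2.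
  rewrite -(subrKA (g x y')) (le_trans (ler_normD _ _))// lerD//.
have bnd x y : a < x < u -> b < y < v ->
    `|complex.Re (f (x +i* y))| <= 1 /\ `|complex.Im (f (x +i* y))| <= 1.
  move=> xin yin; have [x' y'] := inD _ _ xin yin; have := f1 _ _ x' y' => F1.
  by split; apply: le_trans F1; [exact: normc_Re|exact: normc_Im].
exists g1, g2; split.
- move=> x y xin yin e e0.
  have [x' y'] := inD _ _ xin yin; have [d dd] := df x y x' y'.
  have [|de de0 H] := cderiv_cts dd (_ : 0 < e / 4); first by rewrite divr_gt0.
  case/andP: (xin) => x1 x2; case/andP: (yin) => y1 y2.
  pose de' := Num.min (de / 2) (Num.min (Num.min (x - a) (u - x)) (Num.min (y - b) (v - y))).
  have de'0 : 0 < de' by rewrite !lt_min !subr_gt0 x1 x2 y1 y2 divr_gt0.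
  exists de' => // -[s t] st.
  have : normc ((s - x) +i* (t - y)) < de' by [].
  rewrite {st} => st; have hx := le_lt_trans (normc_Re _) st; have hy := le_lt_trans (normc_Im _) st.
  rewrite /= in hx hy; move: (hx) (hy); rewrite !lt_min => /andP[hx1 /andP[/andP[hx2 hx3] _]] /andP[hy1 /andP[_ /andP[hy2 hy3]]].
  have sin : a < s < u.
    by move: hx2 hx3; rewrite !ltr_norml => /andP[p1 p2] /andP[p3 p4]; apply/andP; split; move: p1 p4; clear; lra.
  have tin : b < t < v.
    by move: hy2 hy3; rewrite !ltr_norml => /andP[p1 p2] /andP[p3 p4]; apply/andP; split; move: p1 p4; clear; lra.
  have near (s' t' : R) : Num.min x s <= s' <= Num.max x s -> Num.min y t <= t' <= Num.max y t ->
      normc (f (s' +i* t') - f (x +i* y)) <= e / 4.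
    move=> hs ht; apply/ltW/H.
    have -> : (s' +i* t') - (x +i* y) = (s' - x) +i* (t' - y) by [].
    apply: le_lt_trans (normc_le_ReIm _) _; rewrite /= (splitr de) ltrD//.
      apply: le_lt_trans hx1; case/andP: hs => hs1 hs2.
      have [le|/ltW le] := leP x s.
        rewrite (min_l le) in hs1; rewrite (max_r le) in hs2.
        by rewrite !ger0_norm ?subr_ge0// lerD2r.
      rewrite (min_r le) in hs1; rewrite (max_l le) in hs2.
      by rewrite !ler0_norm ?subr_le0// lerN2 lerD2r.
    apply: le_lt_trans hy1; case/andP: ht => ht1 ht2.
    have [le|/ltW le] := leP y t.
        rewrite (min_l le) in ht1; rewrite (max_r le) in ht2.
        by rewrite !ger0_norm ?subr_ge0// lerD2r.
      rewrite (min_r le) in ht1; rewrite (max_l le) in ht2.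
      by rewrite !ler0_norm ?subr_le0// lerN2 lerD2r.
  have xmm : Num.min x s <= x <= Num.max x s by rewrite ge_min le_max lexx.
  have ymm : Num.min y t <= t <= Num.max y t by rewrite ge_min le_max lexx !orbT.
  set U := complex.Re (f (x +i* y)); set V := complex.Im (f (x +i* y)).
  have reB (z w : R[i]) : complex.Re z - complex.Re w = complex.Re (z - w) by case: z w => [? ?] [].
  have imB (z w : R[i]) : complex.Im z - complex.Im w = complex.Im (z - w) by case: z w => [? ?] [].
  have A1 : `|g1 s t - g1 x t - U * (s - x)| <= e / 4 * `|s - x|.
    apply: (@mvt_abs (g1 ^~ t) (fun x => complex.Re (f (x +i* t)))) => q qin.
      exact: (G1 _ _ (sub _ _ _ _ _ xin sin qin) tin).1.
    by rewrite reB (le_trans (normc_Re _))// near.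
  have A2 : `|g1 x t - g1 x y - (- V) * (t - y)| <= e / 4 * `|t - y|.
    apply: (@mvt_abs (g1 x) (fun y => - complex.Im (f (x +i* y)))) => q qin.
      exact: (G1 _ _ xin (sub _ _ _ _ _ yin tin qin)).2.
    by rewrite -opprD normrN imB (le_trans (normc_Im _))// near.
  have B1 : `|g2 s t - g2 x t - V * (s - x)| <= e / 4 * `|s - x|.
    apply: (@mvt_abs (g2 ^~ t) (fun x => complex.Im (f (x +i* t)))) => q qin.
      exact: (G2 _ _ (sub _ _ _ _ _ xin sin qin) tin).1.
    by rewrite imB (le_trans (normc_Im _))// near.
  have B2 : `|g2 x t - g2 x y - U * (t - y)| <= e / 4 * `|t - y|.
    apply: (@mvt_abs (g2 x) (fun y => complex.Re (f (x +i* y)))) => q qin.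
      exact: (G2 _ _ xin (sub _ _ _ _ _ yin tin qin)).2.
    by rewrite reB (le_trans (normc_Re _))// near.
  have -> : f (x +i* y) = U +i* V by rewrite /U /V; case: (f _).
  have -> : (s +i* t) - (x +i* y) = (s - x) +i* (t - y) by [].
  have -> : (g1 (complex.Re (s +i* t)) (complex.Im (s +i* t)) +i* g2 (complex.Re (s +i* t)) (complex.Im (s +i* t))) -
    (g1 (complex.Re (x +i* y)) (complex.Im (x +i* y)) +i* g2 (complex.Re (x +i* y)) (complex.Im (x +i* y))) -
     (U +i* V) * ((s - x) +i* (t - y)) =
    ((g1 s t - g1 x t - U * (s - x)) + (g1 x t - g1 x y - (- V) * (t - y))) +i*
    ((g2 s t - g2 x t - V * (s - x)) + (g2 x t - g2 x y - U * (t - y))).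
    by apply/eqP; rewrite eq_complex /=; apply/andP; split; apply/eqP; ring.
  apply: le_trans (normc_le_ReIm _) _.
  have e40 : 0 <= e / 4 by rewrite divr_ge0// ltW.
  have D1 := ler_wpM2l e40 (normc_Re ((s - x) +i* (t - y))).
  have D2 := ler_wpM2l e40 (normc_Im ((s - x) +i* (t - y))).
  move: D1 D2; set n := normc _; rewrite /= => D1 D2.
  have C1 := ler_normD (g1 s t - g1 x t - U * (s - x)) (g1 x t - g1 x y - (- V) * (t - y)).
  have C2 := ler_normD (g2 s t - g2 x t - V * (s - x)) (g2 x t - g2 x y - U * (t - y)).
  move: A1 A2 B1 B2 C1 C2 D1 D2; clear; lra.
- apply: (Lip g1 (fun x y => complex.Re (f (x +i* y))) (fun x y => - complex.Im (f (x +i* y)))) => //.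
  by move=> x y xin yin; rewrite normrN; exact: bnd.
- apply: (Lip g2 (fun x y => complex.Im (f (x +i* y))) (fun x y => complex.Re (f (x +i* y)))) => //.
  by move=> x y xin yin; have [] := bnd _ _ xin yin.
Qed.

Lemma derivable_expansion (g : R -> R) (t : R) : derivable g t 1 ->
  exists D : R, forall eta : R, 0 < eta -> exists2 de : R, 0 < de &
    forall h, `|h| < de -> `|g (t + h) - g t - D * h| <= eta * `|h|.
Proof.
move=> /cvg_ex[/= D cD]; exists D => eta eta0.
have /cvgrPdist_le/(_ eta eta0) := cD.
rewrite near_withinE => /nbhs_ballP[de /= de0 H]; exists de => // h hde.
have [->|h0] := eqVneq h 0; first by rewrite addr0 subrr mulr0 subr0 normr0 mulr0.
have := H h; rewrite /ball /= sub0r normrN => /(_ hde h0).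
rewrite /GRing.scale /= mulr1 (addrC h) => le.
have -> : g (t + h) - g t - D * h = - ((D - h^-1 * (g (t + h) - g t)) * h) by field.
by rewrite normrN normrM ler_wpM2r.
Qed.

(** A function that is 1-Lipschitz in x extends to x = 0. Since g x y + x is nondecreasing in
    x, a supremum serves as the limit. *)
Lemma boundary_values (g : R -> R -> R) (b v : R) :
  (forall x y x' y', - 2 < x < 0 -> b < y < v -> - 2 < x' < 0 -> b < y' < v ->
     `|g x' y' - g x y| <= `|x' - x| + `|y' - y|) ->
  exists gam : R -> R, forall x y, - 2 < x < 0 -> b < y < v -> `|gam y - g x y| <= - x.
Proof.
move=> lip; pose S y := [set g x y + x | x in [set x : R | - 2 < x < 0]].
have ub x y : - 2 < x < 0 -> b < y < v -> ubound (S y) (g x y - x).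
  move=> xin yin _ [x' x'in <-]; have := lip x y x' y xin yin x'in yin.
  rewrite subrr normr0 addr0 => le; have := le_trans (ler_norm _) le.
  move/andP: xin => [_ x0]; move/andP: x'in => [_ x'0].
  by have [xx|/ltW xx] := leP x x'; [rewrite ger0_norm ?subr_ge0//|rewrite ler0_norm ?subr_le0//]; lra.
exists (fun y => sup (S y)) => x y xin yin.
have le1 : sup (S y) <= g x y - x.
  by apply: ge_sup; [exists (g x y + x), x|exact: ub].
have le2 : g x y + x <= sup (S y).
  apply: sup_upper_bound; last by exists x.
  by split; [exists (g x y + x), x|exists (g x y - x); exact: ub].
by rewrite ler_norml; apply/andP; split; lra.
Qed.

(** Composing with this retraction extends a Lipschitz function from a neighbourhood of
    [0, 1] to the line. *)
Definition clamp01 (t : R) : R := Num.max 0 (Num.min t 1).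

Lemma clamp01_in t : 0 <= clamp01 t <= 1.
Proof. by rewrite /clamp01 le_max lexx ge_max ler01 ge_min lexx orbT. Qed.

Lemma clamp01_id t : 0 <= t <= 1 -> clamp01 t = t.
Proof. by move=> /andP[t0 t1]; rewrite /clamp01 min_l// max_r. Qed.

Lemma clamp01_lip s t : `|clamp01 s - clamp01 t| <= `|s - t|.
Proof.
have := ler_norm (s - t); have := ler_norm (t - s); rewrite distrC => a b.
have := normr_ge0 (s - t) => c.
rewrite ler_norml /clamp01 !(maxEle, minEle).
by do ![case: ifPn]; rewrite -?ltNge => *; apply/andP; split; lra.
Qed.

(** Let G be a primitive of f. Its boundary values on the imaginary axis are Lipschitz, hence
    have at almost every t a derivative, i L say. There
    F = G(z + i t) - G(i t) - L z grows at most linearly, because G is Lipschitz, and is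
    o(|y|) + O(|x|), because of the derivative. By [boundary_derivative] its derivative
    f - L tends to 0 in every cone. *)
Lemma halfplane_fatou f :
  (forall x y, x < 0 -> exists a, cderiv f (x +i* y) a) ->
  (forall x y, x < 0 -> normc (f (x +i* y)) <= 1) ->
  {ae leb, forall t, 0 < t < 1 -> exists L : R[i], forall c e : R, 0 <= c -> 0 < e ->
     exists2 s0 : R, 0 < s0 & forall x y, - s0 < x < 0 -> `|y - t| <= c * - x ->
       normc (f (x +i* y) - L) <= e}.
Proof.
move=> df f1.
have [g1 [g2 [dG lip1 lip2]]] := @holomorphic_primitive f (- 3) (- 2) 0 (- 2) (- 1) 2
  ltac:(lra) ltac:(lra) ltac:(lra) ltac:(lra)
  (fun x y xin _ => df x y (andP xin).2) (fun x y xin _ => f1 x y (andP xin).2).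
have [gam1 H1] := boundary_values lip1; have [gam2 H2] := boundary_values lip2.
have glip (g : R -> R -> R) (gam : R -> R) :
    (forall x y x' y', - 2 < x < 0 -> - 1 < y < 2 -> - 2 < x' < 0 -> - 1 < y' < 2 ->
     `|g x' y' - g x y| <= `|x' - x| + `|y' - y|) ->
    (forall x y, - 2 < x < 0 -> - 1 < y < 2 -> `|gam y - g x y| <= - x) ->
    forall s t, - 1 < s < 2 -> - 1 < t < 2 -> `|gam s - gam t| <= `|s - t|.
  move=> lip H s t sin tin; apply/ler_addgt0Pl => e e0.
  pose x : R := - Num.min 1 (e / 2).
  have xe : - x <= e / 2 by rewrite opprK ge_min lexx orbT.
  have xin : - 2 < x < 0.
    rewrite oppr_lt0 lt_min divr_gt0// ltr01 ltrN2 andbT gt_min; apply/orP; left; lra.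
  have := lip x t x s xin tin xin sin; rewrite subrr normr0 add0r => a.
  have := H x s xin sin; have := H x t xin tin; move: a xe; rewrite !ler_norml.
  set w := `|s - t|; clear; move=> /andP[p1 p2] p3 /andP[p4 p5] /andP[p6 p7].
  by apply/andP; split; lra.
have in01 t : - 1 < clamp01 t < 2.
  by have /andP[a b] := clamp01_in t; apply/andP; split; lra.
have ae1 := @lipschitz_ae_derivable R (fun t => gam1 (clamp01 t))
  (fun s t => le_trans (glip _ _ lip1 H1 _ _ (in01 s) (in01 t)) (clamp01_lip s t)).
have ae2 := @lipschitz_ae_derivable R (fun t => gam2 (clamp01 t))
  (fun s t => le_trans (glip _ _ lip2 H2 _ _ (in01 s) (in01 t)) (clamp01_lip s t)).
have aeF : Filter (nbhs (almost_everywhere leb)) := ae_filter_ringOfSetsType leb.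
apply: filterS2 ae1 ae2 => t + + tin => /(_ tin)/derivable_expansion[D1 E1] /(_ tin)/derivable_expansion[D2 E2].
(* along the axis d/dy G = i G', so that D1 + i D2 = i L *)
pose L : R[i] := D2 -i* D1.
exists L => c e c0 e0.
case/andP: (tin) => t0 t1.
pose rho := Num.min t (1 - t).
have rho0 : 0 < rho by rewrite lt_min t0 subr_gt0.
have rho1 : rho <= t /\ rho <= 1 - t by rewrite /rho !ge_min !lexx orbT.
have [rt r1t] := rho1.
have tyin y : - rho < y < rho -> 0 <= t + y <= 1 /\ - 1 < t + y < 2.
  by move=> /andP[y1 y2]; split; apply/andP; split; move: y1 y2 rt r1t; clear; lra.
have xin2 x : - rho < x < 0 -> - 2 < x < 0.
  by move=> /andP[x1 ->]; rewrite andbT; move: x1 rt t1; clear; lra.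
have tin2 : - 1 < t < 2 by move: t0 t1; clear; move=> ? ?; apply/andP; split; lra.
pose G z := g1 (complex.Re z) (complex.Im z) +i* g2 (complex.Re z) (complex.Im z).
pose Gt : R[i] := gam1 t +i* gam2 t.
pose F (z : R[i]) := G (z + (0 +i* t)) - Gt - L * z.
have dF x y : - rho < x < 0 -> - rho < y < rho ->
    cderiv F (x +i* y) (f (x +i* (t + y)) - L).
  move=> xin yin e' e'0; have [_ yin2] := tyin y yin.
  have [de de0 H] := dG x (t + y) (xin2 x xin) yin2 e' e'0.
  have zE : (x +i* y) + (0 +i* t) = x +i* (t + y) by rewrite [LHS]/GRing.add/= addr0 addrC.
  exists de => // w wde.
  have wE : (w + (0 +i* t)) - (x +i* (t + y)) = w - (x +i* y) by rewrite -zE; ring.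
  have := H (w + (0 +i* t)); rewrite wE => /(_ wde).
  apply: le_trans; rewrite le_eqVlt; apply/orP; left; apply/eqP; congr normc.
  by rewrite /F zE /G; ring.
pose K : R := 2 + normc L.
have n0 := normc_ge0 L.
have near_bd x y : - rho < x < 0 -> - rho < y < rho ->
    normc (G (x +i* (t + y)) - (gam1 (t + y) +i* gam2 (t + y))) <= 2 * - x.
  move=> xin yin; have [_ yin2] := tyin y yin; have xin' := xin2 x xin.
  apply: le_trans (normc_le_ReIm _) _; rewrite /= distrC (distrC (g2 _ _)) mulr_natl mulr2n.
  by rewrite lerD// ?H1 ?H2.
have FE x y : F (x +i* y) = (G (x +i* (t + y)) - (gam1 (t + y) +i* gam2 (t + y)))
    + ((gam1 (t + y) - gam1 t - D1 * y) +i* (gam2 (t + y) - gam2 t - D2 * y)) - L * x%:C.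
  rewrite /F /G /Gt /L; apply/eqP; rewrite eq_complex /=; apply/andP.
  by rewrite !addr0 (addrC y); split; apply/eqP; ring.
have [||||s0 s00 Hs] := @boundary_derivative R F rho K c e rho0 _ c0 e0.
- by rewrite addr_ge0.
- by move=> x y xin yin; exists (f (x +i* (t + y)) - L); exact: dF.
- move=> x y xin yin.
  have [_ yin2] := tyin y yin.
  have E : F (x +i* y) = (G (x +i* (t + y)) - (gam1 (t + y) +i* gam2 (t + y)))
      + ((gam1 (t + y) - gam1 t) +i* (gam2 (t + y) - gam2 t)) - L * (x +i* y).
    rewrite /F /G /Gt; apply/eqP; rewrite eq_complex /=; apply/andP.
    by rewrite !addr0 (addrC y); split; apply/eqP; ring.
  rewrite E; have := near_bd x y xin yin; set A := G _ - _ => nA.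
  set B := (_ +i* _); have nB : normc B <= 2 * `|y|.
    have := glip _ _ lip1 H1 _ _ yin2 tin2; have := glip _ _ lip2 H2 _ _ yin2 tin2.
    rewrite (_ : t + y - t = y); last by ring.
    move=> h2 h1; apply: le_trans (normc_le_ReIm _) _; rewrite /B [complex.Re _]/= [complex.Im _]/=.
    by move: h1 h2; clear; lra.
  have nC : normc (L * (x +i* y)) <= normc L * (- x + `|y|).
    rewrite normcM ler_wpM2l// (le_trans (normc_le_ReIm _))// [complex.Re _]/= [complex.Im _]/=.
    by rewrite ltr0_norm//; case/andP: xin.
  have x0 : 0 <= - x by case/andP: xin => _ /ltW; rewrite oppr_ge0.
  have := normcB_le (A + B) (L * (x +i* y)); have := le_normcD A B.
  by rewrite /K; move: nA nB nC x0 (normr_ge0 y); clear; lra.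
- move=> eta eta0; have [de1 de10 h1] := E1 (eta / 2) ltac:(by rewrite divr_gt0).
  have [de2 de20 h2] := E2 (eta / 2) ltac:(by rewrite divr_gt0).
  exists (Num.min de1 de2); first by rewrite lt_min de10.
  move=> x y xin yin; rewrite lt_min => /andP[y1 y2].
  have [yin1 yin2] := tyin y yin.
  have := h1 y y1; have := h2 y y2.
  rewrite !clamp01_id ?(ltW t0) ?(ltW t1)// => {}h2 {}h1.
  rewrite FE; have := near_bd x y xin yin; set A := G _ - _ => nA.
  set B := (_ +i* _); have nB : normc B <= eta * `|y|.
    by apply: le_trans (normc_le_ReIm _) _; rewrite /B [complex.Re _]/= [complex.Im _]/=; move: h1 h2; clear; lra.
  have nC : normc (L * x%:C) = normc L * - x.
    by rewrite normcM normc_real ltr0_norm//; case/andP: xin.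
  have := normcB_le (A + B) (L * x%:C); have := le_normcD A B; rewrite nC.
  by rewrite /K; move: nA nB; clear; lra.
exists (Num.min s0 (rho / (c + 1))); first by rewrite lt_min s00 divr_gt0// ltr_wpDl.
move=> x y /andP[x1 x0] yt.
have c1 : 0 < c + 1 by rewrite ltr_wpDl.
have : - x < Num.min s0 (rho / (c + 1)) by rewrite ltrNl.
rewrite lt_min ltr_pdivlMr// => /andP[xs xr].
have cx : 0 <= c * - x by rewrite mulr_ge0// oppr_ge0 ltW.
have xin : - rho < x < 0 by rewrite x0 andbT; move: xr cx; clear; lra.
have yin : - rho < y - t < rho.
  by rewrite -ltr_norml; apply: le_lt_trans yt _; move: xr x0; clear; lra.
have := Hs x (y - t) _ _ yt (dF _ _ xin yin); rewrite (addrC t) subrK; apply.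
by rewrite x0 andbT ltrNl.
Unshelve. all: by end_near. Qed.

End half_plane_fatou.

(** * Lebesgue measure under shears *)

Section affine_tuple.
Context (R : realType).
Local Notation TR := (measurableTypeR R).
Local Notation leb := (@lebesgue_measure R).
Local Notation lebn n := (tuple_measure leb n).

Lemma measurable_affine1 (c a : R) : measurable_fun [set: TR] (fun x : TR => c * x + a : TR).
Proof.
by apply: measurable_funD => //; apply: measurable_funM.
Qed.

Lemma lebesgue_affine (c a : R) (A : set TR) : 0 < c -> measurable A ->
  leb ((fun x => c * x + a) @^-1` A) = (c^-1%:E * leb A)%E.
Proof.
move=> c0 mA.
have cge0 : 0 <= c by exact: ltW.
pose nu : {measure set TR -> \bar R} :=
  measure_function_pushforward__canonical__measure_function_Measure leb (measurable_affine1 c a).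
have E X : measurable X -> leb X = mscale (NngNum cge0) nu X.
  apply: lebesgue_measure_unique => Y /ocitvP[->|[[p q] /= pq ->]].
    by rewrite !measure0.
  rewrite /mscale /nu /= /pushforward (_ : _ @^-1` _ = `](p - a) / c, (q - a) / c]%classic).
    rewrite !lebesgue_measure_itv/= !lte_fin pq ltr_pM2r ?invr_gt0// ltrD2r pq -EFinB -EFinM.
    by congr (_%:E); field; rewrite gt_eqF.
  apply/seteqP; split => x; rewrite /= !in_itv/= ltr_pdivrMr// ler_pdivlMr// ltrBlDr lerBrDr mulrC//.
rewrite [in RHS]E// /mscale /= muleA -EFinM mulVf ?gt_eqF// mul1e.
by [].
Qed.

Definition affine_tuple n (c : R) (M : 'I_n -> 'I_n -> R) (al : 'I_n -> R) (t : n.-tuple TR) : n.-tuple TR :=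
  [tuple c * tnth t i + \sum_k M i k * tnth t k + al i | i < n].

Lemma measurable_affine_tuple n c M al :
  measurable_fun [set: n.-tuple TR] (@affine_tuple n c M al).
Proof.
apply/measurable_fun_tnthP => i.
rewrite (_ : _ \o _ = fun t => c * tnth t i + \sum_k M i k * tnth t k + al i); last first.
  by apply/funext => t /=; rewrite tnth_mktuple.
have mt k : measurable_fun [set: n.-tuple TR] (fun t => tnth t k : R).
  exact: measurable_tnth.
apply: measurable_funD => //; apply: measurable_funD.
  exact: measurable_funM.
by apply: measurable_sum => k; exact: measurable_funM.
Qed.

Lemma lebn_section1 n (E : set (n.+1.-tuple TR)) : measurable E ->
  lebn n.+1 E = (\int[leb]_x lebn n [set t : n.-tuple TR | E [tuple of x :: t]])%E.
Proof.
move=> mE; rewrite /= /cons_measure /pushforward /product_measure1.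
by apply: eq_integral => x _ /=; congr (tuple_measure _ _ _); apply/seteqP; split => t;
  rewrite /xsection /= inE.
Qed.

Lemma lebn_section2 n (E : set (n.+1.-tuple TR)) : measurable E ->
  lebn n.+1 E = (\int[lebn n]_t leb [set x : TR | E [tuple of x :: t]])%E.
Proof.
move=> mE.
have mc : measurable_fun [set: TR * n.-tuple TR] (fun p => [tuple of p.1 :: p.2] : n.+1.-tuple TR).
  exact: measurable_cons.
have mE' : measurable ((fun p : TR * n.-tuple TR => [tuple of p.1 :: p.2]) @^-1` E).
  by rewrite -[X in measurable X]setTI; exact: mc.
transitivity ((leb \x^ lebn n)%E ((fun p : TR * n.-tuple TR => [tuple of p.1 :: p.2]) @^-1` E)).
  rewrite /= /cons_measure /pushforward.
  by apply: product_measure_unique => //= ? ? ? ?; rewrite product_measure2E.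
rewrite /product_measure2; apply: eq_integral => t _ /=; congr (lebesgue_measure _).
by apply/seteqP; split => x; rewrite /ysection /= inE.
Qed.

Lemma measurable_section1 n (E : set (n.+1.-tuple TR)) (x : TR) : measurable E ->
  measurable [set t : n.-tuple TR | E [tuple of x :: t]].
Proof.
move=> mE; rewrite -[X in measurable X]setTI.
have : measurable_fun [set: n.-tuple TR] (fun t => [tuple of x :: t] : n.+1.-tuple TR).
  by apply: measurable_cons => //; exact: measurable_cst.
exact.
Qed.

Lemma measurable_section2 n (E : set (n.+1.-tuple TR)) (t : n.-tuple TR) : measurable E ->
  measurable [set x : TR | E [tuple of x :: t]].
Proof.
move=> mE; rewrite -[X in measurable X]setTI.
have : measurable_fun [set: TR] (fun x => [tuple of x :: t] : n.+1.-tuple TR).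
  by apply: measurable_cons => //; exact: measurable_cst.
exact.
Qed.

Lemma measurable_lebn_section1 n (E : set (n.+1.-tuple TR)) : measurable E ->
  measurable_fun [set: TR] (fun x => lebn n [set t : n.-tuple TR | E [tuple of x :: t]]).
Proof.
move=> mE.
have mc : measurable_fun [set: TR * n.-tuple TR] (fun p => [tuple of p.1 :: p.2] : n.+1.-tuple TR).
  exact: measurable_cons.
have mE' : measurable ((fun p : TR * n.-tuple TR => [tuple of p.1 :: p.2]) @^-1` E).
  by rewrite -[X in measurable X]setTI; exact: mc.
rewrite (_ : (fun x => _) = (lebn n) \o xsection ((fun p : TR * n.-tuple TR => [tuple of p.1 :: p.2]) @^-1` E)).
  exact: measurable_fun_xsection.
apply/funext => x /=; congr (tuple_measure _ _ _); apply/seteqP; split => t; rewrite /xsection /= inE//.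
Qed.

Lemma measurable_lebn_section2 n (E : set (n.+1.-tuple TR)) : measurable E ->
  measurable_fun [set: n.-tuple TR] (fun t => leb [set x : TR | E [tuple of x :: t]]).
Proof.
move=> mE.
have mc : measurable_fun [set: TR * n.-tuple TR] (fun p => [tuple of p.1 :: p.2] : n.+1.-tuple TR).
  exact: measurable_cons.
have mE' : measurable ((fun p : TR * n.-tuple TR => [tuple of p.1 :: p.2]) @^-1` E).
  by rewrite -[X in measurable X]setTI; exact: mc.
rewrite (_ : (fun t => _) = leb \o ysection ((fun p : TR * n.-tuple TR => [tuple of p.1 :: p.2]) @^-1` E)).
  exact: measurable_fun_ysection.
apply/funext => t /=; congr (lebesgue_measure _); apply/seteqP; split => x; rewrite /ysection /= inE//.
Qed.

Lemma ge0_integral_scaled_pushforward d (X : measurableType d) (m : {measure set X -> \bar R})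
    (phi : X -> X) (k : R) (f : X -> \bar R) : 0 <= k ->
  measurable_fun setT phi -> measurable_fun setT f -> (forall x, 0 <= f x)%E ->
  (forall A, measurable A -> m (phi @^-1` A) = (k%:E * m A)%E) ->
  (\int[m]_x f (phi x) = k%:E * \int[m]_x f x)%E.
Proof.
move=> k0 mphi mf f0 H.
transitivity (\int[pushforward m phi]_x f x)%E.
  by rewrite ge0_integral_pushforward ?preimage_setT.
transitivity (\int[mscale (NngNum k0) m]_x f x)%E.
  by apply: eq_measure_integral => A mA _; exact: H.
by rewrite ge0_integral_mscale.
Qed.

(** Fubini's theorem, one coordinate at a time: each is dilated by c and translated by an
    amount depending on the others. Only ordinary coordinates are added to special ones;
    hence a special coordinate can be integrated first, the others being fixed, and an
    ordinary one last, its image depending on no other. *)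
Lemma lebn_affine n (spec : pred 'I_n) (c : R) M al (E : set (n.-tuple TR)) : 0 < c ->
  (forall i k, M i k != 0 -> spec i && ~~ spec k) -> measurable E ->
  lebn n (@affine_tuple n c M al @^-1` E) = ((c^-1 ^+ n)%:E * lebn n E)%E.
Proof.
move=> c0; have cV0 : 0 <= c^-1 by rewrite invr_ge0 ltW.
elim: n => [|n IH] in spec M al E *; move=> HM mE.
  by rewrite expr0 mul1e; congr (tuple_measure _ _ _); rewrite (_ : _ @^-1` E = E)//;
    apply/seteqP; split => t; rewrite /= (_ : affine_tuple c M al t = t)//; apply: eq_from_tnth => -[].
have mT := measurable_affine_tuple c M al.
have mTE : measurable (affine_tuple c M al @^-1` E).
  by rewrite -[X in measurable X]setTI; exact: mT.
pose M' (i k : 'I_n) : R := M (lift ord0 i) (lift ord0 k).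
pose spec' (i : 'I_n) := spec (lift ord0 i).
have HM' i k : M' i k != 0 -> spec' i && ~~ spec' k by exact: HM.
have cons_affine (x : TR) (t : n.-tuple TR) : affine_tuple c M al [tuple of x :: t] =
    [tuple of (c * x + M ord0 ord0 * x + \sum_k M ord0 (lift ord0 k) * tnth t k + al ord0) ::
      affine_tuple c M' (fun i : 'I_n => M (lift ord0 i) ord0 * x + al (lift ord0 i)) t].
  apply: eq_from_tnth => i; rewrite tnth_mktuple big_ord_recl tnth0.
  under eq_bigr do rewrite tnthS.
  case: (unliftP ord0 i) => [j|] ->; last by rewrite !tnth0; ring.
  by rewrite !tnthS tnth_mktuple /M'; ring.
have M00 : M ord0 ord0 = 0.
  by apply/eqP; apply: contraT => /HM/andP[-> ].
case s0 : (spec ord0).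
- have M0 i : M (lift ord0 i) ord0 = 0.
    by apply/eqP; apply: contraT => /HM; rewrite s0 andbF.
  rewrite lebn_section2// lebn_section2//.
  pose T' : n.-tuple TR -> n.-tuple TR := affine_tuple c M' (fun i : 'I_n => al (lift ord0 i)).
  have T'E x t : affine_tuple c M' (fun i : 'I_n => M (lift ord0 i) ord0 * x + al (lift ord0 i)) t = T' t.
    by apply: eq_from_tnth => i; rewrite !tnth_mktuple M0 mul0r add0r.
  pose phi (t : n.-tuple TR) := leb [set x : TR | E [tuple of x :: t]].
  transitivity (\int[lebn n]_t (c^-1%:E * phi (T' t)))%E.
    apply: eq_integral => t _.
    rewrite /phi -(@lebesgue_affine c (\sum_k M ord0 (lift ord0 k) * tnth t k + al ord0))//; last exact: measurable_section2.
    congr (lebesgue_measure _); apply/seteqP; split => x /=;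
      by rewrite cons_affine T'E M00 mul0r addr0 addrA.
  have mphi : measurable_fun setT phi by exact: measurable_lebn_section2.
  have mT' : measurable_fun setT T' by exact: measurable_affine_tuple.
  rewrite ge0_integralZl//; last by exact: measurableT_comp mphi mT'.
  rewrite (@ge0_integral_scaled_pushforward _ _ _ T' (c^-1 ^+ n))//.
  - by rewrite muleA -EFinM -exprS.
  - by rewrite exprn_ge0.
  - by move=> A mA; exact: (IH spec' M' _ A HM' mA).
- rewrite lebn_section1// lebn_section1//.
  have M0 k : M ord0 (lift ord0 k) = 0.
    by apply/eqP; apply: contraT => /HM; rewrite s0.
  pose phi x := lebn n [set t : n.-tuple TR | E [tuple of x :: t]].
  transitivity (\int[leb]_x ((c^-1 ^+ n)%:E * phi (c * x + al ord0)%R))%E.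
    apply: eq_integral => x _.
    rewrite /phi -(IH spec' M' (fun i : 'I_n => M (lift ord0 i) ord0 * x + al (lift ord0 i)))//; last exact: measurable_section1.
    congr (tuple_measure _ _ _); apply/seteqP; split => t /=;
      by rewrite cons_affine M00 mul0r addr0 big1 ?addr0// => k _; rewrite M0 mul0r.
  have mphi : measurable_fun setT phi by exact: measurable_lebn_section1.
  have ma := measurable_affine1 c (al ord0).
  rewrite ge0_integralZl//; [|exact: measurableT_comp mphi ma|by rewrite lee_fin exprn_ge0].
  rewrite (@ge0_integral_scaled_pushforward _ _ _ (fun x : TR => c * x + al ord0 : TR) c^-1 phi)//.
  - by rewrite muleA -EFinM -exprSr.
  - by move=> A mA; exact: lebesgue_affine.
Qed.

Lemma lebn_box n (p r : 'I_n -> R) : (forall i, 0 <= r i) ->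
  measurable [set t : n.-tuple TR | forall i, p i - r i <= tnth t i <= p i + r i] /\
  lebn n [set t | forall i, p i - r i <= tnth t i <= p i + r i] = (\prod_i (2 * r i))%:E.
Proof.
move=> r0; split.
  rewrite (_ : mkset _ = \bigcap_(i in [set: 'I_n])
    ((@tnth _ TR ^~ i) @^-1` `[p i - r i, p i + r i])).
    apply: fin_bigcap_measurable => // i _.
    by rewrite -[X in measurable X]setTI; exact: measurable_tnth.
  apply/seteqP; split => [t At i _|t At i]; first by rewrite /= in_itv; exact: At.
  by have := At i I; rewrite /= in_itv.
elim: n => [|n IH] in p r r0 *.
  by rewrite big_ord0 /= diracE mem_set// => -[].
rewrite /= /cons_measure /pushforward (_ : _ @^-1` _ =
    `[p ord0 - r ord0, p ord0 + r ord0]%classic `*`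
    [set t : n.-tuple TR | forall i, p (lift ord0 i) - r (lift ord0 i) <= tnth t i <= p (lift ord0 i) + r (lift ord0 i)]); last first.
  apply/seteqP; split => [[x t] /= xt|[x t] /= [Ax At] i].
    by split=> [|i]; [have := xt ord0; rewrite in_itv|have := xt (lift ord0 i); rewrite tnthS].
  by case: (unliftP ord0 i) => [j|] ->; rewrite ?tnthS//; move: Ax; rewrite in_itv.
rewrite product_measure1E//; last first.
  rewrite (_ : mkset _ = \bigcap_(i in [set: 'I_n])
    ((@tnth _ TR ^~ i) @^-1` `[p (lift ord0 i) - r (lift ord0 i), p (lift ord0 i) + r (lift ord0 i)])).
    apply: fin_bigcap_measurable => // i _.
    by rewrite -[X in measurable X]setTI; exact: measurable_tnth.
  apply/seteqP; split => [t At i _|t At i]; first by rewrite /= in_itv; exact: At.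
  by have := At i I; rewrite /= in_itv.
rewrite (IH (fun i => p (lift ord0 i)) (fun i => r (lift ord0 i)))// big_ord_recl EFinM.
congr (_ * _)%E.
rewrite [LHS](lebesgue_measure_itv `[p ord0 - r ord0, p ord0 + r ord0])/= lte_fin.
have := r0 ord0; rewrite le_eqVlt => /orP[/eqP <-|rp].
  by rewrite subr0 addr0 ltxx mulr0.
by rewrite ifT; [rewrite -EFinB; congr (_%:E); ring|lra].
Qed.

End affine_tuple.

(** * Volume in C^d and rotations of the sphere *)

Section volume_Cn.
Context (R : realType) (d : nat).
Local Notation TR := (measurableTypeR R).
Local Notation vol := (@lebesgue_Cn R d).

Definition real_affine (c : R) (A B C D : 'I_d -> 'I_d -> R) (z : 'rV[R[i]]_d) : 'rV[R[i]]_d :=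
  \row_j ((c * complex.Re (z 0 j) + \sum_k (A j k * complex.Re (z 0 k) + B j k * complex.Im (z 0 k)))
    +i* (c * complex.Im (z 0 j) + \sum_k (C j k * complex.Re (z 0 k) + D j k * complex.Im (z 0 k)))).

Definition block (A B C D : 'I_d -> 'I_d -> R) (i k : 'I_(d + d)) : R :=
  match fintype.split i, fintype.split k with
  | inl a, inl b => A a b | inl a, inr b => B a b
  | inr a, inl b => C a b | inr a, inr b => D a b
  end.

Lemma split_lshift (a : 'I_d) : fintype.split (lshift d a) = inl a.
Proof. exact: (unsplitK (inl a)). Qed.

Lemma split_rshift (a : 'I_d) : fintype.split (rshift d a) = inr a.
Proof. exact: (unsplitK (inr a)). Qed.

Lemma Cn_of_affine_tuple c A B C D (t : (d + d).-tuple TR) :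
  Cn_of_R2n (affine_tuple c (block A B C D) (fun=> 0) t) = real_affine c A B C D (Cn_of_R2n t).
Proof.
apply/rowP => j; rewrite !mxE !tnth_mktuple !addr0.
rewrite !big_split_ord /= /block split_lshift split_rshift.
congr (_ +i* _).
  congr (_ + _); rewrite big_split /=; congr (_ + _); apply: eq_bigr => k _;
    by rewrite ?split_lshift ?split_rshift mxE.
congr (_ + _); rewrite big_split /=; congr (_ + _); apply: eq_bigr => k _;
  by rewrite ?split_lshift ?split_rshift mxE.
Qed.

(** [sp1] and [sp2] select the special real and imaginary parts of [lebn_affine]. *)
Lemma volume_affine (c : R) A B C D (sp1 sp2 : pred 'I_d) (E : set (Cn R d)) : 0 < c ->
  (forall j k, A j k != 0 -> sp1 j && ~~ sp1 k) -> (forall j k, B j k != 0 -> sp1 j && ~~ sp2 k) ->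
  (forall j k, C j k != 0 -> sp2 j && ~~ sp1 k) -> (forall j k, D j k != 0 -> sp2 j && ~~ sp2 k) ->
  measurable E ->
  vol (real_affine c A B C D @^-1` E) = ((c^-1 ^+ (d + d))%:E * vol E)%E.
Proof.
move=> c0 hA hB hC hD mE; rewrite /lebesgue_Cn /pushforward.
pose sp (i : 'I_(d + d)) := match fintype.split i with inl a => sp1 a | inr a => sp2 a end.
rewrite -(@lebn_affine R (d + d) sp c (block A B C D) (fun=> 0))//.
- congr (tuple_measure _ _ _); apply/seteqP; split => t /=; rewrite Cn_of_affine_tuple//.
- by move=> i k; rewrite /block /sp; case: (fintype.split i) => a; case: (fintype.split k) => b'; auto.
- rewrite -[X in measurable X]setTI; exact: measurable_Cn_of_R2n.
Qed.

Lemma volume_scale (s : R) (E : set (Cn R d)) : 0 < s -> measurable E ->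
  vol [set z | E (s%:C *: z)] = ((s^-1 ^+ (d + d))%:E * vol E)%E.
Proof.
move=> s0 mE.
rewrite -(@volume_affine s (fun _ _ => 0) (fun _ _ => 0) (fun _ _ => 0) (fun _ _ => 0) xpred0 xpred0)//;
  try by move=> j k; rewrite eqxx.
congr (lebesgue_Cn _); apply/seteqP; split => z /=;
  rewrite (_ : real_affine _ _ _ _ _ z = s%:C *: z)//;
  apply/rowP => j; rewrite !mxE !big1 ?addr0; try (by move=> k _; rewrite !mul0r addr0);
  by case: (z 0 j) => a b; apply/eqP; rewrite eq_complex /= !mul0r subr0 addr0 !eqxx.
Qed.

Definition shear_re (a : R) := real_affine 1 (fun _ _ => 0) (fun j k => a *+ (j == k)) (fun _ _ => 0) (fun _ _ => 0).
Definition shear_im (a : R) := real_affine 1 (fun _ _ => 0) (fun _ _ => 0) (fun j k => a *+ (j == k)) (fun _ _ => 0).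

Lemma shear_reE a z j : shear_re a z 0 j = (complex.Re (z 0 j) + a * complex.Im (z 0 j)) +i* complex.Im (z 0 j).
Proof.
rewrite mxE !mul1r; congr (_ +i* _).
  congr (_ + _); rewrite (bigD1 j)//= eqxx mul0r add0r mulr1n big1 ?addr0//.
  by move=> k kj; rewrite mul0r add0r eq_sym (negbTE kj) mulr0n mul0r.
by rewrite big1 ?addr0// => k _; rewrite !mul0r addr0.
Qed.

Lemma shear_imE a z j : shear_im a z 0 j = complex.Re (z 0 j) +i* (complex.Im (z 0 j) + a * complex.Re (z 0 j)).
Proof.
rewrite mxE !mul1r; congr (_ +i* _).
  by rewrite big1 ?addr0// => k _; rewrite !mul0r addr0.
congr (_ + _); rewrite (bigD1 j)//= eqxx mul0r addr0 mulr1n big1 ?addr0//.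
by move=> k kj; rewrite mul0r addr0 eq_sym (negbTE kj) mulr0n mul0r.
Qed.

Lemma volume_shear_re a (E : set (Cn R d)) : measurable E -> vol (shear_re a @^-1` E) = vol E.
Proof.
move=> mE; rewrite /shear_re (@volume_affine 1 _ _ _ _ xpredT xpred0)//; try by move=> j k; rewrite eqxx.
by rewrite invr1 expr1n mul1e.
Qed.

Lemma volume_shear_im a (E : set (Cn R d)) : measurable E -> vol (shear_im a @^-1` E) = vol E.
Proof.
move=> mE; rewrite /shear_im (@volume_affine 1 _ _ _ _ xpred0 xpredT)//; try by move=> j k; rewrite eqxx.
by rewrite invr1 expr1n mul1e.
Qed.

Lemma measurable_real_affine c A B C D :
  measurable_fun [set: Cn R d] (real_affine c A B C D : Cn R d -> Cn R d).
Proof.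
have mRe k := @measurable_Re_coord R d k; have mIm k := @measurable_Im_coord R d k.
apply: measurable_fun_Cn => j; under eq_fun do rewrite mxE /=.
  apply: measurable_funD; first exact: measurable_funM.
  by apply: measurable_sum => k; apply: measurable_funD; exact: measurable_funM.
apply: measurable_funD; first exact: measurable_funM.
by apply: measurable_sum => k; apply: measurable_funD; exact: measurable_funM.
Qed.

(** The point (1 + i t) / (1 - i t). Rational parameters suffice for the rotations and make
    every identity between them a field identity. *)
Definition circle_pt (t : R) : R[i] :=
  ((1 - t ^+ 2) / (1 + t ^+ 2)) +i* (2 * t / (1 + t ^+ 2)).

Lemma circle_den (t : R) : 1 + t ^+ 2 != 0.
Proof. by rewrite gt_eqF// ltr_wpDr// sqr_ge0. Qed.

Lemma normc_circle_pt t : normc (circle_pt t) = 1.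
Proof.
apply/eqP; rewrite -(@eqrXn2 _ 2)// ?normc_ge0// sqr_normcE expr1n /=; apply/eqP.
by field; rewrite circle_den.
Qed.

(** Reduces the invariance of volume under rotations to that under shears. *)
Lemma rotation_shears t z :
  circle_pt t *: z = shear_re (- t) (shear_im (2 * t / (1 + t ^+ 2)) (shear_re (- t) z)).
Proof.
apply/rowP => j; rewrite shear_reE shear_imE shear_reE mxE; case: (z 0 j) => a b.
by apply/eqP; rewrite eq_complex /=; apply/andP; split; apply/eqP; field; rewrite circle_den.
Qed.

Lemma volume_rotation t (E : set (Cn R d)) : measurable E ->
  vol [set z | E (circle_pt t *: z)] = vol E.
Proof.
move=> mE; rewrite (_ : mkset _ = shear_re (- t) @^-1` (shear_im (2 * t / (1 + t ^+ 2)) @^-1` (shear_re (- t) @^-1` E))); last first.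
  by apply/seteqP; split => z /=; rewrite rotation_shears.
have pre (f : 'rV[R[i]]_d -> 'rV[R[i]]_d) (X : set (Cn R d)) :
    measurable_fun [set: Cn R d] (f : Cn R d -> Cn R d) -> measurable X ->
    measurable (f @^-1` X : set (Cn R d)).
  by move=> mf mX; rewrite -[X in measurable X]setTI; exact: mf.
have m1 : measurable (shear_re (- t) @^-1` E : set (Cn R d)) by apply: pre => //; exact: measurable_real_affine.
have m2 : measurable (shear_im (2 * t / (1 + t ^+ 2)) @^-1` (shear_re (- t) @^-1` E) : set (Cn R d)).
  by apply: pre => //; exact: measurable_real_affine.
by rewrite volume_shear_re// volume_shear_im// volume_shear_re.
Qed.

Lemma enormZ (c : R[i]) (z : 'rV[R[i]]_d) : enorm (c *: z) = normc c * enorm z.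
Proof.
rewrite /enorm -[normc c]ger0_norm ?normc_ge0// -sqrtr_sqr -sqrtrM ?sqr_ge0//.
congr Num.sqrt; rewrite mulr_sumr; apply: eq_bigr => j _.
by rewrite mxE normcM exprMn.
Qed.

Lemma enorm_ge0 (z : 'rV[R[i]]_d) : 0 <= enorm z.
Proof. exact: sqrtr_ge0. Qed.

Lemma sqr_enorm (z : 'rV[R[i]]_d) : enorm z ^+ 2 = \sum_j normc (z 0 j) ^+ 2.
Proof. by rewrite sqr_sqrtr// sumr_ge0// => j _; exact: sqr_ge0. Qed.

Lemma radial_projZ (c : R[i]) (z : 'rV[R[i]]_d) : normc c = 1 ->
  radial_proj (c *: z) = c *: radial_proj z.
Proof. by move=> c1; rewrite /radial_proj enormZ c1 mul1r !scalerA mulrC. Qed.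

Lemma radial_proj_scale (s : R) (z : 'rV[R[i]]_d) : 0 < s -> radial_proj (s%:C *: z) = radial_proj z.
Proof.
move=> s0; rewrite /radial_proj enormZ normc_real gtr0_norm// scalerA -rmorphM.
by rewrite invfM mulrAC mulVf ?gt_eqF// mul1r.
Qed.

Lemma sphere_measure_rotation t (A : set (Cn R d)) : measurable A ->
  sphere_measure R d [set z | A (circle_pt t *: z)] = sphere_measure R d A.
Proof.
move=> mA; rewrite !sphere_measureE; congr (_ * _)%E.
have mA' : measurable ([set z | A (radial_proj z)] `&` Bd : set (Cn R d)).
  apply: measurableI; last exact: measurable_Bd.
  by rewrite -[X in measurable X]setTI; exact: measurable_radial_proj.
rewrite -[RHS](volume_rotation t mA'); congr (lebesgue_Cn _).
apply/seteqP; split => z /=; rewrite /Bd /= radial_projZ ?normc_circle_pt// enormZ normc_circle_pt mul1r//.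
Qed.

End volume_Cn.

(** * Complex-valued measurable functions *)

Section complex_measurable.
Context (R : realType) (dx : measure_display) (X : measurableType dx).
Implicit Types f g : X -> R[i].

Definition cmeasurable f := measurable_fun setT (fun x => complex.Re (f x)) /\
  measurable_fun setT (fun x => complex.Im (f x)).

Lemma cmeasurable_cst c : cmeasurable (fun=> c).
Proof. by split; exact: measurable_cst. Qed.

Lemma cmeasurableD f g : cmeasurable f -> cmeasurable g -> cmeasurable (fun x => f x + g x).
Proof.
move=> [f1 f2] [g1 g2]; split.
  rewrite (_ : (fun x => _) = (fun x => complex.Re (f x) + complex.Re (g x))).
    exact: measurable_funD.
  by apply/funext => x; case: (f x) (g x) => [? ?] [].
rewrite (_ : (fun x => _) = (fun x => complex.Im (f x) + complex.Im (g x))).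
  exact: measurable_funD.
by apply/funext => x; case: (f x) (g x) => [? ?] [].
Qed.

Lemma cmeasurableM f g : cmeasurable f -> cmeasurable g -> cmeasurable (fun x => f x * g x).
Proof.
move=> [f1 f2] [g1 g2]; split.
  rewrite (_ : (fun x => _) = (fun x => complex.Re (f x) * complex.Re (g x) - complex.Im (f x) * complex.Im (g x))).
    by apply: measurable_funB; exact: measurable_funM.
  by apply/funext => x; case: (f x) (g x) => [? ?] [].
rewrite (_ : (fun x => _) = (fun x => complex.Re (f x) * complex.Im (g x) + complex.Im (f x) * complex.Re (g x))).
  by apply: measurable_funD; exact: measurable_funM.
by apply/funext => x; case: (f x) (g x) => [? ?] [].
Qed.

Lemma cmeasurableN f : cmeasurable f -> cmeasurable (fun x => - f x).
Proof.
move=> mf; rewrite (_ : (fun x => _) = (fun x => (- 1) * f x)).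
  by apply: cmeasurableM => //; exact: cmeasurable_cst.
by apply/funext => x; rewrite mulN1r.
Qed.

Lemma cmeasurableB f g : cmeasurable f -> cmeasurable g -> cmeasurable (fun x => f x - g x).
Proof. by move=> mf mg; apply: cmeasurableD => //; exact: cmeasurableN. Qed.

Lemma cmeasurable_conj f : cmeasurable f -> cmeasurable (fun x => (f x)^*%C).
Proof.
move=> [f1 f2]; split.
  by rewrite (_ : (fun x => _) = (fun x => complex.Re (f x)))//; apply/funext => x; case: (f x).
rewrite (_ : (fun x => _) = (fun x => - complex.Im (f x))).
  exact: measurable_funN.
by apply/funext => x; case: (f x).
Qed.

Lemma cmeasurable_sum n (f : 'I_n -> X -> R[i]) : (forall j, cmeasurable (f j)) ->
  cmeasurable (fun x => \sum_j f j x).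
Proof.
move=> mf.
suff H (s : seq 'I_n) : cmeasurable (fun x => \sum_(j <- s) f j x) by exact: H.
elim: s => [|j s IH].
  by under eq_fun do rewrite big_nil; exact: cmeasurable_cst.
by under eq_fun do rewrite big_cons; exact: cmeasurableD.
Qed.

Lemma measurable_sqr_normc f : cmeasurable f -> measurable_fun setT (fun x => normc (f x) ^+ 2).
Proof.
move=> [f1 f2]; under eq_fun do rewrite sqr_normcE.
by apply: measurable_funD; exact: measurable_funX.
Qed.

Lemma measurable_normc f : cmeasurable f -> measurable_fun setT (fun x => normc (f x)).
Proof.
move=> mf; rewrite (_ : (fun x => _) = Num.sqrt \o (fun x => normc (f x) ^+ 2)).
  apply: measurableT_comp; last exact: measurable_sqr_normc.
  by apply: continuous_measurable_fun; exact: sqrt_continuous.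
by apply/funext => x /=; rewrite sqrtr_sqr ger0_norm// normc_ge0.
Qed.

Lemma measurable_sub_le (f g : X -> R) : measurable_fun setT f -> measurable_fun setT g ->
  measurable [set x | f x <= g x].
Proof.
move=> mf mg; rewrite (_ : mkset _ = setT `&` (fun x => f x - g x) @^-1` `]-oo, 0]%classic).
  by apply: measurable_funB.
by apply/seteqP; split => x /=; rewrite in_itv/= subr_le0; [split|case].
Qed.

Lemma measurable_sub_lt (f g : X -> R) : measurable_fun setT f -> measurable_fun setT g ->
  measurable [set x | f x < g x].
Proof.
move=> mf mg; rewrite (_ : mkset _ = setT `&` (fun x => f x - g x) @^-1` `]-oo, 0[%classic).
  by apply: measurable_funB.
by apply/seteqP; split => x /=; rewrite in_itv/= subr_lt0; [split|case].
Qed.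

Lemma cmeasurable_coord d (phi : X -> Cn R d) (j : 'I_d) : measurable_fun setT phi ->
  cmeasurable (fun x => (phi x : 'rV[R[i]]_d) 0 j).
Proof.
move=> mphi; split.
  exact: (measurableT_comp (@measurable_Re_coord R d j) mphi).
exact: (measurableT_comp (@measurable_Im_coord R d j) mphi).
Qed.

Lemma cmeasurable_hdot d (phi psi : X -> Cn R d) : measurable_fun setT phi ->
  measurable_fun setT psi -> cmeasurable (fun x => hdot (phi x : 'rV[R[i]]_d) (psi x)).
Proof.
move=> mphi mpsi; apply: cmeasurable_sum => j; apply: cmeasurableM.
  exact: cmeasurable_coord.
exact/cmeasurable_conj/cmeasurable_coord.
Qed.

End complex_measurable.

(** * The measure of a cap *)
Section caps.
Context (R : realType) (d : nat).
Hypothesis d0 : (0 < d)%N.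
Local Notation TR := (measurableTypeR R).
Local Notation vol := (@lebesgue_Cn R d).

Lemma volume_box (P : 'I_d -> R[i]) (r : 'I_d -> R) : (forall k, 0 <= r k) ->
  let box := [set z : 'rV[R[i]]_d | forall k, `|complex.Re (z 0 k) - complex.Re (P k)| <= r k /\
     `|complex.Im (z 0 k) - complex.Im (P k)| <= r k] in
  measurable (box : set (Cn R d)) /\ vol box = ((\prod_k (2 * r k)) ^+ 2)%:E.
Proof.
move=> r0 box; split.
  rewrite (_ : box = \bigcap_(k in [set: 'I_d])
      ([set z : Cn R d | `|complex.Re ((z : 'rV[R[i]]_d) 0 k) - complex.Re (P k)| <= r k] `&`
       [set z : Cn R d | `|complex.Im ((z : 'rV[R[i]]_d) 0 k) - complex.Im (P k)| <= r k])).
    apply: fin_bigcap_measurable => // k _; apply: measurableI.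
      apply: measurable_sub_le => //; apply: measurableT_comp => //.
      by apply: measurable_funB => //; exact: measurable_Re_coord.
    apply: measurable_sub_le => //; apply: measurableT_comp => //.
    by apply: measurable_funB => //; exact: measurable_Im_coord.
  by apply/seteqP; split => [z zb k _|z zb k]; [exact: zb|exact: (zb k I)].
pose p (i : 'I_(d + d)) := match fintype.split i with inl a => complex.Re (P a) | inr a => complex.Im (P a) end.
pose q (i : 'I_(d + d)) := match fintype.split i with inl a => r a | inr a => r a end.
have q0 i : 0 <= q i by rewrite /q; case: (fintype.split i).
have [_ lb] := lebn_box p q0.
have -> : (\prod_k (2 * r k)) ^+ 2 = \prod_i (2 * q i).
  rewrite big_split_ord /= expr2; congr (_ * _); apply: eq_bigr => k _;
  by rewrite /q ?split_lshift ?split_rshift.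
rewrite -lb /lebesgue_Cn /pushforward; congr (tuple_measure _ _ _).
apply/seteqP; split => t /=.
  move=> tb i; rewrite -ler_distl /p /q.
  rewrite -(splitK i); case: (fintype.split i) => a; rewrite /= ?split_lshift ?split_rshift.
    by have [] := tb a; rewrite mxE.
  by have [] := tb a; rewrite mxE.
move=> tb k; rewrite mxE /=; have := tb (lshift d k); have := tb (rshift d k).
by rewrite -!ler_distl /p /q split_lshift split_rshift.
Qed.

Lemma hdotZr (s : R) (z w : 'rV[R[i]]_d) : hdot z (s%:C *: w) = s%:C * hdot z w.
Proof.
rewrite /hdot mulr_sumr; apply: eq_bigr => j _; rewrite mxE.
have -> : (s%:C * w 0 j)^*%C = s%:C * (w 0 j)^*%C by rewrite -{2}(conjc_real s) -rmorphM.
by rewrite mulrCA.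
Qed.

Lemma clBd_coord (w : 'rV[R[i]]_d) k : clBd w -> normc (w 0 k) <= 1.
Proof.
move=> w1; have : normc (w 0 k) ^+ 2 <= 1.
  have : enorm w ^+ 2 <= 1 by rewrite expr_le1// enorm_ge0.
  rewrite sqr_enorm (bigD1 k)//=; apply: le_trans; rewrite lerDl.
  by apply: sumr_ge0 => j _; exact: sqr_ge0.
by rewrite expr_le1// normc_ge0.
Qed.

Lemma sqr_dist_hdot (z w : 'rV[R[i]]_d) :
  \sum_k normc (w 0 k - z 0 k) ^+ 2 = enorm w ^+ 2 + enorm z ^+ 2 - 2 * complex.Re (hdot z w).
Proof.
have RS : complex.Re (hdot z w) = \sum_k complex.Re (z 0 k * (w 0 k)^*%C).
  rewrite /hdot; elim/big_rec2: _ => // k a b _ <-.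
  by case: (z 0 k * _) b => [? ?] [].
rewrite RS !sqr_enorm mulr_sumr -big_split -sumrB /=; apply: eq_bigr => k _.
by rewrite !sqr_normcE; case: (z 0 k) => a b; case: (w 0 k) => a' b' /=; ring.
Qed.

Lemma dist_hdot (z w : 'rV[R[i]]_d) : clBd z -> clBd w ->
  \sum_k normc (w 0 k - z 0 k) ^+ 2 <= 2 - 2 * complex.Re (hdot z w).
Proof.
move=> z1 w1.
rewrite sqr_dist_hdot.
by rewrite lerD2r (_ : 2 = 1 + 1 :> R)// lerD// expr_le1// enorm_ge0.
Qed.

Lemma Re_ge_of_dist (c : R[i]) (t : R) : normc (1 - c) < t -> 1 - t < complex.Re c.
Proof.
move=> h; have := le_lt_trans (normc_Re _) h; case: c {h} => a b /=.
by rewrite ltr_norml => /andP[_]; lra.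
Qed.

(** These w are at distance O(sqrt t) from z, and at distance O(t) in the complex direction
    of z. Some coordinate z_j of z has modulus at least 1 / (2 d); the shear T that replaces
    w_j by the conjugate of <z, w> / z_j preserves volume and sends these w into a box of
    the expected size. *)
Lemma cap_volume (z : 'rV[R[i]]_d) (t : R) : clBd z -> 0 < t -> t < 2^-1 ->
  exists E : set (Cn R d), [/\ measurable E,
    forall w : 'rV[R[i]]_d, clBd w -> normc (1 - hdot z w) < t -> E w &
    (vol E <= ((4 * d%:R * t) ^+ 2 * (8 * t) ^+ d.-1)%:E)%E].
Proof.
move=> z1 t0 t2.
have [[w0 [w01 w0t]]|none] := pselect (exists w0 : 'rV[R[i]]_d, clBd w0 /\ normc (1 - hdot z w0) < t); last first.
  exists set0; split=> //; last by rewrite measure0 lee_fin mulr_ge0// ?sqr_ge0// exprn_ge0// mulr_ge0// ltW.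
  by move=> w w1 wt; apply: none; exists w.
have dR : 0 < d%:R :> R by rewrite ltr0n.
have [j zj] : exists j, (2 * d%:R)^-1 < normc (z 0 j).
  apply/not_existsP => H.
  have h1 := Re_ge_of_dist w0t.
  have : complex.Re (hdot z w0) <= \sum_(k < d) (2 * d%:R)^-1.
    apply: le_trans (ler_norm _) _; apply: le_trans (normc_Re _) _; rewrite /hdot.
    elim/big_rec2: _ => [|k a b _ le]; first by rewrite normc0.
    rewrite (le_trans (le_normcD _ _))// lerD// normcM.
    have wk := clBd_coord k w01; have /negP := H k; rewrite -leNgt => zk.
    by rewrite normc_conj -[leRHS]mulr1 ler_pM ?normc_ge0.
  have -> : \sum_(k < d) (2 * d%:R)^-1 = 2^-1 :> R.
    by rewrite sumr_const card_ord -[LHS]mulr_natr; field; rewrite gt_eqF.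
  by move: h1 t2; clear; lra.
have zj0 : z 0 j != 0 by rewrite -normc_gt0; apply: lt_trans zj; rewrite invr_gt0 mulr_gt0.
pose q k : R[i] := if k == j then 0 else (z 0 k)^*%C / (z 0 j)^*%C.
have cj0 : (z 0 j)^*%C != 0 by rewrite conjc_eq0.
pose T := real_affine 1 (fun j' k => complex.Re (q k) *+ (j' == j)) (fun j' k => - complex.Im (q k) *+ (j' == j))
   (fun j' k => complex.Im (q k) *+ (j' == j)) (fun j' k => complex.Re (q k) *+ (j' == j)).
have Tk (w : 'rV[R[i]]_d) k : k != j -> T w 0 k = w 0 k.
  move=> kj; rewrite mxE !mul1r !big1 ?addr0; first by case: (w 0 k).
    by move=> l _; rewrite (negbTE kj) !mulr0n !mul0r addr0.
  by move=> l _; rewrite (negbTE kj) !mulr0n !mul0r addr0.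
have Tj (w : 'rV[R[i]]_d) : T w 0 j = (hdot z w)^*%C / (z 0 j)^*%C.
  have -> : (hdot z w)^*%C / (z 0 j)^*%C = w 0 j + \sum_k q k * w 0 k.
    have cM (x y : R[i]) : (x * y)^*%C = x^*%C * y^*%C by exact: (rmorphM (@conjc R)).
    have -> : (hdot z w)^*%C = \sum_k (z 0 k)^*%C * w 0 k.
      rewrite /hdot; transitivity (\sum_k (z 0 k * (w 0 k)^*%C)^*%C); first exact: (rmorph_sum (@conjc R)).
      by apply: eq_bigr => k _; rewrite cM conjcK.
    rewrite mulr_suml (bigD1 j)//= mulrAC divff// mul1r.
    congr (_ + _); rewrite [RHS](bigD1 j)//= {1}/q eqxx mul0r add0r.
    apply: eq_bigr => k kj; rewrite /q (negbTE kj).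
    by rewrite mulrAC.
  have RS (F : 'I_d -> R[i]) : \sum_k F k = (\sum_k complex.Re (F k)) +i* (\sum_k complex.Im (F k)).
    by elim/big_rec3: _ => // k a b c _ ->; case: (F k) => p r; rewrite [LHS]/GRing.add.
  rewrite RS mxE !mul1r; case: (w 0 j) => a b; rewrite [RHS]/GRing.add/=.
  congr ((_ + _) +i* (_ + _)); apply: eq_bigr => k _; rewrite eqxx !mulr1n;
    by case: (q k) => x y; case: (w 0 k) => x' y' /=; ring.
pose P k : R[i] := if k == j then (z 0 j)^*%C^-1 else z 0 k.
pose s := Num.sqrt (2 * t).
have s0 : 0 <= s by exact: sqrtr_ge0.
pose r k : R := if k == j then 2 * d%:R * t else s.
have r0 k : 0 <= r k by rewrite /r; case: ifP => // _; rewrite !mulr_ge0// ltW.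
have [mbox volbox] := volume_box P r0; set box := mkset _ in mbox volbox.
have mT : measurable_fun [set: Cn R d] (T : Cn R d -> Cn R d) by exact: measurable_real_affine.
exists (T @^-1` box); split.
- by rewrite -[X in measurable X]setTI; exact: mT.
- move=> w w1 wt k; rewrite /=.
  suff : normc (T w 0 k - P k) <= r k.
    move=> h; split; apply: le_trans h.
      by apply: le_trans (normc_Re _); case: (T w 0 k) (P k) => [? ?] [].
    by apply: le_trans (normc_Im _); case: (T w 0 k) (P k) => [? ?] [].
  have [->|kj] := eqVneq k j.
    rewrite Tj /P /r eqxx -{2}[(z 0 j)^*%C^-1]mul1r -mulrBl normcM normcV.
    rewrite normc_conj -(conjc1 R) -rmorphB normc_conj ler_pdivrMr ?normc_gt0//.
    rewrite distcC; apply: (le_trans (ltW wt)).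
    rewrite mulrAC -[leLHS]mul1r ler_pM2r//.
    by move: zj => /ltW; rewrite -[X in X <= _]mul1r ler_pdivrMr ?mulr_gt0// mulrC.
  rewrite Tk// /P /r (negbTE kj) -(ler_pXn2r (n := 2)) ?nnegrE ?normc_ge0//.
  rewrite sqr_sqrtr ?mulr_ge0 ?ltW//.
  have := dist_hdot z1 w1; rewrite (bigD1 k)//=.
  have := Re_ge_of_dist wt; have : 0 <= \sum_(i | i != k) normc (w 0 i - z 0 i) ^+ 2.
    by apply: sumr_ge0 => l _; exact: sqr_ge0.
  clear; lra.
have HT (x : R) (j' k : 'I_d) : (k = j -> x = 0) -> x *+ (j' == j) != 0 ->
    pred1 j j' && ~~ pred1 j k.
  move=> x0; rewrite /=; case: (j' == j); last by rewrite mulr0n eqxx.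
  by rewrite mulr1n /=; apply: contra => /eqP/x0 ->.
rewrite (@volume_affine _ _ 1 _ _ _ _ (pred1 j) (pred1 j))//; last 4 first.
- by move=> j' k; apply: HT => ->; rewrite /q eqxx.
- by move=> j' k; apply: HT => ->; rewrite /q eqxx /= oppr0.
- by move=> j' k; apply: HT => ->; rewrite /q eqxx.
- by move=> j' k; apply: HT => ->; rewrite /q eqxx.
rewrite invr1 expr1n mul1e volbox lee_fin (bigD1 j)//= /r eqxx.
rewrite (eq_bigr (fun=> 2 * s)); last by move=> k /negbTE ->.
rewrite prodr_const exprMn.
rewrite (_ : 2 * (2 * d%:R * t) = 4 * d%:R * t); last by ring.
rewrite ler_wpM2l ?sqr_ge0//.
rewrite (_ : #|_| = d.-1); last by rewrite cardC1 card_ord.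
have s2 : (2 * s) ^+ 2 = 8 * t.
  by rewrite exprMn sqr_sqrtr ?mulr_ge0 ?ltW//; ring.
by rewrite -exprM mulnC exprM s2.
Qed.

Definition cap (z : 'rV[R[i]]_d) (t : R) : set (Cn R d) :=
  [set w | Sd (w : 'rV[R[i]]_d) /\ normc (1 - hdot z w) < t].

Lemma measurable_Sd : measurable (Sd : set (Cn R d)).
Proof.
rewrite (_ : Sd = setT `&` (@enorm R d : Cn R d -> R) @^-1` [set 1]).
  exact: measurable_enorm.
by apply/seteqP; split => z /=; [split|case].
Qed.

Lemma measurable_cap z t : measurable (cap z t).
Proof.
apply: measurableI; first exact: measurable_Sd.
apply: measurable_sub_lt => //; apply: measurable_normc; apply: cmeasurableB.
  exact: cmeasurable_cst.
by apply: cmeasurable_hdot => //; exact: measurable_cst.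
Qed.

Lemma exp_le_id (s : R) n : 0 <= s <= 1 -> (0 < n)%N -> s ^+ n <= s.
Proof.
move=> /andP[s0 s1]; case: n => // n _; rewrite exprS ler_piMr//.
by rewrite exprn_ile1.
Qed.

(** Compare the cone C over the cap, within the ball, with its dilate C1 of ratio 1 - t. The
    points of C outside C1 have norm at least 1 - t and lie in a set W of [cap_volume] for
    3 t. Hence vol C <= (1 - t)^(2 d) vol C + vol W, where vol W = O(t^(d + 1)), and
    (1 - t)^(2 d) <= 1 - t. *)
Lemma cap_measure : exists2 K : R, 0 < K & forall z t, clBd z -> 0 < t ->
  (sphere_measure R d (cap z t) <= (K * t ^+ d)%:E)%E.
Proof.
have /andP[V0 Voo] := lebesgue_Bd_fin R d.
pose V := fine (vol (Bd : set (Cn R d))).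
have VE : vol (Bd : set (Cn R d)) = V%:E by rewrite /V fineK// ge0_fin_numE// ltW.
have V0' : 0 < V by move: V0; rewrite VE lte_fin.
pose K1 : R := (12 * d%:R) ^+ 2 * 24 ^+ d.-1.
have K10 : 0 <= K1 by rewrite mulr_ge0 ?sqr_ge0// exprn_ge0.
exists (K1 / V + 6 ^+ d).
  by rewrite ltr_wpDl ?exprn_gt0// divr_ge0// ltW.
move=> z t z1 t0.
(* a large cap: any probability is at most 6^d t^d *)
have [t6|t6] := leP 6^-1 t.
  apply: (@le_trans _ _ 1%:E); first exact: probability_le1 (measurable_cap z t).
  rewrite lee_fin mulrDl -exprMn (@le_trans _ _ ((6 * t) ^+ d))//.
    by rewrite exprn_ege1// -[leLHS](@mulfV _ 6)// ler_pM2l.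
  by rewrite lerDr mulr_ge0 ?exprn_ge0 ?divr_ge0// ltW.
pose C : set (Cn R d) := [set w | cap z t (radial_proj w)] `&` Bd.
have mC : measurable C.
  apply: measurableI; last exact: measurable_Bd.
  by rewrite -[X in measurable X]setTI; exact: (measurable_radial_proj (measurableT) (measurable_cap z t)).
have Cfin : vol C \is a fin_num.
  rewrite ge0_fin_numE//; apply: le_lt_trans Voo; apply: le_measure; last by move=> w [].
    by rewrite inE.
  by rewrite inE; exact: measurable_Bd.
pose c := fine (vol C); have cE : vol C = c%:E by rewrite /c fineK.
have c0 : 0 <= c by rewrite fine_ge0.
have t1 : 0 < 1 - t by move: t6; clear; lra.
have t1' : 0 <= 1 - t <= 1 by rewrite ltW//= gerBl ltW.
have t30 : 0 < 3 * t by rewrite mulr_gt0.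
have t3 : 3 * t < 2^-1 by move: t6; clear; lra.
have [W [mW capW volW]] := @cap_volume z (3 * t) z1 t30 t3.
pose C1 : set (Cn R d) := [set w | C ((1 - t)^-1%:C *: w)].
have volC1 : vol C1 = ((1 - t) ^+ (d + d) * c)%:E.
  by rewrite /C1 volume_scale ?invr_gt0// invrK cE.
have mC1 : measurable C1.
  have ms : measurable_fun [set: Cn R d] (fun w : Cn R d => (1 - t)^-1%:C *: (w : 'rV[R[i]]_d) : Cn R d).
    apply: measurable_fun_Cn => j.
      under eq_fun do rewrite mxE.
      by have [] := cmeasurableM (cmeasurable_cst _ ((1 - t)^-1%:C)) (cmeasurable_coord j (@measurable_id _ _ setT)).
    under eq_fun do rewrite mxE.
    by have [] := cmeasurableM (cmeasurable_cst _ ((1 - t)^-1%:C)) (cmeasurable_coord j (@measurable_id _ _ setT)).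
  by rewrite -[X in measurable X]setTI; exact: ms.
have sub : C `<=` C1 `|` W.
  move=> w [Cw Bw]; rewrite /= in Cw.
  have Bw1 : enorm w < 1 by exact: Bw.
  have [wt|wt] := ltP (enorm w) (1 - t).
    left; split; first by rewrite /= radial_proj_scale// invr_gt0.
    rewrite /Bd /= enormZ normc_real gtr0_norm ?invr_gt0//.
    by rewrite mulrC ltr_pdivrMr// mul1r.
  right; have w0 : 0 < enorm w by exact: lt_le_trans wt.
  apply: capW; first by rewrite /clBd /= ltW.
  have [_ ct] := Cw.
  have wE : (w : 'rV[R[i]]_d) = (enorm w)%:C *: radial_proj w.
    by rewrite /radial_proj scalerA -rmorphM divff ?gt_eqF// scale1r.
  rewrite {1}wE hdotZr; set h := hdot _ _ in ct *.
  have hn : normc h <= 2.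
    have -> : h = 1 - (1 - h) by ring.
    rewrite (le_trans (normcB_le _ _))// normc1; move: ct t6; clear; lra.
  have -> : 1 - (enorm w)%:C * h = (1 - h) + (1 - enorm w)%:C * h.
    by rewrite rmorphB rmorph1; ring.
  rewrite (le_lt_trans (le_normcD _ _))// normcM normc_real ger0_norm ?subr_ge0 ?ltW//.
  have : (1 - enorm w) * normc h <= t * 2.
    apply: ler_pM => //; first by rewrite subr_ge0 ltW.
      exact: normc_ge0.
    by rewrite lerBlDr addrC -lerBlDr.
  by move: ct; clear; lra.
have ineq : c <= (1 - t) ^+ (d + d) * c + K1 * t * t ^+ d.
  rewrite -lee_fin EFinD -cE -volC1.
  apply: (@le_trans _ _ (vol C1 + vol W)%E).
    apply: le_trans (measureU2 _ mC1 mW).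
    by rewrite le_measure ?inE//; exact: measurableU.
  rewrite leeD2l//; apply: (le_trans volW); rewrite lee_fin /K1.
  rewrite le_eqVlt; apply/orP; left; apply/eqP.
  have -> : 8 * (3 * t) = 24 * t by ring.
  have -> : t ^+ d = t ^+ d.-1 * t by rewrite -exprSr prednK.
  have -> : (24 * t) ^+ d.-1 = 24 ^+ d.-1 * t ^+ d.-1 by rewrite exprMn.
  ring.
have cK : c <= K1 * t ^+ d.
  have : (1 - t) ^+ (d + d) <= 1 - t by apply: exp_le_id => //; rewrite addn_gt0 d0.
  move=> /(ler_wpM2r c0) h.
  have : c * t <= (K1 * t ^+ d) * t by move: h ineq; clear; lra.
  by rewrite ler_pM2r.
rewrite sphere_measureE -/C -/V cE -EFinM lee_fin mulrDl.
apply: (@le_trans _ _ (K1 / V * t ^+ d)).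
  by rewrite mulrAC ler_pM2r ?invr_gt0.
by rewrite lerDl mulr_ge0// exprn_ge0// ltW.
Qed.

End caps.

(** * Functions on the ball and their radial limits *)

Section ball_functions.
Context (R : realType) (d : nat).
Implicit Types (b : 'rV[R[i]]_d -> R[i]) (z : 'rV[R[i]]_d).

Lemma nbhs_CnP z (P : set 'rV[R[i]]_d) :
  nbhs z P <-> exists2 e : R, 0 < e & forall w : 'rV[R[i]]_d, (forall j, normc (w 0 j - z 0 j) < e) -> P w.
Proof.
split=> [/nbhs_ballP[[e e']]|[e e0 H]].
  rewrite /= ltcE/= => /andP[/eqP -> e0] H; exists e => // w we; apply: H; split=> [|i j].
    by rewrite ltcR.
  by rewrite ord1 /ball /= normCE ltcR distcC.
apply/nbhs_ballP; exists e%:C; first by rewrite /= ltcR.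
move=> w [_ zw]; apply: H => j; have := zw 0 j.
by rewrite /ball /= normCE ltcR distcC.
Qed.

Lemma open_Bd : open (Bd : set 'rV[R[i]]_d).
Proof.
rewrite openE => z /= z1; apply/nbhs_CnP.
have z2 : enorm z ^+ 2 < 1 by rewrite expr_lt1// enorm_ge0.
have d0 : 0 < 3 * (d%:R + 1) :> R by rewrite mulr_gt0// ltr_wpDl.
pose e := Num.min 1 ((1 - enorm z ^+ 2) / (3 * (d%:R + 1))).
have e0 : 0 < e by rewrite lt_min ltr01 divr_gt0// subr_gt0.
have e1 : e <= 1 by rewrite ge_min lexx.
exists e => // w wz; rewrite /Bd /= -(ltr_pXn2r (n := 2)) ?nnegrE ?enorm_ge0// expr1n.
have le : enorm w ^+ 2 <= enorm z ^+ 2 + \sum_(j < d) 3 * e.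
  rewrite !sqr_enorm -big_split /=; apply: ler_sum => j _.
  have a : normc (w 0 j) <= normc (z 0 j) + e.
    rewrite -[w 0 j](subrK (z 0 j)) (le_trans (le_normcD _ _))// addrC lerD2l ltW//.
  have zj := @clBd_coord R d z j (ltW z1); have := normc_ge0 (z 0 j); have := normc_ge0 (w 0 j).
  move: a e1 e0 zj; move: (normc (w 0 j)) (normc (z 0 j)) => p q; clear; move=> a e1 e0 q1 p0 q0.
  have : p ^+ 2 <= (q + e) ^+ 2 by rewrite lerXn2r ?nnegrE//; lra.
  by move=> /le_trans; apply; nra.
apply: le_lt_trans le _; rewrite sumr_const card_ord -mulr_natr.
have : e * (3 * (d%:R + 1)) <= 1 - enorm z ^+ 2 by rewrite -ler_pdivlMr// ge_min lexx orbT.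
by move: e0; clear; nra.
Qed.

Definition bd_cts b := forall z, Bd z -> forall e : R, 0 < e -> exists2 de : R, 0 < de &
  forall w : 'rV[R[i]]_d, (forall j, normc (w 0 j - z 0 j) < de) -> normc (b w - b z) < e.

Lemma holomorphic_bd_cts b : holomorphic_Bd b -> bd_cts b.
Proof.
move=> hb z Bz e e0; have /differentiable_continuous cb := hb z Bz.
have FF : Filter (nbhs z) := nbhs_filter z.
have := (@cvgrPdist_lt _ _ _ (nbhs z) FF b (b z)).1 cb e%:C.
rewrite ltcR => /(_ e0) /nbhs_CnP[de de0 H]; exists de => // w /H.
by rewrite normCE ltcR distcC.
Qed.

(** Extension by 0, which makes a function continuous on the ball a Borel function on C^d. *)
Definition bd_restrict b z : R[i] := if enorm z < 1 then b z else 0.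

Lemma cmeasurable_bd_restrict b : bd_cts b ->
  cmeasurable (bd_restrict b : Cn R d -> R[i]).
Proof.
move=> cb.
have H (g : R[i] -> R) : (forall u v : R[i], `|g u - g v| <= normc (u - v)) -> g 0 = 0 ->
    measurable_fun [set: Cn R d] (fun z : Cn R d => g (bd_restrict b z)).
  move=> g1 g0.
  apply: (measurability _ (RGenOInfty.measurableE R)) => _ [_ [x ->] <-]; rewrite setTI.
  have op : measurable ([set z | Bd z /\ x < g (b z)] : set (Cn R d)).
    apply: sub_sigma_algebra; rewrite openE => z [Bz xz].
    apply: (@filterI _ (nbhs z)); first by apply: open_nbhs_nbhs; split => //; exact: open_Bd.
    apply/nbhs_CnP; have [de de0 H] := cb z Bz (g (b z) - x) ltac:(by rewrite subr_gt0).
    exists de => // w /H le; have := le_lt_trans (g1 _ _) le.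
    by rewrite ltr_norml => /andP[+ _]; clear; lra.
  have [x0|x0] := ltP x 0.
    rewrite (_ : _ @^-1` _ = [set z | Bd z /\ x < g (b z)] `|` ~` (Bd : set (Cn R d))).
      by apply: measurableU => //; apply: measurableC; exact: measurable_Bd.
    apply/seteqP; split => z; rewrite /= in_itv/= andbT /bd_restrict /Bd /=.
      by case: ifP => [z1 xz|/negP z1 _]; [left|right].
    by case: ifP => [z1 [[_]//|/(_ isT)]|]; rewrite // g0.
  rewrite (_ : _ @^-1` _ = [set z | Bd z /\ x < g (b z)])//.
  apply/seteqP; split => z; rewrite /= in_itv/= andbT /bd_restrict /Bd /=.
    by case: ifP => // _; rewrite g0 ltNge x0.
  by case: ifP => [_ []|/negP z1 []].
split; apply: H => //.
  by move=> z w; apply: le_trans (normc_Re _); case: z w => [? ?] [].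
by move=> z w; apply: le_trans (normc_Im _); case: z w => [? ?] [].
Qed.

Definition has_rlim b z (L : R[i]) := forall e : R, 0 < e -> exists2 de : R, 0 < de &
  forall r, 1 - de < r < 1 -> normc (b (r%:C *: z) - L) <= e.

Lemma has_rlimP b z L : has_rlim b z L <-> b (r%:C *: z) @[r --> (1 : R)^'-] --> L.
Proof.
split=> [H|H].
  apply/cvgrPdist_le => e; rewrite ltcE => /andP[/eqP /= ei /= e0].
  have [de de0 {}H] := H _ e0; near=> r.
  rewrite distrC normCE lecE /= ei eqxx /=; apply: H; apply/andP; split; near: r.
    by apply: nbhs_left_gt; rewrite ltrBlDr ltrDl.
  exact: nbhs_left_lt.
move=> e e0; have /cvgrPdist_le/(_ e%:C) := H; rewrite ltcR => /(_ e0).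
rewrite near_withinE => /nbhs_ballP[de /= de0 {}H]; exists de => // r /andP[r1 r2].
have := H r; rewrite /ball /= ger0_norm ?subr_ge0 ?(ltW r2)// => h.
by rewrite distcC -lecR -normCE; apply: h => //; move: r1; clear; lra.
Unshelve. all: by end_near. Qed.

Lemma rlim_radial_lim b z L : has_rlim b z L -> radial_lim b z = L.
Proof.
by move=> /has_rlimP H; apply: cvg_lim H; exact: norm_hausdorff.
Qed.

Lemma radial_cvg_rlim b z : radial_cvg b z -> has_rlim b z (radial_lim b z).
Proof. by move=> H; apply/has_rlimP. Qed.

Lemma rlim_radial_cvg b z L : has_rlim b z L -> radial_cvg b z.
Proof. by move=> /has_rlimP H; apply/cvg_ex; exists L. Qed.

Lemma cderiv_slice b z (la : R[i]) : holomorphic_Bd b -> Bd (la *: z) ->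
  exists a, cderiv (fun l => b (l *: z)) la a.
Proof.
move=> hb Bz; apply/derivable_cderiv.
have := @diff_derivable _ _ _ b (la *: z) z (hb _ Bz); rewrite /derivable.
rewrite (_ : (fun h => h^-1 *: ((b \o shift (la *: z)) (h *: z) - b (la *: z)))
  = (fun h => h^-1 *: (((fun l => b (l *: z)) \o shift la) (h *: (1 : R[i])) - b (la *: z))))//.
apply/funext => h /=; congr (_ *: (b _ - _)).
by rewrite scalerDl /GRing.scale /= mulr1.
Qed.

Lemma ex_cderiv_comp (f g : R[i] -> R[i]) (z : R[i]) : (exists a, cderiv g z a) ->
  (exists a, cderiv f (g z) a) -> exists a, cderiv (fun w => f (g w)) z a.
Proof.
move=> /derivable_cderiv/derivable1_diffP dg /derivable_cderiv/derivable1_diffP df.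
apply/derivable_cderiv/derivable1_diffP.
exact: (differentiable_comp dg df).
Qed.

End ball_functions.

(** * Fatou's theorem on the sphere *)

Section sphere_fatou.
Context (R : realType) (d : nat).
Local Notation leb := (@lebesgue_measure R).
Local Notation TR := (measurableTypeR R).
Implicit Types (b : 'rV[R[i]]_d -> R[i]) (z : 'rV[R[i]]_d).

(** The map (1 + h) / (1 - h) of the left half plane onto the disk; on the imaginary axis it
    is [circle_pt]. *)
Definition cayley (h : R[i]) : R[i] := (- 1) * ((h - - 1) * (h - 1)^-1).

Lemma normc_cayley_lt1 (x y : R) : x < 0 -> normc (cayley (x +i* y)) < 1.
Proof.
move=> x0; rewrite /cayley !normcM normcV normcN normc1 mul1r.
have n0 : 0 < normc ((x +i* y) - 1).
  apply: lt_le_trans (normc_Re _); rewrite /= normr_gt0 subr_eq0 lt_eqF//.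
  by apply: lt_trans x0 _.
rewrite ltr_pdivrMr// mul1r -(ltr_pXn2r (n := 2)) ?nnegrE ?normc_ge0//.
by rewrite !sqr_normcE /=; nra.
Qed.

Lemma ex_cderiv_cayley (x y : R) : x < 0 -> exists a, cderiv cayley (x +i* y) a.
Proof.
move=> x0; apply: ex_cderivM; first exact: ex_cderiv_cst.
apply: ex_cderivM; first by exists 1; exact: cderiv_shift.
apply/derivable_cderiv/derivableV.
  by rewrite subr_eq0 eq_complex /= negb_and lt_eqF//; apply: lt_trans x0 _.
by apply/derivable_cderiv; exists 1; exact: cderiv_shift.
Qed.

(** The preimage of a radius of the disk is a path that ends at i t inside a cone, in fact
    tangentially to the normal. *)
Lemma cayley_radius (r t : R) : 0 < r < 1 ->
  let D := (1 + r) ^+ 2 + t ^+ 2 * (1 - r) ^+ 2 in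
  cayley ((- ((1 - r ^+ 2) * (1 + t ^+ 2) / D)) +i* (4 * r * t / D)) = r%:C * circle_pt t.
Proof.
move=> /andP[r0 r1] D.
have D0 : 0 < D by rewrite /D -exprMn; have := sqr_ge0 (t * (1 - r)); nra.
have t0 := circle_den t.
set x := - _; set y := _ / D.
have x0 : x < 0.
  rewrite oppr_lt0 divr_gt0// mulr_gt0//; last by rewrite ltr_wpDr// sqr_ge0.
  by rewrite subr_gt0 expr_lt1// ltW.
have h0 : (x +i* y) - 1 != 0.
  by rewrite subr_eq0 eq_complex /= negb_and lt_eqF//; apply: lt_trans x0 _.
suff E : - ((x +i* y) - - 1) = r%:C * circle_pt t * ((x +i* y) - 1).
  by rewrite /cayley mulrA mulN1r E mulfK.
have Dn : D != 0 by rewrite gt_eqF.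
by apply/eqP; rewrite eq_complex /= /x /y; apply/andP; split; apply/eqP;
  rewrite /D; field; rewrite t0 andbT; move: Dn; rewrite /D -exprMn.
Qed.

Lemma slice_fatou b z : holomorphic_Bd b -> (forall w, Bd w -> normc (b w) < 1) -> Sd z ->
  {ae leb, forall t, 0 < t < 1 -> exists L, has_rlim b (circle_pt t *: z) L}.
Proof.
move=> hb b1 z1.
pose f h := b (cayley h *: z).
have Bc (x y : R) : x < 0 -> Bd (cayley (x +i* y) *: z).
  by move=> x0; rewrite /Bd /= enormZ z1 mulr1 normc_cayley_lt1.
have df (x y : R) : x < 0 -> exists a, cderiv f (x +i* y) a.
  move=> x0; apply: (@ex_cderiv_comp _ (fun l => b (l *: z)) cayley).
    exact: ex_cderiv_cayley.
  by apply: cderiv_slice => //; exact: Bc.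
have f1 (x y : R) : x < 0 -> normc (f (x +i* y)) <= 1.
  by move=> x0; rewrite ltW// b1//; exact: Bc.
have := halfplane_fatou df f1.
have aeF : Filter (nbhs (almost_everywhere leb)) := ae_filter_ringOfSetsType leb.
apply: filterS => t + tin => /(_ tin)[L HL]; exists L => e e0.
have [s0 s00 Hs] := HL 1 e ler01 e0; case/andP: tin => t0 t1.
exists (Num.min 1 (s0 / 4)); first by rewrite lt_min ltr01 divr_gt0.
move=> r /andP[r1 r2].
have [m1 m2] : Num.min 1 (s0 / 4) <= 1 /\ Num.min 1 (s0 / 4) <= s0 / 4.
  by rewrite !ge_min !lexx orbT.
have r0 : 0 < r by move: r1 m1; clear; lra.
have rs : 4 * (1 - r) < s0 by move: r1 m2; clear; lra.
have rin : 0 < r < 1 by rewrite r0.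
have := @cayley_radius r t rin.
set D := _ + _; move=> /= E.
have D1 : 1 <= D by rewrite /D; move: r0 (sqr_ge0 t) (sqr_ge0 (1 - r)); clear; nra.
have D0 : 0 < D by apply: lt_le_trans D1.
rewrite scalerA -E; apply: Hs.
  apply/andP; split; last first.
    rewrite oppr_lt0 divr_gt0// mulr_gt0//; last by rewrite ltr_wpDr// sqr_ge0.
    by rewrite subr_gt0 expr_lt1// ltW.
  rewrite ltrN2 ltr_pdivrMr//.
  apply: (@lt_le_trans _ _ s0); last by rewrite ler_pMr.
  apply: le_lt_trans rs.
  move: r0 r2 t0 t1; clear=> r0 r2 t0 t1.
  have a : 0 <= (1 - r ^+ 2) by nra.
  have b : 1 - r ^+ 2 <= 2 * (1 - r) by nra.
  have c : 1 + t ^+ 2 <= 2 by nra.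
  have c0 : 0 <= 1 + t ^+ 2 by nra.
  by apply: le_trans (ler_pM a c0 b c) _; lra.
have -> : 4 * r * t / D - t = - (t * (1 - r) ^+ 2 * (1 + t ^+ 2) / D).
  by rewrite /D; field; move: D0; rewrite /D -exprMn => /gt_eqF/negbT.
rewrite opprK mul1r normrN ger0_norm; last first.
  apply: divr_ge0; last exact: ltW.
  apply: mulr_ge0; first by apply: mulr_ge0; [exact: ltW|exact: sqr_ge0].
  by apply: addr_ge0; [exact: ler01|exact: sqr_ge0].
rewrite ler_pM2r ?invr_gt0// ler_wpM2r ?addr_ge0 ?sqr_ge0//.
have a : t * (1 - r) <= 1 by move: r0 r2 t0 t1; clear; nra.
have : 0 <= (1 - r) * (1 + r - t * (1 - r)).
  by apply: mulr_ge0; move: a r0 r2; clear; lra.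
by clear; lra.
Qed.

(** Cauchy's criterion along the radius. It is tested on rational radii, so that countably
    many conditions define the set, which is therefore Borel. *)
Definition radial_cauchy b : set (Cn R d) := [set z | forall k, exists m : nat, forall q q' : rat,
  1 - m.+1%:R^-1 < (ratr q : R) < 1 -> 1 - m.+1%:R^-1 < (ratr q' : R) < 1 ->
  normc (bd_restrict b ((ratr q)%:C *: (z : 'rV[R[i]]_d)) - bd_restrict b ((ratr q')%:C *: (z : 'rV[R[i]]_d))) <= k.+1%:R^-1].

Lemma measurable_scale_fun dx (X : measurableType dx) (c : X -> R[i]) (phi : X -> Cn R d) :
  cmeasurable c -> measurable_fun setT phi ->
  measurable_fun setT (fun x => c x *: (phi x : 'rV[R[i]]_d) : Cn R d).
Proof.
move=> mc mphi; apply: measurable_fun_Cn => j; under eq_fun do rewrite mxE;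
  by have [] := cmeasurableM mc (cmeasurable_coord j mphi).
Qed.

Lemma cmeasurable_comp dx dy (X : measurableType dx) (Y : measurableType dy)
    (f : Y -> R[i]) (g : X -> Y) :
  cmeasurable f -> measurable_fun setT g -> cmeasurable (f \o g).
Proof. by move=> [f1 f2] mg; split; [exact: measurableT_comp f1 mg|exact: measurableT_comp f2 mg]. Qed.

Lemma measurable_radial_cauchy b : bd_cts b -> measurable (radial_cauchy b).
Proof.
move=> cb; have mb := cmeasurable_bd_restrict cb.
rewrite (_ : radial_cauchy b = \bigcap_k \bigcup_m \bigcap_(p in [set p : rat * rat |
   1 - m.+1%:R^-1 < (ratr p.1 : R) < 1 /\ 1 - m.+1%:R^-1 < (ratr p.2 : R) < 1])
  [set z : Cn R d | normc (bd_restrict b ((ratr p.1)%:C *: (z : 'rV[R[i]]_d)) -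
     bd_restrict b ((ratr p.2)%:C *: (z : 'rV[R[i]]_d))) <= k.+1%:R^-1]); last first.
  apply/seteqP; split => z H k.
    by move=> _; have [m Hm] := H k; exists m => // -[q q'] /= [h1 h2]; exact: Hm.
  by have [m _ Hm] := H k I; exists m => q q' h1 h2; exact: (Hm (q, q')).
apply: bigcap_measurable => // k _; apply: bigcup_measurable => // m _.
rewrite bigcap_mkcond -[X in measurable X]setCK setC_bigcap; apply: measurableC.
apply: countable_bigcupT_measurable => [|p]; first exact: countableP.
apply: measurableC; case: ifP => // _; apply: measurable_sub_le => //; apply: measurable_normc.
have ms q : measurable_fun setT (fun z : Cn R d => (ratr q)%:C *: (z : 'rV[R[i]]_d) : Cn R d).
  by apply: measurable_scale_fun => //; exact: cmeasurable_cst.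
apply: cmeasurableB; exact: cmeasurable_comp mb (ms _).
Qed.

Lemma radius_Bd z (r : R) : Sd z -> 0 <= r < 1 -> Bd (r%:C *: z).
Proof.
by move=> z1 /andP[r0 r1]; rewrite /Bd /= enormZ z1 mulr1 normc_real ger0_norm.
Qed.

Lemma radius_restrict b z (r : R) m : Sd z -> 1 - m.+1%:R^-1 < r < 1 ->
  bd_restrict b (r%:C *: z) = b (r%:C *: z).
Proof.
move=> z1 /andP[r0 r1]; rewrite /bd_restrict ifT//; apply: radius_Bd => //.
rewrite r1 andbT ltW//; apply: le_lt_trans r0.
by rewrite subr_ge0 invf_le1// ler1n.
Qed.

Lemma rlim_cauchy b z L : Sd z -> has_rlim b z L -> radial_cauchy b z.
Proof.
move=> z1 H k; have k0 : 0 < k.+1%:R^-1 :> R by rewrite invr_gt0.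
have [de de0 Hde] := H (k.+1%:R^-1 / 2) ltac:(by rewrite divr_gt0).
have [m _ /(_ m (leqnn m)) mde] := @near_infty_natSinv_lt R (PosNum de0).
exists m => q q' qm q'm; rewrite !(radius_restrict b z1 qm, radius_restrict b z1 q'm).
have in_ (r : R) : 1 - m.+1%:R^-1 < r < 1 -> 1 - de < r < 1.
  by move=> /andP[r1 ->]; rewrite andbT (lt_trans _ r1)// ltrD2l ltrN2.
rewrite (le_trans (normc_triangle L _ _))// [leRHS]splitr lerD//.
  exact: Hde (in_ _ qm).
rewrite distcC; exact: Hde (in_ _ q'm).
Qed.

Lemma cauchy_rlim b z : bd_cts b -> Sd z -> radial_cauchy b z -> exists L, has_rlim b z L.
Proof.
move=> cb z1 H.
pose q (n : nat) : rat := 1 - n.+2%:R^-1.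
have qE n : ratr (q n) = 1 - n.+2%:R^-1 :> R.
  by rewrite rmorphB rmorph1 fmorphV rmorph_nat.
have qin m n : (m <= n)%N -> 1 - m.+1%:R^-1 < (ratr (q n) : R) < 1.
  move=> mn; rewrite qE; apply/andP; split; last by rewrite gtrDl oppr_lt0 invr_gt0.
  by rewrite ltrD2l ltrN2 ltf_pV2 ?posrE// ltr_nat ltnS ltnS.
pose u n := b ((ratr (q n))%:C *: z).
have Hk e : 0 < e -> exists m : nat, forall p p' : rat,
    1 - m.+1%:R^-1 < (ratr p : R) < 1 -> 1 - m.+1%:R^-1 < (ratr p' : R) < 1 ->
    normc (b ((ratr p)%:C *: z) - b ((ratr p')%:C *: z)) <= e.
  move=> e0; have [k _ /(_ k (leqnn k)) ke] := @near_infty_natSinv_lt R (PosNum e0).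
  have [m Hm] := H k; exists m => p p' pm p'm.
  have := Hm p p' pm p'm; rewrite !(radius_restrict b z1 pm, radius_restrict b z1 p'm).
  by move=> /le_trans; apply; exact: ltW.
have cvgu (g : R[i] -> R) : (forall v w : R[i], `|g v - g w| <= normc (v - w)) -> cvgn (g \o u).
  move=> g1; apply: cauchy_cvg; apply: cauchy_exP => e e0.
  have [m Hm] := Hk (e / 2) ltac:(by rewrite divr_gt0).
  exists (g (u m)); exists m => // n /= mn; rewrite /ball /=.
  apply: le_lt_trans (g1 _ _) _; apply: le_lt_trans (Hm _ _ (qin m m (leqnn m)) (qin m n mn)) _.
  by rewrite ltr_pdivrMr// ltr_pMr// ltr1n.
have cR := cvgu (@complex.Re R) (fun v w => le_trans
  (_ : `|complex.Re v - complex.Re w| <= `|complex.Re (v - w)|) (normc_Re _)).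
have {}cR : cvgn ((@complex.Re R) \o u).
  by apply: cR => v w; case: v w => [? ?] [].
have {}cI : cvgn ((@complex.Im R) \o u).
  by apply: cvgu => v w; apply: le_trans (normc_Im _); case: v w => [? ?] [].
pose L : R[i] := limn ((@complex.Re R) \o u) +i* limn ((@complex.Im R) \o u).
exists L => e e0.
have e4 : 0 < e / 4 by rewrite divr_gt0.
have [m Hm] := Hk (e / 4) e4.
exists m.+1%:R^-1; first by rewrite invr_gt0.
move=> r rin; have /andP[r1 r2] := rin.
(* the criterion concerns rational radii: by continuity, replace r by one of them *)
have Br : Bd (r%:C *: z).
  apply: radius_Bd => //; rewrite r2 andbT ltW//; apply: le_lt_trans r1.
  by rewrite subr_ge0 invf_le1// ler1n.
have [de de0 Hde] := cb _ Br _ e4.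
have [p] := @rat_in_itvoo R (Num.max (1 - m.+1%:R^-1) (r - de)) r ltac:(by rewrite gt_max r1 gtrDl oppr_lt0).
rewrite in_itv/= gt_max => /andP[/andP[p1 p2] p3].
have pin : 1 - m.+1%:R^-1 < (ratr p : R) < 1 by rewrite p1 (lt_trans p3).
have b1 : normc (b ((ratr p)%:C *: z) - b (r%:C *: z)) < e / 4.
  apply: Hde => j; rewrite !mxE -mulrBl normcM -rmorphB normc_real.
  apply: (@le_lt_trans _ _ `|ratr p - r|).
    by rewrite ler_piMr// (clBd_coord j)// /clBd /= z1.
  by rewrite ltr0_norm ?subr_lt0// opprB; move: p2; clear; lra.
have [N _ HN] : \forall n \near \oo, normc (u n - L) <= e / 4.
  have e8 : 0 < e / 8 by rewrite divr_gt0.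
  have nR := (@cvgrPdist_le _ _ _ _ _ _ _).1 cR _ e8.
  have nI := (@cvgrPdist_le _ _ _ _ _ _ _).1 cI _ e8.
  near=> n; apply: le_trans (normc_le_ReIm _) _.
  have h1 : `|limn ((@complex.Re R) \o u) - complex.Re (u n)| <= e / 8 by near: n; exact: nR.
  have h2 : `|limn ((@complex.Im R) \o u) - complex.Im (u n)| <= e / 8 by near: n; exact: nI.
  move: h1 h2; rewrite /L; case: (u n) => x y /=; rewrite distrC (distrC _ y).
  by clear; lra.
pose n := maxn N m.
have h1 := HN n (leq_maxl _ _).
have h2 := Hm p (q n) pin (qin m n (leq_maxr _ _)).
have t1 := normc_triangle (b ((ratr p)%:C *: z)) (b (r%:C *: z)) L.
have t2 := normc_triangle (u n) (b ((ratr p)%:C *: z)) L.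
move: b1 h1 h2 t1 t2 e0; rewrite /= distcC -/(u n); clear; lra.
Unshelve. all: by end_near. Qed.

Lemma cmeasurable_circle_pt : cmeasurable (fun t : TR => circle_pt t).
Proof.
have mV : measurable_fun [set: TR] (fun t : TR => (1 + t ^+ 2)^-1 : R).
  have cV : continuous (fun t : R => (1 + t ^+ 2)^-1).
    move=> t; apply: cvgV; first exact: circle_den.
    by apply: cvgD; [exact: cvg_cst|exact: exprn_continuous].
  exact: continuous_measurable_fun cV.
have mt : measurable_fun [set: TR] (fun t : TR => t : R) by exact: measurable_id.
split; apply: measurable_funM => //.
  by apply: measurable_funB => //; exact: measurable_funX.
Qed.

(** The set B of bad points is Borel. For each z of the sphere, [slice_fatou] shows that the
    rotations of z lie in B for almost no parameter t; and B has the same measure as its image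
    under each rotation. Fubini's theorem for (z, t) gives measure 0. *)
Lemma sphere_fatou b : holomorphic_Bd b -> (forall w, Bd w -> normc (b w) < 1) ->
  {ae sphere_measure R d, forall z, Sd z -> exists L, has_rlim b z L}.
Proof.
move=> hb b1; have cb := holomorphic_bd_cts hb.
pose B : set (Cn R d) := Sd `&` ~` radial_cauchy b.
have mB : measurable B.
  apply: measurableI; first exact: measurable_Sd.
  apply: measurableC; exact: measurable_radial_cauchy.
exists B; split => //; last first.
  move=> z /= /not_implyP[z1 nL]; split => // zc; apply: nL.
  exact: cauchy_rlim.
pose I : set TR := `]0, 1[%classic.
have mI : measurable I by exact: measurable_itv.
have I1 : leb I = 1%E.
  by rewrite /I lebesgue_measure_itv/= lte_fin ltr01 sube0.
have Ioo : (leb I < +oo)%E by rewrite I1 ltry.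
pose lebI : {finite_measure set TR -> \bar R} := mfrestr mI Ioo.
pose rot (p : Cn R d * TR) : Cn R d := circle_pt p.2 *: (p.1 : 'rV[R[i]]_d).
have mrot : measurable_fun setT rot.
  apply: measurable_scale_fun; last exact: measurable_fst.
  exact: (cmeasurable_comp cmeasurable_circle_pt measurable_snd).
have mZ : measurable (rot @^-1` B) by rewrite -[X in measurable X]setTI; exact: mrot.
have E1 : (sphere_measure R d \x lebI)%E (rot @^-1` B) = 0%E.
  rewrite /product_measure1 integral0_eq// => z _ /=.
  rewrite (_ : xsection _ z = [set t | B (circle_pt t *: (z : 'rV[R[i]]_d))]); last first.
    by apply/seteqP; split => t; rewrite /xsection /= inE.
  have mz : measurable ([set t | B (circle_pt t *: (z : 'rV[R[i]]_d))] `&` I : set TR).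
    apply: measurableI => //.
    have mr : measurable_fun setT (fun t : TR => circle_pt t *: (z : 'rV[R[i]]_d) : Cn R d).
      by apply: measurable_scale_fun; [exact: cmeasurable_circle_pt|exact: measurable_cst].
    by rewrite -[X in measurable X]setTI; exact: mr.
  rewrite /lebI /= /mfrestr /mrestr.
  have [z1|z1] := pselect (Sd (z : 'rV[R[i]]_d)); last first.
    rewrite (_ : _ `&` I = set0) ?measure0// -subset0 => t /= [[zt _] _]; apply: z1.
    by move: zt; rewrite /Sd /= enormZ normc_circle_pt mul1r.
  apply: (measure_negligible mz).
  apply: negligibleS (slice_fatou hb b1 z1) => t /= [[zt nc]]; rewrite /I /= in_itv/= => tin.
  by move=> /(_ tin)[L HL]; apply: nc; exact: rlim_cauchy HL.
have E2 : (sphere_measure R d \x^ lebI)%E (rot @^-1` B) = sphere_measure R d B.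
  rewrite /product_measure2 (eq_integral (cst (sphere_measure R d B))).
    by rewrite integral_cst// /lebI /= /mfrestr /mrestr setTI I1 mule1.
  move=> t _ /=; rewrite -(sphere_measure_rotation t mB).
  by congr (sphere_measure R d _); apply/seteqP; split => z; rewrite /ysection /= inE.
rewrite -E2 -E1; apply/esym; apply: product_measure_unique => //= ? ? ? ?.
by rewrite product_measure2E.
Qed.

End sphere_fatou.

(** * The Poisson kernel *)

Lemma measurable_invr (R : realType) : measurable_fun [set: R] (fun x : R => x^-1).
Proof.
rewrite (_ : [set: R] = [set x | x != 0] `|` [set 0]).
  have oU : open [set x : R | x != 0].
    rewrite (_ : mkset _ = ~` [set 0]); last by apply/seteqP; split => x /= /eqP.
    exact/closed_openC/closed_eq.
  apply/measurable_funU; [exact: open_measurable|exact: measurable_set1|split].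
    apply: open_continuous_measurable_fun => // x; rewrite inE/= => x0.
    exact: inv_continuous.
  exact: measurable_fun_set1.
apply/seteqP; split => // x _ /=.
by have [->|x0] := eqVneq x 0; [right|left].
Qed.

Section poisson_kernel.
Context (R : realType) (d : nat).
Hypothesis d0 : (0 < d)%N.
Implicit Types z w : 'rV[R[i]]_d.

Lemma Re_hdot_le z w : 2 * complex.Re (hdot z w) <= enorm z ^+ 2 + enorm w ^+ 2.
Proof.
rewrite addrC -subr_ge0 -sqr_dist_hdot; apply: sumr_ge0 => k _; exact: sqr_ge0.
Qed.

Lemma Re_hdot_le1 z w : clBd z -> clBd w -> complex.Re (hdot z w) <= 1.
Proof.
move=> z1 w1; have := Re_hdot_le z w.
have : enorm z ^+ 2 <= 1 by rewrite expr_le1// enorm_ge0.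
have : enorm w ^+ 2 <= 1 by rewrite expr_le1// enorm_ge0.
clear; lra.
Qed.

(** For |w| = 1 - ep this is, up to constants, the invariant Poisson kernel
    (1 - |w|^2)^d / |1 - <z, w>|^(2 d). *)
Definition poisson (ep : R) z w : R := (ep / normc (1 - hdot z w) ^+ 2) ^+ d.

Lemma poisson_ge0 ep z w : 0 <= ep -> 0 <= poisson ep z w.
Proof. by move=> ep0; rewrite exprn_ge0// divr_ge0// sqr_ge0. Qed.

Lemma dist_radius_ge ep z w (de : R) : 0 < ep <= 1 -> 0 <= de <= 1 ->
  complex.Re (hdot z w) <= 1 - de ->
  ep <= normc (1 - hdot z ((1 - ep)%:C *: w)) /\ de <= normc (1 - hdot z ((1 - ep)%:C *: w)).
Proof.
move=> /andP[e0 e1] /andP[d1 d2] h.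
have : 1 - (1 - ep) * complex.Re (hdot z w) <= normc (1 - hdot z ((1 - ep)%:C *: w)).
  apply: le_trans (normc_Re _); apply: le_trans (ler_norm _).
  by rewrite hdotZr; case: (hdot z w) => p q /=; rewrite mul0r subr0.
move=> H; have : (1 - ep) * complex.Re (hdot z w) <= (1 - ep) * (1 - de).
  by rewrite ler_wpM2l// subr_ge0.
by move=> H2; split; apply: le_trans H; nra.
Qed.

Lemma poisson_far ep z w (de : R) : 0 < ep <= 1 -> 0 < de <= 1 ->
  complex.Re (hdot z w) <= 1 - de ->
  poisson ep z ((1 - ep)%:C *: w) <= (ep / de ^+ 2) ^+ d.
Proof.
move=> ein /andP[d1 d2] h; have e0 : 0 <= ep by case/andP: ein => /ltW.
have [_ le] := dist_radius_ge ein (ltac:(by rewrite d2 ltW) : 0 <= de <= 1) h.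
rewrite /poisson lerXn2r ?nnegrE ?divr_ge0 ?sqr_ge0//.
rewrite ler_wpM2l// lef_pV2 ?posrE ?exprn_gt0//; last exact: lt_le_trans le.
by rewrite lerXn2r ?nnegrE ?normc_ge0// ltW.
Qed.

Lemma measurable_poisson ep dx (X : measurableType dx) (phi psi : X -> Cn R d) :
  measurable_fun setT phi -> measurable_fun setT psi ->
  measurable_fun setT (fun x => poisson ep (phi x : 'rV[R[i]]_d) (psi x)).
Proof.
move=> mphi mpsi; apply: measurable_funX; apply: measurable_funM => //.
apply: (measurableT_comp (@measurable_invr R)); apply: measurable_sqr_normc; apply: cmeasurableB.
  exact: cmeasurable_cst.
exact: cmeasurable_hdot.
Qed.

Lemma normc_hdot_le z w : clBd z -> clBd w -> normc (hdot z w) <= d%:R.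
Proof.
move=> z1 w1; have -> : d%:R = \sum_(k < d) 1 :> R by rewrite sumr_const card_ord.
rewrite /hdot; elim/big_rec2: _ => [|k a b _ le]; first by rewrite normc0.
rewrite (le_trans (le_normcD _ _))// lerD// normcM.
by rewrite normc_conj -[leRHS]mulr1 ler_pM ?normc_ge0 ?clBd_coord.
Qed.

(** Cut the sphere into the sets where |1 - <z, (1 - ep) w>| is between 2^k ep and
    2^(k + 1) ep. There the kernel is at most c k = 1 / (4^k ep)^d, and [cap_measure] bounds
    the measure by a multiple of (2^(k + 1) ep)^d: the series is geometric. The factor
    1 - ep is moved from w to z, so that the caps are sets of points w. *)
Lemma poisson_integral_le : exists2 M : R, 0 < M & forall ep z, 0 < ep <= 1 -> clBd z ->
  (\int[sphere_measure R d]_(w in Sd) (poisson ep z ((1 - ep)%:C *: (w : 'rV[R[i]]_d)))%:E <= M%:E)%E.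
Proof.
have [K K0 HK] := cap_measure R d0.
exists (K * 2 ^+ d * 2); first by rewrite !mulr_gt0// exprn_gt0.
move=> ep z ein z1; have /andP[e0 e1] := ein.
pose z' : 'rV[R[i]]_d := (1 - ep)%:C *: z.
have z'1 : clBd z'.
  rewrite /clBd /= enormZ normc_real ger0_norm ?subr_ge0// mulr_ile1 ?subr_ge0 ?enorm_ge0//.
  by rewrite gerBl ltW.
have z'h w : hdot z' w = hdot z ((1 - ep)%:C *: w).
  rewrite hdotZr /hdot mulr_sumr; apply: eq_bigr => k _; rewrite mxE.
  by rewrite mulrA.
have [n nP] : exists n : nat, (1 + d%:R) < 2 ^+ n * ep :> R.
  pose n := Num.truncn ((1 + d%:R) / ep).
  exists n.+1; rewrite -ltr_pdivrMr//; apply: lt_le_trans (truncnS_gt _) _.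
  by rewrite -natrX ler_nat; exact/ltnW/ltn_expl.
pose c (k : nat) : R := (ep / (2 ^+ k * ep) ^+ 2) ^+ d.
have c0 k : 0 <= c k by rewrite exprn_ge0// divr_ge0 ?sqr_ge0// ltW.
pose E (k : nat) : set (Cn R d) := cap z' (2 ^+ k.+1 * ep).
have mE k : measurable (E k) by exact: measurable_cap.
have ptw w : Sd w -> poisson ep z ((1 - ep)%:C *: w) <= \sum_(k < n.+1) c k * \1_(E k) w.
  move=> w1; have w1' : clBd w by rewrite /clBd /= w1.
  have [x1 _] := @dist_radius_ge ep z w 0 ein ltac:(by rewrite lexx ler01)
    ltac:(by rewrite subr0 Re_hdot_le1).
  set x := normc _ in x1.
  have xn : x < 2 ^+ n.+1 * ep.
    apply: le_lt_trans (_ : 1 + d%:R < _); last first.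
      by apply: (lt_le_trans nP); rewrite ler_wpM2r ?(ltW e0)// ler_weXn2l// ler1n.
    rewrite /x (le_trans (normcB_le _ _))// normc1 lerD2l -z'h normc_hdot_le//.
  (* the index of the dyadic shell that contains w *)
  have ex : exists k, x < 2 ^+ k.+1 * ep by exists n.
  case: (ex_minnP ex) => k kP kmin.
  have kn : (k < n.+1)%N by rewrite ltnS; exact: kmin.
  have xk : 2 ^+ k * ep <= x.
    have [->|k0] := posnP k; first by rewrite expr0 mul1r.
    rewrite leNgt; apply/negP => h; have := kmin k.-1; rewrite prednK// => /(_ h).
    by rewrite leqNgt ltn_predL k0.
  rewrite (bigD1 (Ordinal kn))//= -[leLHS]addr0 lerD//; last first.
    by apply: sumr_ge0 => j _; rewrite mulr_ge0.
  rewrite indicE mem_set; last first.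
    by split => //; rewrite z'h.
  rewrite mulr1 /poisson /c lerXn2r ?nnegrE ?divr_ge0 ?sqr_ge0 ?(ltW e0)//.
  have p0 : 0 < 2 ^+ k * ep by rewrite mulr_gt0// exprn_gt0.
  rewrite ler_wpM2l ?(ltW e0)// lef_pV2 ?posrE ?exprn_gt0//; last exact: lt_le_trans xk.
  by rewrite lerXn2r ?nnegrE ?(ltW p0)// normc_ge0.
have mS := @measurable_Sd R d.
apply: (@le_trans _ _ (\int[sphere_measure R d]_(w in Sd) (\sum_(k < n.+1) (c k * \1_(E k) w)%:E))%E).
  apply: ge0_le_integral => //.
  - by move=> w _; rewrite lee_fin poisson_ge0// ltW.
  - apply/measurable_EFinP; apply: (measurable_funS measurableT) => //.
    apply: measurable_poisson => //.
    by apply: measurable_scale_fun => //; exact: cmeasurable_cst.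
  - apply: emeasurable_sum => k; apply/measurable_EFinP; apply: measurable_funM => //.
  - by move=> w w1; rewrite sumEFin lee_fin; exact: ptw.
rewrite ge0_integral_sum//; last 2 first.
- move=> k; apply/measurable_EFinP; exact: measurable_funM.
- by move=> k w _; rewrite lee_fin mulr_ge0.
apply: (@le_trans _ _ (\sum_(k < n.+1) (K * 2 ^+ d * 2^-1 ^+ k)%:E)%E).
  apply: lee_sum => k _.
  rewrite (eq_integral (fun w : Cn R d => (c k)%:E * (\1_(E k) w)%:E)%E); last by move=> w _; rewrite EFinM.
  rewrite ge0_integralZl//; [|exact/measurable_EFinP|by rewrite lee_fin].
  rewrite integral_indic//.
  have -> : E k `&` Sd = E k by apply/setIidl => w [].
  apply: (@le_trans _ _ ((c k)%:E * (K * (2 ^+ k.+1 * ep) ^+ d)%:E)%E).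
    rewrite lee_wpmul2l ?lee_fin//; apply: HK => //.
    by rewrite mulr_gt0// exprn_gt0.
  rewrite -EFinM lee_fin /c mulrCA -exprMn.
  have -> : ep / (2 ^+ k * ep) ^+ 2 * (2 ^+ k.+1 * ep) = 2 * 2^-1 ^+ k.
    rewrite (exprS 2 k) exprVn; have p0 : 2 ^+ k != 0 :> R by rewrite expf_neq0.
    by move: p0; set p := 2 ^+ k => p0; field; rewrite p0 gt_eqF.
  rewrite exprMn -mulrA ler_pM2l// ler_pM2l ?exprn_gt0//.
  by apply: exp_le_id => //; rewrite exprn_ge0//= exprn_ile1// invf_le1// ler1n.
rewrite sumEFin lee_fin -mulr_sumr ler_pM2l ?mulr_gt0 ?exprn_gt0//.
have -> : \sum_(k < n.+1) 2^-1 ^+ k = 2 - 2^-1 ^+ n :> R.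
  elim: (n) => [|m IH]; first by rewrite big_ord1 !expr0; ring.
  by rewrite big_ord_recr /= IH exprS; field.
by rewrite gerBl exprn_ge0.
Qed.

End poisson_kernel.

(** * Regularity of finite Borel measures *)

Section regularity.
Context (R : realType) (d : nat) (P : {finite_measure set (Cn R d) -> \bar R}).

Let approx (X : set (Cn R d)) := forall e : R, 0 < e -> exists F U : set 'rV[R[i]]_d,
  [/\ closed F, open U, F `<=` X, X `<=` U & (P (U `\` F) < e%:E)%E].

Let mopen (U : set 'rV[R[i]]_d) : open U -> measurable (U : set (Cn R d)).
Proof. exact: sub_sigma_algebra. Qed.

Let mclosed (F : set 'rV[R[i]]_d) : closed F -> measurable (F : set (Cn R d)).
Proof.
move=> cF; rewrite -[F]setCK; apply: measurableC; apply: mopen; exact: closed_openC.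
Qed.

Let approx_open (U : set 'rV[R[i]]_d) : open U -> approx U.
Proof.
move=> oU e e0.
pose F n : set 'rV[R[i]]_d := [set z | forall w : 'rV[R[i]]_d, (forall j, normc (w 0 j - z 0 j) < n.+1%:R^-1) -> U w].
have cF n : closed (F n).
  rewrite -[F n]setCK; apply: open_closedC; rewrite openE => z.
  rewrite /F /= => /existsNP[w /not_implyP[wz nU]]; apply/nbhs_CnP.
  have [m m0 mP] : exists2 m : R, 0 < m & forall j, normc (w 0 j - z 0 j) + m <= n.+1%:R^-1.
    have H (s : seq 'I_d) : exists2 m : R, 0 < m & forall j, j \in s -> normc (w 0 j - z 0 j) + m <= n.+1%:R^-1.
      elim: s => [|j s [m m0 mP]]; first by exists 1.
      exists (Num.min m (n.+1%:R^-1 - normc (w 0 j - z 0 j))); first by rewrite lt_min m0 subr_gt0 wz.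
      move=> k; rewrite inE => /orP[/eqP ->|ks].
        by rewrite -lerBrDl ge_min lexx orbT.
      by apply: le_trans (mP k ks); rewrite lerD2l ge_min lexx.
    by have [m m0 mP] := H (enum 'I_d); exists m => // j; apply: mP; rewrite mem_enum.
  exists m => // z' z'z H; apply: nU; apply: H => j.
  rewrite (le_lt_trans (normc_triangle (z 0 j) _ _))//; apply: lt_le_trans (mP j).
  by rewrite ltrD2l distcC.
have FU n : F n `<=` U by move=> z; apply => j; rewrite subrr normc0 invr_gt0.
have UF : U = \bigcup_n F n.
  apply/seteqP; split => [z Uz|z [n _ /FU]//].
  have : nbhs z U by rewrite nbhsE; exists U.
  move=> /nbhs_CnP[m m0 mP].
  have [n _ /(_ n (leqnn n)) nm] := @near_infty_natSinv_lt R (PosNum m0).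
  by exists n => // w wz; apply: mP => j; apply: lt_trans (wz j) nm.
have ndF : nondecreasing_seq F.
  move=> m n mn; apply/subsetPset => z Fz w wz; apply: Fz => j.
  by apply: lt_le_trans (wz j) _; rewrite lef_pV2 ?posrE// ler_nat.
have mF n : measurable (F n : set (Cn R d)) by exact: mclosed.
have mD n : measurable (U `\` F n : set (Cn R d)) by apply: measurableD => //; exact: mopen.
have cv : P \o (fun n => U `\` F n) @ \oo --> P (\bigcap_n (U `\` F n)).
  apply: nonincreasing_cvg_mu => //.
  - by rewrite -ge0_fin_numE// fin_num_measure.
  - exact: bigcap_measurableType.
  - move=> m n mn; apply/subsetPset => z [Uz nF]; split => // Fz; apply: nF.
    by move: z Fz {Uz}; exact/subsetPset/ndF.
have e0' : (\bigcap_n (U `\` F n)) = set0.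
  rewrite -subset0 => z H; have [Uz _] := H 0%N I.
  by move: Uz; rewrite UF => -[n _]; have [] := H n I.
rewrite e0' measure0 in cv.
have [n _ /(_ n (leqnn n)) nP] : \forall n \near \oo, (P (U `\` F n) < e%:E)%E.
  apply: (cv [set x | (x < e%:E)%E]); apply: open_nbhs_nbhs; split; last by rewrite /= lte_fin.
  exact: open_ereal_lt_ereal.
by exists (F n), U; split.
Qed.

Let approxC (X : set (Cn R d)) : approx X -> approx (~` X).
Proof.
move=> aX e e0; have [F [U [cF oU FX XU lt]]] := aX e e0.
exists (~` U), (~` F); split.
- exact: open_closedC.
- exact: closed_openC.
- exact: subsetC.
- exact: subsetC.
- by rewrite setDE setCK setIC -setDE.
Qed.

Let approx_bigcup (X : (set (Cn R d))^nat) :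
  (forall n, approx (X n)) -> approx (\bigcup_n X n).
Proof.
move=> aX e e0.
have H n : exists FU : set 'rV[R[i]]_d * set 'rV[R[i]]_d,
    [/\ closed FU.1, open FU.2, FU.1 `<=` X n, X n `<=` FU.2 &
    (P (FU.2 `\` FU.1) < (e / 2 / 2 ^+ n.+1)%:E)%E].
  have [|F [U HFU]] := aX n (e / 2 / 2 ^+ n.+1); first by rewrite !divr_gt0// exprn_gt0.
  by exists (F, U).
pose F n := (sval (cid (H n))).1; pose U n := (sval (cid (H n))).2.
have HFU n : [/\ closed (F n), open (U n), F n `<=` X n, X n `<=` U n &
    (P (U n `\` F n) < (e / 2 / 2 ^+ n.+1)%:E)%E].
  by rewrite /F /U; case: cid.
have mF n : measurable (F n : set (Cn R d)) by apply: mclosed; case: (HFU n).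
have mU n : measurable (U n : set (Cn R d)) by apply: mopen; case: (HFU n).
pose V := \bigcup_n U n.
pose G n := \big[setU/set0]_(k < n) F k.
have GF : \bigcup_n G n = \bigcup_n F n.
  apply/seteqP; split => z.
    by move=> [n _]; rewrite /G -bigcup_mkord => -[k _ Fk]; exists k.
  by move=> [n _ Fz]; exists n.+1 => //; rewrite /G -bigcup_mkord; exists n => //=.
have cG n : closed (G n).
  by rewrite /G; apply: closed_bigsetU => k _; case: (HFU k).
have oV : open V by apply: bigcup_open => n _; case: (HFU n).
have mV : measurable (V : set (Cn R d)) by exact: mopen.
have mG n : measurable (G n : set (Cn R d)) by exact: mclosed.
have mD n : measurable (V `\` G n : set (Cn R d)) by exact: measurableD.
have mB : measurable (V `\` \bigcup_n F n : set (Cn R d)).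
  by apply: measurableD => //; exact: bigcup_measurable.
have cv : P \o (fun n => V `\` G n) @ \oo --> P (\bigcap_n (V `\` G n)).
  apply: nonincreasing_cvg_mu => //.
  - by rewrite -ge0_fin_numE// fin_num_measure.
  - exact: bigcap_measurableType.
  - move=> m n mn; apply/subsetPset => z [Uz nF]; split => // Fz; apply: nF.
    by move: Fz; rewrite /G -!bigcup_mkord => -[k km Fk]; exists k => //=; exact: leq_trans km mn.
have E : \bigcap_n (V `\` G n) = V `\` \bigcup_n F n.
  rewrite -GF; apply/seteqP; split => [z Hz|z [Vz nG] n _].
    by have [Vz _] := Hz 0%N I; split => // -[n _]; have [] := Hz n I.
  by split => // Gz; apply: nG; exists n.
have lt : (P (V `\` \bigcup_n F n) < e%:E)%E.
  apply: (@le_lt_trans _ _ (P (\bigcup_n (U n `\` F n)))).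
    apply: le_measure; rewrite ?inE//.
      by apply: bigcup_measurable => n _; exact: measurableD.
    by move=> z [[n _ Uz] nF]; exists n => //; split => // Fz; apply: nF; exists n.
  apply: (@le_lt_trans _ _ (e / 2)%:E); last by rewrite lte_fin ltr_pdivrMr// ltr_pMr// ltr1n.
  apply: (@le_trans _ _ (\sum_(0 <= n <oo) P (U n `\` F n))%E).
    apply: measure_sigma_subadditive => //; first by move=> n; exact: measurableD.
    by apply: bigcup_measurable => n _; exact: measurableD.
  apply: (@le_trans _ _ (\sum_(0 <= n <oo) (e / 2 / 2 ^+ n.+1)%:E)%E).
    by apply: lee_nneseries => // n _; apply: ltW; case: (HFU n).
  have := @epsilon_trick0 R (e / 2) xpredT ltac:(by rewrite divr_ge0// ltW).
  apply: le_trans; apply: lee_nneseries => // n _; first by rewrite lee_fin !divr_ge0// ?ltW// exprn_ge0.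
  by rewrite natrX.
rewrite -E in lt.
have [n _ /(_ n (leqnn n)) nP] : \forall n \near \oo, (P (V `\` G n) < e%:E)%E.
  apply: (cv [set x | (x < e%:E)%E]); apply: open_nbhs_nbhs; split => //.
  exact: open_ereal_lt_ereal.
exists (G n), V; split => //.
  move=> z; rewrite /G -bigcup_mkord => -[k _ Fk]; exists k => //.
  by case: (HFU k) => _ _ + _ _; apply.
by move=> z [k _ Xz]; exists k => //; case: (HFU k) => _ _ _ + _; apply.
Qed.

(** The sets that can be squeezed between a closed and an open set of nearly equal measures
    form a sigma-algebra that contains the open sets. *)
Lemma closed_inner_regular (X : set (Cn R d)) (e : R) : measurable X -> 0 < e ->
  exists F : set 'rV[R[i]]_d, [/\ closed F, measurable (F : set (Cn R d)),
    F `<=` X & (P (X `\` F) < e%:E)%E].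
Proof.
move=> mX e0.
have aX : approx X.
  apply: (mX approx); split; last by move=> U /approx_open.
  split => //.
  - by apply: approx_open; exact: open0.
  - by move=> A aA; rewrite setTD; exact: approxC.
have [F [U [cF oU FX XU lt]]] := aX e e0.
exists F; split => //; first exact: mclosed.
apply: le_lt_trans lt; apply: le_measure; rewrite ?inE.
- by apply: measurableD => //; exact: mclosed.
- by apply: measurableD; [exact: mopen|exact: mclosed].
- exact: setSD.
Qed.

End regularity.

(** * Kernel functions as test functions *)

Section local_differentiability.
Context (K : numFieldType) (V W : normedModType K).

Lemma near_eq_differentiable (f g : V -> W) (x : V) :
  (\forall y \near x, f y = g y) -> differentiable f x -> differentiable g x.
Proof.
move=> fg df; have [cd /eqaddoP fo] := (diff_locallyP x f).1 df.
have fgx : f x = g x by exact: nbhs_singleton fg.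
have fg0 : \forall h \near (0 : V), f (h + x) = g (h + x).
  by move: fg; rewrite (near_shift 0); apply: filterS => h; rewrite /= subr0.
have go : g \o shift x = cst (g x) + 'd f x +o_ (0 : V) id.
  apply/eqaddoP => e e0; have := fo e e0.
  apply: filterS2 fg0 => h fgh.
  by rewrite -![(_ - _) _]/(_ - _) /= -fgx -fgh.
by apply/diff_locallyP; rewrite (diff_unique cd go).
Qed.

Lemma differentiable_expr (f : V -> K) (x : V) n :
  differentiable f x -> differentiable (fun y => f y ^+ n) x.
Proof.
move=> df; case: n => [|n]; first exact: differentiable_cst.
by have := differentiableX n df; rewrite exprfctE.
Qed.

Lemma differentiable_1sub (f : V -> K) (x : V) :
  differentiable f x -> differentiable (fun y => 1 - f y) x.
Proof.
move=> df; rewrite (_ : (fun _ => _) = cst 1 - f)//.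
apply: differentiableB => //; exact: differentiable_cst.
Qed.

End local_differentiability.

Section kernel_functions.
Context (R : realType) (d : nat).
Implicit Types (b : 'rV[R[i]]_d -> R[i]) (z w : 'rV[R[i]]_d).

Lemma differentiable_hdot w z : differentiable (fun y : 'rV[R[i]]_d => hdot y w) z.
Proof.
rewrite (_ : (fun y => _) = \sum_(j < d) (fun y : 'rV[R[i]]_d => y 0 j * (w 0 j)^*%C)).
  apply: differentiable_sum => j.
  apply: (@differentiableM _ _ (fun y : 'rV[R[i]]_d => y 0 j) (cst (w 0 j)^*%C)).
    exact: differentiable_coord.
  exact: differentiable_cst.
by apply/funext => y; rewrite fct_sumE.
Qed.

Lemma dbr_kernel_den z w : clBd z -> Bd w -> 1 - hdot z w != 0.
Proof.
move=> z1 w1; apply/eqP => h; have := Re_hdot_le z w.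
have -> : hdot z w = 1 by apply/esym/eqP; rewrite -subr_eq0 h.
have : enorm z ^+ 2 <= 1 by rewrite expr_le1// enorm_ge0.
have : enorm w ^+ 2 < 1 by rewrite expr_lt1// enorm_ge0.
by rewrite /=; clear; lra.
Qed.

Definition kernel_test b w z : R[i] := if z \in Bd then dbr_kernel b z w else 0.

Lemma holomorphic_kernel_test b w : holomorphic_Bd b -> Bd w ->
  holomorphic_Bd (kernel_test b w).
Proof.
move=> hb w1 z z1.
apply: (@near_eq_differentiable _ _ _ (fun y => dbr_kernel b y w)).
  have : nbhs z (Bd : set 'rV[R[i]]_d) by apply: open_nbhs_nbhs; split => //; exact: open_Bd.
  by apply: filterS => y y1; rewrite /kernel_test mem_set.
apply: (@differentiableM _ _ (fun y => 1 - b y * (b w)^*%C) (fun y => ((1 - hdot y w) ^+ d)^-1)).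
  apply: differentiable_1sub.
  apply: (@differentiableM _ _ b (cst (b w)^*%C)); first exact: hb.
  exact: differentiable_cst.
apply: differentiableV; last by rewrite expf_neq0// dbr_kernel_den// /clBd /= ltW.
apply: differentiable_expr.
apply: differentiable_1sub.
exact: differentiable_hdot.
Qed.

Lemma hdotZl (s : R[i]) z w : hdot (s *: z) w = s * hdot z w.
Proof. by rewrite /hdot mulr_sumr; apply: eq_bigr => j _; rewrite mxE mulrA. Qed.

(** The denominator does not vanish on the closed ball, so that the kernel function has a
    radial limit wherever b has one. *)
Lemma kernel_test_rlim b w z L : Sd z -> Bd w -> has_rlim b z L ->
  has_rlim (kernel_test b w) z ((1 - L * (b w)^*%C) / (1 - hdot z w) ^+ d).
Proof.
move=> z1 w1 bL.
have FF : Filter ((1 : R)^'-) by apply: at_left_proper_filter.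
have cr : r%:C @[r --> (1 : R)^'-] --> (1 : R[i]).
  apply/cvgrPdist_le => e; rewrite ltcE => /andP[/eqP /= ei /= e0]; near=> r.
  have r1 : r <= 1 by near: r; apply: nbhs_left_le.
  rewrite -(rmorph1 (@real_complex R)) -rmorphB normCE normc_real lecE /= ei eqxx /=.
  rewrite ger0_norm ?subr_ge0// lerBlDr -lerBlDl; near: r.
  by apply: nbhs_left_ge; rewrite ltrBlDr ltrDl.
have : (fun y => dbr_kernel b y w) (r%:C *: z) @[r --> (1 : R)^'-] -->
    (1 - L * (b w)^*%C) / (1 - hdot z w) ^+ d.
  rewrite /dbr_kernel; apply: cvgM.
    apply: cvgB; first exact: cvg_cst.
    by apply: cvgM; [exact/has_rlimP|exact: cvg_cst].
  apply: cvgV; first by rewrite expf_neq0// dbr_kernel_den// /clBd /= z1.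
  have ch : 1 - hdot (r%:C *: z) w @[r --> (1 : R)^'-] --> 1 - hdot z w.
    apply: cvgB; first exact: cvg_cst.
    rewrite (_ : (fun r : R => hdot (r%:C *: z) w) = (fun r : R => r%:C * hdot z w)); last first.
      by apply/funext => r; rewrite hdotZl.
    have : r%:C * hdot z w @[r --> (1 : R)^'-] --> 1 * hdot z w.
      by apply: cvgM; [exact: cr|exact: cvg_cst].
    by rewrite mul1r.
  suff H (n : nat) : (1 - hdot (r%:C *: z) w) ^+ n @[r --> (1 : R)^'-] --> (1 - hdot z w) ^+ n.
    exact: H.
  elim: n => [|n IH]; first by under eq_fun do rewrite expr0; rewrite expr0; exact: cvg_cst.
  rewrite exprS (_ : (fun r : R => _ ^+ n.+1) = (fun r : R => (1 - hdot (r%:C *: z) w) *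
    (1 - hdot (r%:C *: z) w) ^+ n)); last by apply/funext => r; rewrite exprS.
  by apply: cvgM; [exact: ch|exact: IH].
move=> /(@has_rlimP R d (fun y => dbr_kernel b y w) z) H e e0; have [de de0 {}H] := H e e0.
exists (Num.min 1 de); first by rewrite lt_min ltr01.
move=> r /andP[r1 r2].
have [m1 m2] : Num.min 1 de <= 1 /\ Num.min 1 de <= de by rewrite !ge_min !lexx orbT.
have r0 : 0 <= r < 1 by rewrite r2 andbT; move: r1 m1; clear; lra.
rewrite /kernel_test mem_set; last exact: radius_Bd.
by apply: H; rewrite r2 andbT; move: r1 m2; clear; lra.
Unshelve. all: by end_near. Qed.

Definition radial_points b : set (Cn R d) := Sd `&` radial_cauchy b.

(** A Borel function that agrees with [bd_extension] in the ball and at the points of the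
    sphere where the radial limit exists. *)
Definition bd_values b z : R[i] :=
  bd_restrict b z + (if (z : Cn R d) \in radial_points b then radial_lim b z else 0).

Lemma bd_values_Bd b z : Bd z -> bd_values b z = b z.
Proof.
move=> z1; rewrite /bd_values /bd_restrict ifT// memNset ?addr0// => -[] /= z2.
by move: z1; rewrite /Bd /= z2 ltxx.
Qed.

Lemma bd_values_rlim b z : bd_cts b -> radial_points b z -> has_rlim b z (bd_values b z).
Proof.
move=> cb [z1 zc]; have [L HL] := cauchy_rlim cb z1 zc.
rewrite /bd_values /bd_restrict z1 ltxx add0r mem_set//.
by rewrite (rlim_radial_lim HL).
Qed.

Lemma has_rlim_seq b z L : has_rlim b z L ->
  normc (b ((1 - n.+2%:R^-1)%:C *: z) - L) @[n --> \oo] --> (0 : R).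
Proof.
move=> H; apply/cvgrPdist_le => e e0; have [de de0 {}H] := H e e0.
near=> n; rewrite sub0r normrN ger0_norm ?normc_ge0//; apply: H.
rewrite [X in _ && X]ltrBlDr [X in _ && X]ltrDl invr_gt0 ltr0n andbT ltrD2l ltrN2.
apply: (@le_lt_trans _ _ n.+1%:R^-1); first by rewrite lef_pV2 ?posrE// ler_nat.
by near: n; exact: (near_infty_natSinv_lt (PosNum de0)).
Unshelve. all: by end_near. Qed.

Lemma radius_seq_in n : 0 < (n.+2%:R^-1 : R) <= 1.
Proof. by rewrite invr_gt0 ltr0n /= invf_le1// ler1n. Qed.

Lemma bd_values_le1 b z : bd_cts b -> (forall w, Bd w -> normc (b w) < 1) -> normc (bd_values b z) <= 1.
Proof.
move=> cb b1; have [zB|zB] := boolP (enorm z < 1).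
  by rewrite bd_values_Bd// ltW// b1.
have [zr|zr] := boolP ((z : Cn R d) \in radial_points b); last first.
  by rewrite /bd_values /bd_restrict (negbTE zB) (negbTE zr) addr0 normc0 ler01.
have {}zr : radial_points b z by move: zr; rewrite inE.
have H := bd_values_rlim cb zr; rewrite leNgt; apply/negP => lt.
have [de de0 {}H] := H ((normc (bd_values b z) - 1) / 2) ltac:(by rewrite divr_gt0// subr_gt0).
pose r := 1 - Num.min 1 de / 2.
have [m1 m2] : Num.min 1 de <= 1 /\ Num.min 1 de <= de by rewrite !ge_min !lexx orbT.
have m0 : 0 < Num.min 1 de by rewrite lt_min ltr01.
have r01 : 0 <= r < 1 by rewrite /r; apply/andP; split; move: m1 m0; clear; lra.
have rde : 1 - de < r < 1 by rewrite /r; apply/andP; split; move: m1 m2 m0; clear; lra.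
have bz := b1 _ (radius_Bd (zr.1 : Sd z) r01).
have := H r rde; rewrite -normcN opprB => le.
have := le_normcD (bd_values b z - b (r%:C *: z)) (b (r%:C *: z)); rewrite subrK.
by move: le bz lt; clear; lra.
Qed.

Lemma cmeasurable_bd_values b : bd_cts b -> cmeasurable (bd_values b : Cn R d -> R[i]).
Proof.
move=> cb; have mb := cmeasurable_bd_restrict cb.
have mr : measurable (radial_points b).
  by apply: measurableI; [exact: measurable_Sd|exact: measurable_radial_cauchy].
pose u (n : nat) (z : Cn R d) : R[i] := bd_restrict b z +
  (\1_(radial_points b) z : R)%:C * bd_restrict b ((1 - n.+2%:R^-1)%:C *: (z : 'rV[R[i]]_d)).
have mu n : cmeasurable (u n).
  apply: cmeasurableD => //; apply: cmeasurableM.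
    split => /=; last exact: measurable_cst.
    exact: measurable_indic.
  have ms : measurable_fun setT (fun z : Cn R d => (1 - n.+2%:R^-1 : R)%:C *: (z : 'rV[R[i]]_d) : Cn R d).
    by apply: measurable_scale_fun => //; exact: cmeasurable_cst.
  exact: (cmeasurable_comp mb ms).
have cu (z : Cn R d) : normc (u n z - bd_values b z) @[n --> \oo] --> (0 : R).
  have [zr|zr] := boolP (z \in radial_points b); last first.
    rewrite /u /bd_values indicE (negbTE zr) /=.
    rewrite (_ : (fun _ => _) = cst 0); first exact: cvg_cst.
    by apply/funext => n; rewrite /= mul0r subrr normc0.
  have zr' : radial_points b z by move: zr; rewrite inE.
  have := has_rlim_seq (bd_values_rlim cb zr').
  apply: cvg_trans; apply: near_eq_cvg; near=> n.
  have := radius_seq_in n => /andP[e0 e1].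
  rewrite /u indicE zr /= mul1r.
  have -> : bd_restrict b z = 0 by rewrite /bd_restrict zr'.1 ltxx.
  rewrite add0r /bd_restrict ifT//; apply: radius_Bd; first by case: zr'.
  by rewrite subr_ge0 e1 ltrBlDr ltrDl.
have H (g : R[i] -> R) : (forall u v : R[i], `|g u - g v| <= normc (u - v)) ->
    (forall n, measurable_fun setT (fun z : Cn R d => g (u n z))) ->
    measurable_fun [set: Cn R d] (fun z : Cn R d => g (bd_values b z)).
  move=> g1 mg; apply: (measurable_fun_cvg mg) => z _.
  apply/cvgrPdist_le => e e0; have /cvgrPdist_le/(_ e e0) := cu z.
  apply: filterS => n; rewrite sub0r normrN ger0_norm ?normc_ge0// => le.
  by rewrite distrC; apply: le_trans le.
split; apply: H.
- by move=> z w; apply: le_trans (normc_Re _); case: z w => [? ?] [].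
- by move=> n; case: (mu n).
- by move=> z w; apply: le_trans (normc_Im _); case: z w => [? ?] [].
- by move=> n; case: (mu n).
Unshelve. all: by end_near. Qed.

End kernel_functions.

Section outer_comparison.
Context dx (X : measurableType dx) (R : realType) (mu : {measure set X -> \bar R}).

(** The integral of a nonnegative function is a supremum over simple functions below it,
    hence it is monotone even when f is not measurable. This is the case of a function
    extended by arbitrary values where its radial limit does not exist. *)
Lemma ge0_integral_le_off_null (f : X -> \bar R) (h : X -> R) (N : set X) :
  (forall x, (0 <= f x)%E) -> (forall x, 0 <= h x) -> measurable_fun setT h ->
  measurable N -> mu N = 0%E -> (forall x, ~ N x -> (f x <= (h x)%:E)%E) ->
  (\int[mu]_x f x <= \int[mu]_x (h x)%:E)%E.
Proof.
move=> f0 h0 mh mN N0 fh.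
(* infinite on N, so that f <= g everywhere *)
pose g x := if x \in N then +oo%E else (h x)%:E.
have g0 x : (0 <= g x)%E by rewrite /g; case: ifP => // _; rewrite lee_fin.
have mg : measurable_fun setT g.
  apply: measurable_fun_ifT => //; last exact/measurable_EFinP.
  by apply: (measurable_fun_bool true); rewrite setTI (_ : _ @^-1` _ = N)//;
    apply/seteqP; split => x; [exact: set_mem|exact: mem_set].
apply: (@le_trans _ _ (\int[mu]_x g x)%E).
  rewrite !ge0_integralTE//; apply: ereal_sup_le => _ [s sf <-]; exists s => // x.
  apply: le_trans (sf x) _; rewrite /g; case: ifPn => [_|/negP]; first exact: leey.
  by rewrite inE => /fh.
rewrite le_eqVlt; apply/orP; left; apply/eqP; apply: ge0_ae_eq_integral => //.
- exact/measurable_EFinP.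
- by move=> x _; rewrite lee_fin.
exists N; split => // x /= /not_implyP[_ gh]; apply: contrapT => nN; apply: gh.
by rewrite /g memNset.
Qed.

End outer_comparison.

Section kernel_estimate.
Context (R : realType) (d : nat).
Implicit Types (b : 'rV[R[i]]_d -> R[i]) (z w : 'rV[R[i]]_d).

Lemma hdotzz w : hdot w w = (enorm w ^+ 2)%:C.
Proof.
rewrite sqr_enorm /hdot rmorph_sum; apply: eq_bigr => k _.
rewrite sqr_normcE; case: (w 0 k) => x y.
by apply/eqP; rewrite eq_complex /=; apply/andP; split; apply/eqP; ring.
Qed.

Lemma dbr_kernel_diag b w : dbr_kernel b w w =
  ((1 - normc (b w) ^+ 2) / (1 - enorm w ^+ 2) ^+ d)%:C.
Proof.
rewrite /dbr_kernel hdotzz.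
have -> : b w * (b w)^*%C = (normc (b w) ^+ 2)%:C.
  rewrite sqr_normcE; case: (b w) => x y.
  by apply/eqP; rewrite eq_complex /=; apply/andP; split; apply/eqP; ring.
have inv (x : R) : (x^-1)%:C = (x%:C)^-1.
  have [->|x0] := eqVneq x 0; first by rewrite !(invr0, rmorph0).
  by rewrite rmorphV// unitfE.
rewrite -!(rmorph1 (@real_complex R)) -!rmorphB -rmorphXn -inv -rmorphM.
by [].
Qed.

(** The reverse Carleson inequality for the kernel function at w, whose squared norm is its
    own value at w by the reproducing property. *)
Lemma kernel_norm_le (mu : {finite_measure set (Cn R d) -> \bar R}) b
    (Hb : rkhs Bd (dbr_kernel b)) (C : R) : mu (~` clBd) = 0%E ->
  admissible mu b -> 0 < C ->
  (forall f, rkhs_carrier Hb f -> admissible mu f ->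
    ((rkhs_norm Hb f)%:E <=
     C%:E * 'N[mu]_2%:E[(fun z : Cn R d => (normc (bd_extension f z))%:E)])%E) ->
  forall w, Bd w -> (((1 - normc (b w) ^+ 2) / (1 - enorm w ^+ 2) ^+ d)%:E <=
  (C ^+ 2)%:E * \int[mu]_z (normc (1 - bd_values b z * (b w)^*%C) ^+ 2 /
     normc (1 - hdot (z : 'rV[R[i]]_d) w) ^+ (2 * d))%:E)%E.
Proof.
move=> muB [hb rb] C0 HC w w1.
have cb := holomorphic_bd_cts hb.
pose F := kernel_test b w.
have cF : rkhs_carrier Hb F by exact: rkhs_kernel.
have aF : admissible mu F.
  split; first exact: holomorphic_kernel_test.
  have aeF : Filter (nbhs (almost_everywhere mu)) := ae_filter_ringOfSetsType mu.
  apply: filterS rb => z rz z1; have := radial_cvg_rlim (rz z1).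
  by move=> /(kernel_test_rlim z1 w1) /rlim_radial_cvg.
have := HC F cF aF.
rewrite /rkhs_norm -(rkhs_reproducing cF w1) {1}/F /kernel_test mem_set// dbr_kernel_diag /=.
set X := (1 - _) / _; set I := (\int[mu]_z _)%E; set Nm := ('N[mu]_2%:E[_])%E.
have I0 : (0 <= I)%E.
  by apply: integral_ge0 => z _; rewrite lee_fin mulr_ge0 ?sqr_ge0// invr_ge0 exprn_ge0// normc_ge0.
have NI : (Nm `^ 2 <= I)%E.
  rewrite /Nm poweR_Lnorm//.
  have mr : measurable (radial_points b).
    by apply: measurableI; [exact: measurable_Sd|exact: measurable_radial_cauchy].
  have mcl : measurable (~` clBd : set (Cn R d)).
    rewrite (_ : ~` clBd = (@enorm R d : Cn R d -> R) @^-1` `]1, +oo[%classic).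
      by rewrite -[X in measurable X]setTI; exact: (measurable_enorm measurableT).
    by apply/seteqP; split => z; rewrite /clBd /= in_itv/= andbT ltNge => /negP.
  apply: (@ge0_integral_le_off_null _ _ R mu _ (fun z : Cn R d => normc (1 - bd_values b z * (b w)^*%C) ^+ 2 /
     normc (1 - hdot (z : 'rV[R[i]]_d) w) ^+ (2 * d)) (~` clBd `|` (Sd `\` radial_points b))).
  - by move=> z; exact: poweR_ge0.
  - by move=> z; rewrite mulr_ge0 ?sqr_ge0// invr_ge0 exprn_ge0// normc_ge0.
  - apply: measurable_funM.
      apply: measurable_sqr_normc; apply: cmeasurableB; first exact: cmeasurable_cst.
      by apply: cmeasurableM; [exact: cmeasurable_bd_values|exact: cmeasurable_cst].
    apply: (measurableT_comp (@measurable_invr R)); apply: measurable_funX.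
    apply: measurable_normc; apply: cmeasurableB; first exact: cmeasurable_cst.
    by apply: cmeasurable_hdot.
  - apply: measurableU => //; apply: measurableD => //; exact: measurable_Sd.
  - apply: null_set_setU => //; first by apply: measurableD => //; exact: measurable_Sd.
    apply: measure_negligible; first by apply: measurableD => //; exact: measurable_Sd.
    have [N [mN N0 sN]] := rb; exists N; split => // z [z1 nz]; apply: sN => /= H; apply: nz.
    by split => //; exact: (rlim_cauchy z1 (radial_cvg_rlim (H z1))).
  - move=> z /not_orP[/contrapT zcl /not_andP zr].
    have -> : bd_extension F z = (1 - bd_values b z * (b w)^*%C) / (1 - hdot z w) ^+ d.
      rewrite /bd_extension; case: ifPn => [zB|zB].
        by rewrite /F /kernel_test mem_set// /dbr_kernel bd_values_Bd.
      have z1 : Sd z.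
        by apply/eqP; rewrite eq_le zcl /= leNgt.
      have {}zr : radial_points b z by case: zr => // /contrapT.
      exact/rlim_radial_lim/kernel_test_rlim/bd_values_rlim.
    rewrite gee0_abs ?lee_fin ?normc_ge0// powR_mulrn ?normc_ge0//.
    rewrite normcM normcV exprMn exprVn normcX -exprM mulnC.
    by [].
have N0 : (0 <= Nm)%E by exact: Lnorm_ge0.
move: N0 NI; case: Nm => [r| |]//.
  rewrite lee_fin poweR_EFin => r0; rewrite powR_mulrn// => NI.
  rewrite -EFinM lee_fin => le.
  apply: (@le_trans _ _ ((C ^+ 2)%:E * (r ^+ 2)%:E)%E); last by rewrite lee_pmul2l// lte_fin exprn_gt0.
  rewrite -EFinM lee_fin -exprMn.
  have [X0|X0] := leP 0 X; last by rewrite (le_trans (ltW X0))// sqr_ge0.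
  by rewrite -[leLHS](sqr_sqrtr X0) lerXn2r// nnegrE ?sqrtr_ge0// mulr_ge0// ltW.
move=> _; rewrite poweRyr// leye_eq => /eqP -> _.
by rewrite mulry gtr0_sg ?exprn_gt0// mul1e leey.
Qed.

(** [kernel_norm_le] at w = (1 - ep) z, where 1 - |w|^2 <= 2 ep. *)
Lemma poisson_test (mu : {finite_measure set (Cn R d) -> \bar R}) b
    (Hb : rkhs Bd (dbr_kernel b)) : mu (~` clBd) = 0%E ->
  (forall w, Bd w -> normc (b w) < 1) ->
  admissible mu b -> reverse_carleson Hb mu ->
  exists2 C : R, 0 < C & forall ep z, 0 < ep <= 1 -> Sd z ->
  ((1 - normc (b ((1 - ep)%:C *: z)) ^+ 2)%:E <= C%:E *
   \int[mu]_x (normc (1 - bd_values b x * (b ((1 - ep)%:C *: z))^*%C) ^+ 2 *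
     poisson ep (x : 'rV[R[i]]_d) ((1 - ep)%:C *: z))%:E)%E.
Proof.
move=> muB b1 bad [C C0 HC]; exists (C ^+ 2 * 2 ^+ d); first by rewrite mulr_gt0 ?exprn_gt0.
move=> ep z /andP[e0 e1] z1; set w := _ *: z.
have w1 : Bd w by apply: radius_Bd => //; rewrite subr_ge0 e1 ltrBlDr ltrDl.
have cb := holomorphic_bd_cts bad.1.
pose h (x : Cn R d) : R := normc (1 - bd_values b x * (b w)^*%C) ^+ 2 /
  normc (1 - hdot (x : 'rV[R[i]]_d) w) ^+ (2 * d).
have le : (((1 - normc (b w) ^+ 2) / (1 - enorm w ^+ 2) ^+ d)%:E <=
  (C ^+ 2)%:E * \int[mu]_x (h x)%:E)%E := kernel_norm_le muB bad C0 HC w1.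
have mh : measurable_fun setT h.
  apply: measurable_funM.
    apply: measurable_sqr_normc; apply: cmeasurableB; first exact: cmeasurable_cst.
    by apply: cmeasurableM; [exact: cmeasurable_bd_values|exact: cmeasurable_cst].
  apply: (measurableT_comp (@measurable_invr R)); apply: measurable_funX.
  apply: measurable_normc; apply: cmeasurableB; first exact: cmeasurable_cst.
  by apply: cmeasurable_hdot.
have h0 x : 0 <= h x by rewrite mulr_ge0 ?sqr_ge0// invr_ge0 exprn_ge0// normc_ge0.
have e2 : 0 < (2 * ep) ^+ d by rewrite exprn_gt0// mulr_gt0.
rewrite (eq_integral (fun x : Cn R d => ((ep ^+ d)%:E * (h x)%:E)%E)); last first.
  move=> x _; rewrite -EFinM /h /poisson exprMn exprVn -exprM; congr (_%:E).
  by rewrite mulrCA.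
rewrite ge0_integralZl//; last 3 first.
- exact/measurable_EFinP.
- by move=> x _; rewrite lee_fin.
- by rewrite lee_fin exprn_ge0// ltW.
rewrite muleA -EFinM (_ : C ^+ 2 * 2 ^+ d * ep ^+ d = (2 * ep) ^+ d * C ^+ 2); last first.
  by rewrite exprMn; ring.
rewrite EFinM -muleA; apply: le_trans (lee_wpmul2l _ le); last by rewrite lee_fin ltW.
rewrite -EFinM lee_fin.
have w2 : 1 - enorm w ^+ 2 = 1 - (1 - ep) ^+ 2.
  by rewrite /w enormZ z1 mulr1 normc_real ger0_norm// subr_ge0.
have a0 : 0 < 1 - enorm w ^+ 2 by rewrite w2; move: e0 e1; clear; nra.
have a1 : 1 - enorm w ^+ 2 <= 2 * ep by rewrite w2; move: e0 e1; clear; nra.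
rewrite mulrCA ler_peMr//.
  by rewrite subr_ge0 expr_le1// ?normc_ge0// ltW// b1.
rewrite ler_pdivlMr ?exprn_gt0// mul1r lerXn2r ?nnegrE ?(ltW a0)//.
by rewrite mulr_ge0// ltW.
Qed.

End kernel_estimate.

(** * Averages over a closed subset of the sphere *)

Section unit_disk.
Context (R : realType).

Lemma sqr_1sub_le4 (a c : R[i]) : normc a <= 1 -> normc c <= 1 -> normc (1 - a * c^*%C) ^+ 2 <= 4.
Proof.
move=> a1 c1; have : normc (1 - a * c^*%C) <= 2.
  rewrite (le_trans (normcB_le _ _))// normc1 (_ : 2 = 1 + 1 :> R)// lerD2l.
  by rewrite normcM normc_conj -[leRHS]mulr1 ler_pM ?normc_ge0.
have := normc_ge0 (1 - a * c^*%C); nra.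
Qed.

(** Write 1 - a c^* = (1 - |a|^2) + a (a - c)^*. *)
Lemma sqr_1sub_near (a c : R[i]) (e : R) : normc a <= 1 -> normc (a - c) <= e ->
  normc (1 - a * c^*%C) ^+ 2 <= 2 * (1 - normc a ^+ 2) ^+ 2 + 2 * e ^+ 2.
Proof.
move=> a1 ac.
have -> : 1 - a * c^*%C = (1 - normc a ^+ 2)%:C + a * (a - c)^*%C.
  rewrite sqr_normcE; case: a c {a1 ac} => [x y] [x' y'].
  by apply/eqP; rewrite eq_complex /=; apply/andP; split; apply/eqP; ring.
have h := le_normcD (1 - normc a ^+ 2)%:C (a * (a - c)^*%C).
have n0 : 0 <= 1 - normc a ^+ 2 by rewrite subr_ge0 expr_le1// normc_ge0.
have h2 : normc (a * (a - c)^*%C) <= e.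
  rewrite normcM normc_conj -[leRHS]mul1r ler_pM ?normc_ge0//.
rewrite normc_real ger0_norm// in h.
have := normc_ge0 ((1 - normc a ^+ 2)%:C + a * (a - c)^*%C).
have := normc_ge0 (a * (a - c)^*%C).
move: h h2 n0; move: (1 - _) (normc (a * _)) (normc (_ + _)) => p q r; clear => h h2 p0 q0 r0.
have : r ^+ 2 <= (p + q) ^+ 2 by rewrite lerXn2r ?nnegrE ?addr_ge0.
have : q ^+ 2 <= e ^+ 2 by rewrite lerXn2r ?nnegrE// (le_trans q0).
have := sqr_ge0 (p - q); nra.
Qed.

End unit_disk.

Lemma measurable_clBd (R : realType) (d : nat) : measurable (clBd : set (Cn R d)).
Proof.
rewrite (_ : clBd = (@enorm R d : Cn R d -> R) @^-1` `]-oo, 1]%classic).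
  by rewrite -[X in measurable X]setTI; exact: (measurable_enorm measurableT).
by apply/seteqP; split => z; rewrite /clBd /= in_itv.
Qed.

Section poisson_averages.
Context (R : realType) (d : nat).
Hypothesis d0 : (0 < d)%N.
Variables (b : 'rV[R[i]]_d -> R[i]) (A : set (Cn R d)).
Implicit Types z w : 'rV[R[i]]_d.
Hypothesis cb : bd_cts b.
Hypothesis b1 : forall w, Bd w -> normc (b w) < 1.
Hypothesis mA : measurable A.
Hypothesis cA : closed (A : set 'rV[R[i]]_d).
Hypothesis Ar : A `<=` radial_points b.
Local Notation ep n := (n.+2%:R^-1 : R).
Local Notation "'shrink' n z" := ((1 - ep n)%:C *: (z : 'rV[R[i]]_d)) (at level 10, n at level 8, z at level 8).
(** The radii 1 - 1 / (n + 2) tend to 1; b converges uniformly to its radial limits along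
    them. Uniformity makes the radial limits continuous on A. *)
Hypothesis uA : forall e : R, 0 < e -> exists N, forall n z, (N <= n)%N -> A z ->
  normc (b (shrink n z) - bd_values b z) <= e.
Local Notation sigma := (sphere_measure R d).

Let A1 z : A z -> Sd z. Proof. by move=> /Ar[]. Qed.

Let shrinkB n z : A z -> Bd (shrink n z).
Proof.
move=> /A1 z1; apply: radius_Bd => //; have /andP[e0 e1] := @radius_seq_in R n.
by rewrite subr_ge0 e1 ltrBlDr ltrDl.
Qed.

Let clA z : A z -> clBd z. Proof. by move=> /A1 z1; rewrite /clBd /= z1. Qed.

Let bd_values_cts z (e : R) : A z -> 0 < e -> exists2 de : R, 0 < de &
  forall w, A w -> (forall j, normc (w 0 j - z 0 j) < de) ->
  normc (bd_values b z - bd_values b w) <= e.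
Proof.
move=> Az e0; have [N HN] := uA (ltac:(by rewrite divr_gt0) : 0 < e / 3).
have [de de0 Hde] := cb (shrinkB N Az) (ltac:(by rewrite divr_gt0) : 0 < e / 3).
exists de => // w Aw wz; have h1 := HN N z (leqnn N) Az; have h2 := HN N w (leqnn N) Aw.
have h3 : normc (b (shrink N w) - b (shrink N z)) < e / 3.
  apply: Hde => j; rewrite !mxE -mulrBr normcM; apply: le_lt_trans (wz j).
  have /andP[e1 e2] := @radius_seq_in R N.
  rewrite -[leRHS]mul1r ler_wpM2r ?normc_ge0// normc_real ger0_norm ?subr_ge0//.
rewrite (le_trans (normc_triangle (b (shrink N z)) _ _))//.
have := normc_triangle (b (shrink N w)) (b (shrink N z)) (bd_values b w).
have := h1; rewrite distcC; have := h3; rewrite distcC; move: h2; lra.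
Qed.

(** For w in A, a value of Re <z, w> close to 1 means that w is close to z. This excludes z
    outside the closed set A, and for z in A the continuity of the radial limits applies. *)
Let separation z (e : R) : clBd z -> 0 < e -> exists2 de : R, 0 < de <= 1 &
  exists N, forall n w, (N <= n)%N -> A w -> 1 - de < complex.Re (hdot z w) ->
  A z /\ normc (bd_values b z - b (shrink n w)) <= e.
Proof.
move=> z1 e0.
have close (rho : R) : 0 < rho -> exists2 de : R, 0 < de <= 1 & forall w, A w ->
    1 - de < complex.Re (hdot z w) -> forall j, normc (w 0 j - z 0 j) < rho.
  move=> r0; exists (Num.min 1 (rho ^+ 2 / 2)).
    by rewrite lt_min ltr01 divr_gt0 ?exprn_gt0// ge_min lexx.
  move=> w Aw h j.
  have m : Num.min 1 (rho ^+ 2 / 2) <= rho ^+ 2 / 2 by rewrite ge_min lexx orbT.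
  have := dist_hdot z1 (clA Aw); rewrite (bigD1 j)//= => le.
  have s0 : 0 <= \sum_(i < d | i != j) normc (w 0 i - z 0 i) ^+ 2.
    by apply: sumr_ge0 => i _; exact: sqr_ge0.
  rewrite -(ltr_pXn2r (n := 2)) ?nnegrE ?normc_ge0 ?(ltW r0)//.
  by move: le s0 h m; lra.
have [Az|nAz] := pselect (A z).
  have e2 : 0 < e / 2 by rewrite divr_gt0.
  have [rho r0 Hr] := bd_values_cts Az e2; have [de dein Hde] := close _ r0.
  have [N HN] := uA e2; exists de => //; exists N => n w Nn Aw h; split => //.
  have := Hr w Aw (Hde w Aw h); have := HN n w Nn Aw; rewrite distcC.
  have := normc_triangle (bd_values b w) (bd_values b z) (b (shrink n w)).
  by lra.
have : nbhs z (~` A : set 'rV[R[i]]_d) by apply: open_nbhs_nbhs; split => //; exact: closed_openC.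
move=> /nbhs_CnP[rho r0 Hr]; have [de dein Hde] := close _ r0.
exists de => //; exists 0%N => n w _ Aw h; exfalso; exact: (Hr w (Hde w Aw h)).
Qed.

(** The integrand of the kernel estimate, cut off to z in the closed ball and w in A. *)
Definition poisson_fun n (z w : Cn R d) : R := \1_clBd z * \1_A w *
  (normc (1 - bd_values b z * (bd_restrict b (shrink n w))^*%C) ^+ 2 *
   poisson (ep n) (z : 'rV[R[i]]_d) (shrink n w)).

Lemma poisson_fun_ge0 n z w : 0 <= poisson_fun n z w.
Proof.
by apply: mulr_ge0; apply: mulr_ge0 => //; [exact: sqr_ge0|exact: poisson_ge0].
Qed.

Lemma poisson_funE n z w : clBd z -> A w -> poisson_fun n z w =
  normc (1 - bd_values b z * (b (shrink n w))^*%C) ^+ 2 *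
  poisson (ep n) (z : 'rV[R[i]]_d) (shrink n w).
Proof.
move=> z1 Aw; rewrite /poisson_fun !indicE !mem_set// !mul1r.
by rewrite /bd_restrict (shrinkB n Aw : enorm _ < 1).
Qed.

Lemma measurable_poisson_fun n :
  measurable_fun setT (fun p : Cn R d * Cn R d => poisson_fun n p.1 p.2).
Proof.
have m1 : measurable_fun setT (fun p : Cn R d * Cn R d => p.1) by exact: measurable_fst.
have m2 : measurable_fun setT (fun p : Cn R d * Cn R d => p.2) by exact: measurable_snd.
have ms : measurable_fun setT (fun p : Cn R d * Cn R d => (shrink n p.2 : Cn R d)).
  by apply: measurable_scale_fun => //; exact: cmeasurable_cst.
apply: measurable_funM.
  apply: measurable_funM.
    by apply: (measurableT_comp _ m1); apply: measurable_indic; exact: measurable_clBd.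
  by apply: (measurableT_comp _ m2); exact: measurable_indic.
apply: measurable_funM; last exact: measurable_poisson.
apply: measurable_sqr_normc; apply: cmeasurableB; first exact: cmeasurable_cst.
apply: cmeasurableM.
  exact: (cmeasurable_comp (cmeasurable_bd_values cb) m1).
apply: cmeasurable_conj; exact: (cmeasurable_comp (cmeasurable_bd_restrict cb) ms).
Qed.

Lemma poisson_fun_le4 n z w : clBd z -> poisson_fun n z w <= 4 * poisson (ep n) z (shrink n w).
Proof.
move=> z1; have P0 : 0 <= poisson (ep n) z (shrink n w) by rewrite poisson_ge0.
have [Aw|nAw] := pselect (A w).
  rewrite poisson_funE// ler_wpM2r// sqr_1sub_le4 ?bd_values_le1// ltW// b1//.
  exact: shrinkB.
by rewrite /poisson_fun [\1_A (w : Cn R d)]indicE memNset// mulr0 !mul0r mulr_ge0.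
Qed.

(** The first term bounds the contribution of the w close to z, and the second one that of
    all others, where the Poisson kernel is small. *)
Lemma poisson_fun_near z (e : R) : clBd z -> 0 < e -> exists2 de : R, 0 < de <= 1 &
  exists N, forall n w, (N <= n)%N ->
  poisson_fun n z w <= (\1_A (z : Cn R d) * (2 * (1 - normc (bd_values b z) ^+ 2) ^+ 2) + 2 * e ^+ 2) *
    poisson (ep n) z (shrink n w) + 4 * (ep n / de ^+ 2) ^+ d.
Proof.
move=> z1 e0; have [de dein [N HN]] := separation z1 e0; exists de => //; exists N => n w Nn.
have P0 : 0 <= poisson (ep n) z (shrink n w) by rewrite poisson_ge0.
have t0 : 0 <= 4 * (ep n / de ^+ 2) ^+ d by rewrite mulr_ge0// exprn_ge0// divr_ge0// sqr_ge0.
have s0 : 0 <= (\1_A (z : Cn R d) * (2 * (1 - normc (bd_values b z) ^+ 2) ^+ 2) + 2 * e ^+ 2) *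
    poisson (ep n) z (shrink n w).
  apply: mulr_ge0 => //; apply: addr_ge0; apply: mulr_ge0 => //; last exact: sqr_ge0.
  by apply: mulr_ge0 => //; exact: sqr_ge0.
have [Aw|nAw] := pselect (A w); last first.
  by rewrite /poisson_fun [\1_A (w : Cn R d)]indicE memNset// mulr0 !mul0r addr_ge0.
have [far|near] := leP (complex.Re (hdot z w)) (1 - de).
  apply: (@le_trans _ _ (4 * (ep n / de ^+ 2) ^+ d)); last by rewrite lerDr.
  apply: le_trans (poisson_fun_le4 _ _ z1) _; rewrite ler_pM2l//.
  by apply: poisson_far => //; exact: radius_seq_in.
have [Az le] := HN n w Nn Aw near.
rewrite poisson_funE// indicE mem_set// mul1r -[leLHS]addr0 lerD// ler_wpM2r//.
by apply: sqr_1sub_near => //; exact: bd_values_le1.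
Qed.

Variable (mu : {finite_measure set (Cn R d) -> \bar R}) (M C : R).
Hypothesis mu_clBd : mu (~` clBd) = 0%E.
Hypothesis M0 : 0 < M.
Hypothesis poissonM : forall ep x, 0 < ep <= 1 -> clBd x ->
  (\int[sigma]_(y in (Sd : set (Cn R d))) (poisson ep x ((1 - ep)%:C *: (y : 'rV[R[i]]_d)))%:E <= M%:E)%E.
Hypothesis C0 : 0 < C.
Hypothesis testC : forall ep x, 0 < ep <= 1 -> Sd x ->
  ((1 - normc (b ((1 - ep)%:C *: x)) ^+ 2)%:E <= C%:E *
   \int[mu]_v (normc (1 - bd_values b v * (b ((1 - ep)%:C *: x))^*%C) ^+ 2 *
     poisson ep (v : 'rV[R[i]]_d) ((1 - ep)%:C *: x))%:E)%E.

Let mS := @measurable_Sd R d.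

Let I n (x : Cn R d) : \bar R := (\int[sigma]_y (poisson_fun n x y)%:E)%E.

Let I_ge0 n (x : Cn R d) : (0 <= I n x)%E.
Proof. by apply: integral_ge0 => y _; rewrite lee_fin poisson_fun_ge0. Qed.

Let I_Sd n (x : Cn R d) : I n x = (\int[sigma]_(y in (Sd : set (Cn R d))) (poisson_fun n x y)%:E)%E.
Proof.
rewrite [RHS]integral_mkcond; apply: eq_integral => y _; rewrite patchE.
case: ifPn => // /negP wS; rewrite /poisson_fun [\1_A y]indicE memNset ?mulr0 ?mul0r//.
by move=> /A1 w1; apply: wS; rewrite inE.
Qed.

Let mpf n (x : Cn R d) : measurable_fun setT (fun y : Cn R d => poisson_fun n x y).
Proof.
have mp : measurable_fun setT (fun y : Cn R d => (x, y) : Cn R d * Cn R d).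
  exact: pair1_measurable.
exact: (measurableT_comp (measurable_poisson_fun n) mp).
Qed.

Let mpo n (x : 'rV[R[i]]_d) : measurable_fun (Sd : set (Cn R d)) (fun y : Cn R d => poisson (ep n) x (shrink n y)).
Proof.
apply: (measurable_funS measurableT) => //; apply: measurable_poisson => //.
by apply: measurable_scale_fun => //; exact: cmeasurable_cst.
Qed.

(** Integration over w of a bound of the kind provided by [poisson_fun_near]. *)
Let I_le n (x : 'rV[R[i]]_d) (c t : R) : clBd x -> 0 <= c -> 0 <= t ->
  (forall y, poisson_fun n x y <= c * poisson (ep n) x (shrink n y) + t) ->
  (I n x <= (c * M + t)%:E)%E.
Proof.
move=> z1 cp tp H; rewrite I_Sd.
apply: (@le_trans _ _ (\int[sigma]_(y in (Sd : set (Cn R d)))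
   (c%:E * (poisson (ep n) x (shrink n (y : 'rV[R[i]]_d)))%:E + t%:E))%E).
  apply: ge0_le_integral => //.
  - by move=> y _; rewrite lee_fin poisson_fun_ge0.
  - by apply/measurable_EFinP; apply: (measurable_funS measurableT).
  - apply/measurable_EFinP; apply: measurable_funD => //; exact: measurable_funM.
  - by move=> y _; rewrite -EFinM -EFinD lee_fin.
have P0 (y : Cn R d) : (0 <= (poisson (ep n) x (shrink n y))%:E)%E by rewrite lee_fin poisson_ge0.
rewrite ge0_integralD//; last 2 first.
- by move=> y _; rewrite mule_ge0.
- by apply/measurable_EFinP; apply: measurable_funM => //; exact: mpo.
rewrite EFinD leeD//.
  rewrite ge0_integralZl//; last by apply/measurable_EFinP; exact: mpo.
  rewrite EFinM lee_wpmul2l//; apply: poissonM => //; exact: radius_seq_in.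
rewrite integral_cst// -[leRHS]mule1 lee_wpmul2l//.
exact: (@probability_le1 _ _ R sigma).
Qed.

Let I_off n (x : Cn R d) : ~ clBd x -> I n x = 0%E.
Proof.
move=> z1; rewrite /I integral0_eq// => y _.
by rewrite /poisson_fun [\1_clBd (x : Cn R d)]indicE memNset// !mul0r.
Qed.

Let I_le4 n (x : Cn R d) : (I n x <= (4 * M)%:E)%E.
Proof.
have [z1|z1] := pselect (clBd x); last by rewrite I_off// lee_fin mulr_ge0// ltW.
have := @I_le n x 4 0 z1 ltac:(by []) ltac:(by []); rewrite addr0; apply => y.
by rewrite addr0 poisson_fun_le4.
Qed.

Let J n (x : Cn R d) : R := fine (I n x).

Let JE n x : I n x = (J n x)%:E.
Proof.
rewrite /J fineK// ge0_fin_numE//; apply: le_lt_trans (I_le4 _ _) _; exact: ltry.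
Qed.

Let mI n : measurable_fun setT (I n).
Proof.
have := @measurable_fun_fubini_tonelli_F _ _ _ _ R sigma
  (fun p : Cn R d * Cn R d => (poisson_fun n p.1 p.2)%:E).
apply; first by apply/measurable_EFinP; exact: measurable_poisson_fun.
by move=> p; rewrite lee_fin poisson_fun_ge0.
Qed.

Let mJ n : measurable_fun setT (J n).
Proof.
by apply/measurable_EFinP; rewrite (_ : _ \o _ = I n)//; apply/funext => x; rewrite JE.
Qed.

(** An upper bound of the limits of the averages I n x. *)
Let G (x : Cn R d) : R := \1_A x * (2 * (1 - normc (bd_values b x) ^+ 2) ^+ 2 * M).

Let G0 x : 0 <= G x.
Proof.
apply: mulr_ge0 => //; apply: mulr_ge0; last exact: ltW.
by apply: mulr_ge0 => //; exact: sqr_ge0.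
Qed.

Let mphi : measurable_fun setT (fun x : Cn R d => 1 - normc (bd_values b x) ^+ 2).
Proof.
by apply: measurable_funB => //; apply: measurable_sqr_normc; exact: cmeasurable_bd_values.
Qed.

Let mG : measurable_fun setT G.
Proof.
apply: measurable_funM; first exact: measurable_indic.
by apply: measurable_funM => //; apply: measurable_funM => //; exact: measurable_funX.
Qed.

(** The excess of the averages over their expected bound: it tends to 0 and is bounded, so
    that its integral tends to 0. *)
Let u n (x : Cn R d) : R := Num.max (J n x - G x) 0.

Let mun n : measurable_fun setT (u n).
Proof. by apply: measurable_maxr => //; exact: measurable_funB. Qed.

Let u_cvg (x : Cn R d) : u ^~ x @ \oo --> (0 : R).
Proof.
apply/cvgrPdist_le => e e0.
have u0 n : 0 <= u n x by rewrite /u le_max lexx orbT.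
have [z1|z1] := pselect (clBd x); last first.
  near=> n; rewrite sub0r normrN ger0_norm// /u /J I_off// ge_max (ltW e0) andbT.
  by rewrite (le_trans _ (ltW e0))// subr_le0 /= G0.
pose e1 := Num.min 1 (e / (4 * M)).
have M4 : 0 < 4 * M by rewrite mulr_gt0.
have e10 : 0 < e1 by rewrite lt_min ltr01 divr_gt0.
have e1e : 2 * e1 ^+ 2 * M <= e / 2.
  have h1 : e1 <= 1 by rewrite ge_min lexx.
  have h2 : e1 * (4 * M) <= e by rewrite -ler_pdivlMr// ge_min lexx orbT.
  have : e1 ^+ 2 * M <= e1 * M by rewrite ler_pM2r// expr2 ler_piMl// ltW.
  by move: h2; lra.
have [de /andP[de0 de1] [N HN]] := poisson_fun_near z1 e10.
have d2 : 0 < de ^+ 2 by rewrite exprn_gt0.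
near=> n.
have Nn : (N <= n)%N by near: n; exact: nbhs_infty_ge.
have [h1 h2] : ep n / de ^+ 2 <= 1 /\ 4 * (ep n / de ^+ 2) <= e / 2.
  have en : ep n <= Num.min (de ^+ 2) (e * de ^+ 2 / 8).
    near: n; have m0 : 0 < Num.min (de ^+ 2) (e * de ^+ 2 / 8).
      by rewrite lt_min d2 divr_gt0// mulr_gt0.
    have [k _ Hk] := @near_infty_natSinv_lt R (PosNum m0); exists k => // n kn.
    by apply: ltW; apply: (Hk n.+1); exact: leqW.
  split; first by rewrite ler_pdivrMr// mul1r (le_trans en)// ge_min lexx.
  rewrite mulrA ler_pdivrMr//.
  have h8 : ep n <= e * de ^+ 2 / 8 by rewrite (le_trans en)// ge_min lexx orbT.
  apply: (@le_trans _ _ (4 * (e * de ^+ 2 / 8))); first by rewrite ler_pM2l.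
  by rewrite [leLHS](_ : _ = e / 2 * de ^+ 2)//; field.
have p0 : 0 <= ep n / de ^+ 2 by rewrite divr_ge0// ltW.
have h3 : (ep n / de ^+ 2) ^+ d <= ep n / de ^+ 2 by apply: exp_le_id => //; rewrite p0.
rewrite sub0r normrN ger0_norm// /u ge_max (ltW e0) andbT.
have := @I_le n x (\1_A (x : Cn R d) * (2 * (1 - normc (bd_values b x) ^+ 2) ^+ 2) + 2 * e1 ^+ 2)
  (4 * (ep n / de ^+ 2) ^+ d) z1.
have a0 : 0 <= \1_A (x : Cn R d) * (2 * (1 - normc (bd_values b x) ^+ 2) ^+ 2) + 2 * e1 ^+ 2.
  apply: addr_ge0; apply: mulr_ge0 => //; last exact: sqr_ge0.
  by apply: mulr_ge0 => //; exact: sqr_ge0.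
have t0 : 0 <= 4 * (ep n / de ^+ 2) ^+ d by rewrite mulr_ge0// exprn_ge0.
move=> /(_ a0 t0 (fun y => HN n y Nn)); rewrite JE lee_fin => le.
rewrite lerBlDr; apply: le_trans le _; rewrite mulrDl -addrA addrC.
apply: lerD; last by rewrite /G !mulrA.
have h4 : 4 * (ep n / de ^+ 2) ^+ d <= e / 2 by apply: le_trans h2; rewrite ler_pM2l.
by rewrite [leRHS]splitr; exact: lerD.
Unshelve. all: by end_near. Qed.

Let int_u : (\int[mu]_x (u n x)%:E)%E @[n --> \oo] --> 0%E.
Proof.
have := @dominated_convergence _ _ R mu setT measurableT
  (fun n x => (u n x)%:E) (cst 0%E) (EFin \o cst (4 * M)).
case.
- by move=> n; exact/measurable_EFinP.
- exact: measurable_cst.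
- by apply: aeW => x _; apply: cvg_EFin; [exact: nearW|exact: u_cvg].
- exact: finite_measure_integrable_cst.
- apply: aeW => x n _; rewrite /= lee_fin ger0_norm; last by rewrite /u le_max lexx orbT.
  rewrite /u ge_max mulr_ge0 ?(ltW M0)// andbT lerBlDr.
  by rewrite (le_trans (_ : _ <= 4 * M))// ?lerDl// -lee_fin -JE I_le4.
by move=> _ _; rewrite integral0.
Qed.

Let J_le n (x : Cn R d) : (I n x <= (G x)%:E + (u n x)%:E)%E.
Proof. by rewrite JE -EFinD lee_fin -lerBlDl /u le_max lexx. Qed.

Let phi n (y : Cn R d) := 1 - normc (b (shrink n y)) ^+ 2.

Let mphin n : measurable_fun A (phi n).
Proof.
have ms : measurable_fun setT (fun y : Cn R d => (shrink n y : Cn R d)).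
  by apply: measurable_scale_fun => //; exact: cmeasurable_cst.
have : measurable_fun A (fun y : Cn R d => 1 - normc (bd_restrict b (shrink n y)) ^+ 2).
  apply: (measurable_funS measurableT) => //; apply: measurable_funB => //.
  apply: measurable_sqr_normc; exact: (cmeasurable_comp (cmeasurable_bd_restrict cb) ms).
apply: eq_measurable_fun => y; rewrite inE => Aw.
by rewrite /phi /bd_restrict (shrinkB n Aw : enorm _ < 1).
Qed.

(** Integrate the kernel estimate over w in A, and exchange the integrals. *)
Let phi_le n : (\int[sigma]_(y in A) (phi n y)%:E <= C%:E * \int[mu]_x I n x)%E.
Proof.
have mp : measurable_fun setT (fun p : Cn R d * Cn R d => (poisson_fun n p.1 p.2)%:E).
  by apply/measurable_EFinP; exact: measurable_poisson_fun.
have p0 (p : Cn R d * Cn R d) : (0 <= (poisson_fun n p.1 p.2)%:E)%E by rewrite lee_fin poisson_fun_ge0.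
rewrite (fubini_tonelli (m1 := mu) (m2 := sigma) _ mp p0).
have m2 : measurable_fun setT (fun y : Cn R d => \int[mu]_v (poisson_fun n v y)%:E)%E.
  exact: (@measurable_fun_fubini_tonelli_G _ _ _ _ R mu _ mp p0).
have g0 y : (0 <= \int[mu]_v (poisson_fun n v y)%:E)%E.
  by apply: integral_ge0 => v _; rewrite lee_fin poisson_fun_ge0.
rewrite -ge0_integralZl//=; last by rewrite lee_fin ltW.
have mC : measurable_fun setT (fun y : Cn R d => C%:E * \int[mu]_v (poisson_fun n v y)%:E)%E.
  by apply: emeasurable_funM.
apply: (@le_trans _ _ (\int[sigma]_(y in A) (C%:E * \int[mu]_v (poisson_fun n v y)%:E))%E); last first.
  by apply: ge0_subset_integral => // y _; rewrite mule_ge0// lee_fin ltW.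
apply: ge0_le_integral => //.
- by move=> y Aw; rewrite lee_fin subr_ge0 expr_le1// ?normc_ge0// ltW// b1//; exact: shrinkB.
- exact/measurable_EFinP.
- exact: measurable_funS mC.
move=> y Aw; apply: le_trans (testC (radius_seq_in R n) (A1 Aw)) _.
rewrite lee_wpmul2l//; first by rewrite lee_fin ltW.
apply: (@ge0_integral_le_off_null _ _ R mu _ (fun v : Cn R d => poisson_fun n v y) (~` clBd)).
- by move=> v; rewrite lee_fin mulr_ge0 ?sqr_ge0// poisson_ge0.
- by move=> v; exact: poisson_fun_ge0.
- have mq : measurable_fun setT (fun v : Cn R d => (v, y) : Cn R d * Cn R d).
    exact: pair2_measurable.
  exact: (measurableT_comp (measurable_poisson_fun n) mq).
- by apply: measurableC; exact: measurable_clBd.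
- exact: mu_clBd.
- by move=> v /contrapT x1; rewrite poisson_funE.
Qed.

(** In the limit of [phi_le] the left side tends to the integral of 1 - |b|^2 over A, by
    uniform convergence, and the right side is at most the integral of the bound G. *)
Lemma averaged_bound :
  (\int[sigma]_(y in A) (1 - normc (bd_values b y) ^+ 2)%:E <=
   (C * (2 * M))%:E * \int[mu]_(x in A) ((1 - normc (bd_values b x) ^+ 2) ^+ 2)%:E)%E.
Proof.
have -> : ((C * (2 * M))%:E * \int[mu]_(x in A) ((1 - normc (bd_values b x) ^+ 2) ^+ 2)%:E
    = C%:E * \int[mu]_x (G x)%:E)%E.
  rewrite EFinM -muleA; congr (_ * _)%E; rewrite -ge0_integralZl//; last 3 first.
  - apply: (measurable_funS measurableT) => //.
    by apply/measurable_EFinP; exact: measurable_funX.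
  - by move=> x _; rewrite lee_fin sqr_ge0.
  - by rewrite lee_fin mulr_ge0// ltW.
  rewrite [LHS]integral_mkcond; apply: eq_integral => x _; rewrite patchE /G indicE.
  case: ifPn => _; last by rewrite mul0r.
  by rewrite -EFinM mul1r; congr (_%:E); ring.
apply/lee_addgt0Pr => e e0.
(* the errors are 2 e' on the left side and C e' on the right side *)
pose e' := e / (C + 2).
have C2 : 0 < C + 2 by rewrite addr_gt0.
have e'0 : 0 < e' by rewrite divr_gt0.
have [N HN] := uA e'0.
have [k _ Hk] : \forall n \near \oo, (\int[mu]_x (u n x)%:E < e'%:E)%E.
  apply: (int_u (t := [set v | (v < e'%:E)%E])); apply: open_nbhs_nbhs; split.
    exact: open_ereal_lt_ereal.
  by rewrite /= lte_fin.
pose n := maxn k N.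
have Nn : (N <= n)%N by exact: leq_maxr.
have Hn : (\int[mu]_x (u n x)%:E < e'%:E)%E by apply: Hk; exact: leq_maxl.
have phi0 y : A y -> 0 <= phi n y.
  by move=> Aw; rewrite subr_ge0 expr_le1// ?normc_ge0// ltW// b1//; exact: shrinkB.
apply: (@le_trans _ _ (\int[sigma]_(y in A) ((phi n y)%:E + (2 * e')%:E))%E).
  apply: ge0_le_integral => //.
  - move=> y Aw; rewrite lee_fin subr_ge0 expr_le1// ?normc_ge0//.
    exact: bd_values_le1.
  - by apply/measurable_EFinP; apply: (measurable_funS measurableT).
  - by apply/measurable_EFinP; apply: measurable_funD.
  - move=> y Aw; rewrite -EFinD lee_fin /phi.
    have h1 := HN n y Nn Aw; have h2 : normc (bd_values b y) <= 1 by exact: bd_values_le1.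
    have h3 : normc (b (shrink n y)) <= 1 by rewrite ltW// b1//; exact: shrinkB.
    have := le_normcD (b (shrink n y) - bd_values b y) (bd_values b y); rewrite subrK.
    have := normc_ge0 (b (shrink n y)); have := normc_ge0 (bd_values b y).
    by move: h1 h2 h3; nra.
rewrite ge0_integralD//; [|exact/measurable_EFinP|by move=> y _; rewrite lee_fin mulr_ge0// ltW].
apply: (@le_trans _ _ (C%:E * (\int[mu]_x (G x)%:E + e'%:E) + (2 * e')%:E)%E).
  apply: leeD.
    apply: le_trans (phi_le n) _; rewrite lee_wpmul2l//; first by rewrite lee_fin ltW.
    apply: (@le_trans _ _ (\int[mu]_x ((G x)%:E + (u n x)%:E))%E).
      apply: ge0_le_integral => //.
      by apply/measurable_EFinP; apply: measurable_funD.
    rewrite ge0_integralD//; last 4 first.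
    - by move=> x _; rewrite lee_fin.
    - exact/measurable_EFinP.
    - by move=> x _; rewrite lee_fin /u le_max lexx orbT.
    - exact/measurable_EFinP.
    by rewrite leeD2l// ltW.
  rewrite integral_cst// -[leRHS]mule1 lee_wpmul2l//.
    by rewrite lee_fin mulr_ge0// ltW.
  exact: (@probability_le1 _ _ R sigma).
rewrite ge0_muleDr; last 2 first.
- by apply: integral_ge0 => x _; rewrite lee_fin.
- by rewrite lee_fin ltW.
rewrite -addeA leeD2l// -EFinM -EFinD lee_fin -mulrDl.
by rewrite /e' mulrC divfK ?gt_eqF.
Qed.

End poisson_averages.

(** * From closed sets to points *)

Section localization.
Context (R : realType) (d : nat) (P : {finite_measure set (Cn R d) -> \bar R}).

(** If f exceeds h by 1 / (k + 1) on a set of positive measure, then, by Egorov's theorem and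
    regularity, also on a closed set A of positive measure on which v tends to 0 uniformly.
    This contradicts the comparison of the integrals over A. *)
Lemma le_off_null_of_closed (B : set (Cn R d)) (f h : Cn R d -> R) (v : (Cn R d -> R)^nat) :
  measurable B -> measurable_fun setT f -> measurable_fun setT h ->
  P.-integrable B (EFin \o f) -> P.-integrable B (EFin \o h) ->
  (forall n, measurable_fun setT (v n)) ->
  (forall z, B z -> v ^~ z @ \oo --> (0 : R)) ->
  (forall A : set (Cn R d), measurable A -> closed (A : set 'rV[R[i]]_d) -> A `<=` B ->
    (forall e : R, 0 < e -> exists N, forall n z, (N <= n)%N -> A z -> v n z <= e) ->
    (\int[P]_(z in A) (f z)%:E <= \int[P]_(z in A) (h z)%:E)%E) ->
  P (B `&` [set z | h z < f z]) = 0%E.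
Proof.
move=> mB mf mh If Ih mv v0 H.
pose Bk k : set (Cn R d) := B `&` [set z | h z + k.+1%:R^-1 <= f z].
have mBk k : measurable (Bk k).
  by apply: measurableI => //; apply: measurable_sub_le => //; exact: measurable_funD.
have -> : B `&` [set z | h z < f z] = \bigcup_k Bk k.
  apply/seteqP; split => [z [Bz /= hf]|z [k _ [Bz /= hf]]]; last first.
    by split => //=; apply: lt_le_trans hf; rewrite ltrDl.
  have p0 : 0 < f z - h z by rewrite subr_gt0.
  have [k _ /(_ k (leqnn k)) Hk] := @near_infty_natSinv_lt R (PosNum p0).
  by exists k => //; split => //=; rewrite addrC -lerBrDr ltW.
apply: measure_negligible; first exact: bigcup_measurable.
apply: negligible_bigcup => k; apply/negligibleP => //.
apply/eqP; rewrite eq_le measure_ge0 andbT leNgt; apply/negP => p0.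
have fB : P (Bk k) \is a fin_num by exact: fin_num_measure.
have s0 : 0 < fine (P (Bk k)) by rewrite -lte_fin fineK.
have [E [mE Elt unif]] := @pointwise_almost_uniform _ R _ P v (cst 0) (Bk k) (fine (P (Bk k)))
  (fun n => measurable_funS measurableT (@subsetT _ _) (mv n)) (mBk k)
  ltac:(by rewrite -ge0_fin_numE) (fun z Bz => v0 z Bz.1) s0.
have mD : measurable (Bk k `\` E) by exact: measurableD.
have D0 : (0 < P (Bk k `\` E))%E.
  rewrite measureD//; last by rewrite -ge0_fin_numE.
  rewrite sube_gt0; apply: le_lt_trans (_ : (P E < _)%E); last by rewrite fineK in Elt.
  by apply: le_measure; rewrite ?inE//; exact: measurableI.
have fD : P (Bk k `\` E) \is a fin_num by exact: fin_num_measure.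
have [A [cA mA AD Alt]] := closed_inner_regular P mD
  (ltac:(by rewrite -lte_fin fineK) : 0 < fine (P (Bk k `\` E))).
have AB : A `<=` B by move=> z /AD[[]].
have A0 : (0 < P A)%E.
  rewrite lt_neqAle measure_ge0 andbT eq_sym; apply/eqP => PA.
  move: Alt; rewrite fineK// measureD//; last by rewrite -ge0_fin_numE.
  rewrite [X in (_ - X)%E](_ : _ = 0%E) ?sube0 ?ltxx//.
  by rewrite -PA; congr (P _); exact/setIidr.
have fA : P A \is a fin_num by exact: fin_num_measure.
have IfA : P.-integrable A (EFin \o f) by exact: integrableS If.
have IhA : P.-integrable A (EFin \o h) by exact: integrableS Ih.
have small (e : R) : 0 < e -> exists N, forall n z, (N <= n)%N -> A z -> v n z <= e.
  move=> e0.
  have : nbhs (cst 0 : {uniform` (Bk k `\` E) -> R})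
      [set g : {uniform` (Bk k `\` E) -> R} | forall y, (Bk k `\` E) y -> `|g y| < e].
    apply/uniform_nbhs; exists [set xy : R * R | ball xy.1 e xy.2]; split.
      exact: entourage_ball (PosNum e0).
    by move=> g Hg y Dy; have := Hg y Dy; rewrite /ball /= sub0r normrN.
  move=> /unif[N _ HN]; exists N => n z Nn Az.
  by apply: le_trans (ler_norm _) _; apply: ltW; apply: HN => //; exact: AD.
have Ic : P.-integrable A (EFin \o cst (k.+1%:R^-1 : R)) by exact: finite_measure_integrable_cst.
have : (\int[P]_(z in A) ((h z)%:E + (k.+1%:R^-1)%:E) <= \int[P]_(z in A) (f z)%:E)%E.
  apply: le_integral => //; first exact: integrableD.
  by move=> z; rewrite inE => /AD[[_ le] _]; rewrite -EFinD lee_fin.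
move=> le2; have := le_trans le2 (H A mA cA AB small).
rewrite integralD// integral_cst//.
have fh : (\int[P]_(z in A) (h z)%:E)%E \is a fin_num by exact: integrable_fin_num.
rewrite -[leRHS]adde0 leeD2lE// leNgt mule_gt0//.
Qed.

End localization.

(** * Reverse Carleson measures *)

Theorem theorem2 (R : realType) (d : nat) (d_gt0 : (0 < d)%N)
  (mu : {finite_measure set (Cn R d) -> \bar R})
  (mu_clBd : mu (~` clBd) = 0%E)
  (b : 'rV[R[i]]_d -> R[i])
  (b_disk : forall z, Bd z -> normc (b z) < 1)
  (b_adm : admissible mu b)
  (Hb : rkhs Bd (dbr_kernel b))
  (mu_a mu_s : {finite_measure set (Cn R d) -> \bar R})
  (mu_dec : @lebesgue_decomposition _ (Cn R d) R
    (fun A : set (Cn R d) => mu (A `&` Sd)) (sphere_measure R d)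
    mu_a mu_s) :
  let g := 'd (charge_of_finite_measure mu_a) '/d (sphere_measure R d) in
  reverse_carleson Hb mu ->
  exists2 C : R, 0 < C &
    {ae sphere_measure R d, forall z, Sd z ->
      ((1 - normc (radial_lim b z) ^+ 2)%:E <=
       (C * (1 - normc (radial_lim b z) ^+ 2) ^+ 2)%:E * g z)%E}.
Proof.
move=> g rc.
have hb := b_adm.1; have cb := holomorphic_bd_cts hb.
have [M M0 HM] := poisson_integral_le R d_gt0.
have [C C0 HC] := poisson_test mu_clBd b_disk b_adm rc.
have [dec ac [N [mN sN N0]]] := mu_dec.
pose K := C * (2 * M); have K0 : 0 < K by rewrite !mulr_gt0.
exists K => //.
have gfin z : g z \is a fin_num by exact: Radon_Nikodym_fin_num.
have ig : (sphere_measure R d).-integrable setT g by exact: Radon_Nikodym_integrable.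
pose gam (z : Cn R d) : R := fine (g z).
have gE z : g z = (gam z)%:E by rewrite fineK.
have mgam : measurable_fun setT gam.
  apply/measurable_EFinP; rewrite (_ : _ \o _ = g); first exact: (measurable_int _ ig).
  by apply/funext => z; rewrite gE.
pose phi (z : Cn R d) : R := 1 - normc (bd_values b z) ^+ 2.
have phi01 z : 0 <= phi z <= 1.
  rewrite subr_ge0 expr_le1// ?normc_ge0// gerBl sqr_ge0 andbT.
  exact: bd_values_le1.
have mphi : measurable_fun setT phi.
  by apply: measurable_funB => //; apply: measurable_sqr_normc; exact: cmeasurable_bd_values.
pose q (z : Cn R d) : R := phi z ^+ 2 * gam z.
have mq : measurable_fun setT q by apply: measurable_funM => //; exact: measurable_funX.
have iq : (sphere_measure R d).-integrable setT (EFin \o q).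
  apply: le_integrable ig => //; first exact/measurable_EFinP.
  move=> z _; rewrite gE /= lee_fin normrM ler_piMl// ger0_norm ?sqr_ge0//.
  by have /andP[p0 p1] := phi01 z; rewrite expr_le1.
have mr : measurable (radial_points b).
  by apply: measurableI; [exact: measurable_Sd|exact: measurable_radial_cauchy].
(* off N, a carrier of the singular part, the measure mu restricted to the sphere is g sigma *)
pose B := radial_points b `\` N.
have mB : measurable B by exact: measurableD.
pose v n (z : Cn R d) : R :=
  normc (bd_restrict b ((1 - n.+2%:R^-1)%:C *: (z : 'rV[R[i]]_d)) - bd_values b z).
have vE n z : radial_points b z ->
    v n z = normc (b ((1 - n.+2%:R^-1)%:C *: (z : 'rV[R[i]]_d)) - bd_values b z).
  move=> zr; rewrite /v /bd_restrict ifT//; apply: radius_Bd; first by case: zr.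
  by have /andP[e0 e1] := @radius_seq_in R n; rewrite subr_ge0 e1 ltrBlDr ltrDl.
have null : sphere_measure R d (B `&` [set z | K * q z < phi z]) = 0%E.
  apply: (@le_off_null_of_closed R d (sphere_measure R d) B phi (fun z => K * q z) v) => //.
  - exact: measurable_funM.
  - apply: (integrableS measurableT) => //.
    apply: (@le_integrable _ _ _ _ _ _ _ (EFin \o cst (1 : R))) => //.
    + exact/measurable_EFinP.
    + move=> z _; rewrite /= lee_fin normr1 ger0_norm; by case/andP: (phi01 z).
    + exact: finite_measure_integrable_cst.
  - apply: (integrableS measurableT) => //.
    rewrite (_ : _ \o _ = fun z => (K%:E * (q z)%:E)%E)//.
    exact: integrableZl.
  - move=> n; apply: measurable_normc; apply: cmeasurableB; last exact: cmeasurable_bd_values.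
    have ms : measurable_fun setT (fun z : Cn R d => (1 - n.+2%:R^-1 : R)%:C *: (z : 'rV[R[i]]_d) : Cn R d).
      by apply: measurable_scale_fun => //; exact: cmeasurable_cst.
    exact: (cmeasurable_comp (cmeasurable_bd_restrict cb) ms).
  - move=> z [zr _]; rewrite (_ : v ^~ z = fun n =>
      normc (b ((1 - n.+2%:R^-1)%:C *: (z : 'rV[R[i]]_d)) - bd_values b z)).
      exact/has_rlim_seq/bd_values_rlim.
    by apply/funext => n; rewrite vE.
  - move=> A mA cA AB uA.
    have Ar : A `<=` radial_points b by move=> z /AB[].
    have iqA : (sphere_measure R d).-integrable A (EFin \o q) by exact: integrableS iq.
    have uA' (e : R) : 0 < e -> exists n0, forall n z, (n0 <= n)%N -> A z ->
        normc (b ((1 - n.+2%:R^-1)%:C *: (z : 'rV[R[i]]_d)) - bd_values b z) <= e.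
      move=> e0; have [n0 Hn] := uA e e0; exists n0 => n z nn Az.
      by rewrite -vE//; [exact: Hn|exact: Ar].
    have := averaged_bound d_gt0 cb b_disk mA cA Ar uA' mu_clBd M0 HM C0 HC.
    suff -> : (\int[mu]_(z in A) ((1 - normc (bd_values b z) ^+ 2) ^+ 2)%:E =
        \int[sphere_measure R d]_(z in A) (q z)%:E)%E.
      move=> le; rewrite [leRHS](_ : _ = \int[sphere_measure R d]_(z in A) (K%:E * (q z)%:E))%E//.
      by rewrite integralZl.
    rewrite (@eq_measure_integral _ _ _ _ mu_a); last first.
      move=> X mX XA; have := dec X mX.
      have -> : X `&` Sd = X by apply/setIidl => z /XA/Ar[].
      have -> : mu_s X = 0%E; last by rewrite adde0.
      apply: (@subset_measure0 _ _ _ mu_s _ (~` N)) => //; first exact: measurableC.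
      by move=> z /XA/AB[].
    rewrite -(Radon_Nikodym_change_of_variables ac) => //.
      by apply: eq_integral => z _; rewrite [X in (_ * X)%E]gE -EFinM.
    apply: (@le_integrable _ _ _ _ _ _ _ (EFin \o cst (1 : R))) => //.
    + apply: (measurable_funS measurableT) => //.
      by apply/measurable_EFinP; exact: measurable_funX.
    + move=> z _; rewrite /= lee_fin normr1 ger0_norm ?sqr_ge0//.
      by have /andP[p0 p1] := phi01 z; rewrite expr_le1.
    + exact: finite_measure_integrable_cst.
have aeF : Filter (nbhs (almost_everywhere (sphere_measure R d))) :=
  ae_filter_ringOfSetsType (sphere_measure R d).
have aeN : {ae sphere_measure R d, forall z, ~ N z}.
  by exists N; split => // z /= /contrapT.
have aeB : {ae sphere_measure R d, forall z, ~ (B `&` [set z | K * q z < phi z]) z}.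
  exists (B `&` [set z | K * q z < phi z]); split => //.
    apply: measurableI => //; apply: measurable_sub_lt => //; exact: measurable_funM.
  by move=> z /= /contrapT.
have aeL := sphere_fatou hb b_disk.
apply: filterS3 aeL aeN aeB => z zL nN nB z1; have [L HL] := zL z1.
have zr : radial_points b z by split => //; exact: rlim_cauchy HL.
have <- : bd_values b z = radial_lim b z.
  by rewrite (rlim_radial_lim (bd_values_rlim cb zr)).
rewrite gE -EFinM lee_fin -mulrA leNgt; apply/negP => lt.
by apply: nB; split => //; split.
Qed.
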